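(* The sets $Z_v$, $v\in V$, form a covering of $Z$. As a consequence, $Z$ is a smooth submanifold of $\mathbb{C}^F$ of real dimension $n+d$, where $d=\#(F)$. The action of the torus $N$ on $Z$ is free, and we have a reduced phase space $M:=Z/N$, which is a compact and connected smooth $2n$-dimensional symplectic manifold, which carries an effective Hamiltonian $T$-action with momentum mapping $\mu_T:M\to\mathfrak{t}^*$ determined by $\pi^*\circ\mu_T\circ p=(\mu-\lambda)|_Z$, where $p:Z\to M$ is the canonical projection. The sets $M_v$, $v\in V$, form an open covering of $M$ and the $\varphi_v:=(\psi_v)^{-1}:M_v\to U_v$ form an atlas of $T$-equivariant symplectic coordinatizations of the Hamiltonian $T$-space $M$. For each $v\in V$, we have $M_v=\mu_T^{-1}(\Delta_v)$, and $\mu_T|_{M_v}=\mu_v\circ\varphi_v$.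
   Context: For a finite set $B$ and a set $A$, $A^B$ is the set of functions $B\to A$; for $z\in A^B$ write $z_f=z(f)$. Let $T$ be an $n$-dimensional torus (compact, connected, commutative Lie group) with Lie algebra $\mathfrak{t}$, exponential map $\exp:\mathfrak{t}\to T$, and integral lattice $\mathfrak{t}_{\mathbb{Z}}:=\ker(\exp)$; the induced isomorphism $\mathfrak{t}/\mathfrak{t}_{\mathbb{Z}}\to T$ is also denoted $\exp$. Let $\Delta\subset\mathfrak{t}^*$ be an $n$-dimensional convex polytope, $F$ the set of its codimension one faces, $V$ the set of its vertices, and $F_v=\{f\in F\mid v\in f\}$ for $v\in V$. Assume $\Delta$ is a Delzant polytope: (i) for each $f\in F$ there are $X_f\in\mathfrak{t}$, $\lambda_f\in\mathbb{R}$ such that the hyperplane containing $f$ is $\{\xi\mid\langle X_f,\xi\rangle+\lambda_f=0\}$ and $\Delta\subset\{\xi\mid\langle X_f,\xi\rangle+\lambda_f\ge 0\}$ (with $X_f$ normalized to be primitive in $\mathfrak{t}_{\mathbb{Z}}$, which makes $X_f,\lambda_f$ unique); (ii) for every $v\in V$ the $X_f$, $f\in F_v$, form a $\mathbb{Z}$-basis of $\mathfrak{t}_{\mathbb{Z}}$. Hence $\#F_v=n$ and $\Delta=\{\xi\in\mathfrak{t}^*\mid\langle X_f,\xi\rangle+\lambda_f\ge0\ \forall f\in F\}$. Let $\pi:\mathbb{R}^F\to\mathfrak{t}$, $\pi(t)=\sum_{f\in F}t_fX_f$, and let $\pi':\mathbb{R}^F/\mathbb{Z}^F\to\mathfrak{t}/\mathfrak{t}_{\mathbb{Z}}$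 be the induced surjective homomorphism. Put $\mathfrak{n}=\ker\pi$ and $N=\ker(\exp\circ\pi')\subset\mathbb{R}^F/\mathbb{Z}^F$ (a torus with Lie algebra $\mathfrak{n}$). The torus $\mathbb{R}^F/\mathbb{Z}^F$ acts on $\mathbb{C}^F$ by $(t\cdot z)_f=e^{2\pi i t_f}z_f$. On $\mathbb{C}^F$ put the symplectic form $\sigma=\frac{1}{2\pi}\sum_{f\in F}dx_f\wedge dy_f$, $z_f=x_f+iy_f$. Convention: a momentum map $\mu$ satisfies that the infinitesimal action vector field $Y_M$ of $Y$ has $\iota_{Y_M}\sigma=-d\langle Y,\mu\rangle$; the momentum map of the $\mathbb{R}^F/\mathbb{Z}^F$-action is $\mu:\mathbb{C}^F\to(\mathbb{R}^F)^*\simeq\mathbb{R}^F$, $\mu(z)_f=|z_f|^2/2$. Let $\iota_{\mathfrak n}^*:(\mathbb{R}^F)^*\to\mathfrak{n}^*$ be restriction to $\mathfrak{n}$, $\lambda=(\lambda_f)_{f\in F}\in(\mathbb{R}^F)^*$, $\mu_N=\iota_{\mathfrak n}^*\circ\mu$, $\lambda_N=\iota_{\mathfrak n}^*(\lambda)$, and $Z:=\mu_N^{-1}(\{\lambda_N\})\subset\mathbb{C}^F$, which is $\mathbb{R}^F/\mathbb{Z}^F$-invariant. The symplectic form $\sigma_M$ on $M=Z/N$ is the unique one with $p^*\sigma_M=\sigma|_Z$, and $T\simeq(\mathbb{R}^F/\mathbb{Z}^F)/N$ (via $\exp\circ\pi'$) acts on $M$. For $v\in V$: $\rho_v:\mathbb{C}^F\to\mathbb{C}^{F_v}$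 is restriction of functions to $F_v$; $U_v$ is the interior of $\rho_v(Z)$ in $\mathbb{C}^{F_v}$; $Z_v:=\rho_v^{-1}(U_v)\cap Z$; $M_v:=Z_v/N\subset M$; $\Delta_v:=\Delta\setminus\bigcup_{f'\in F\setminus F_v}f'$; $\mu_v:\mathbb{C}^{F_v}\to\mathfrak{t}^*$ is defined by $|z_f|^2/2-\lambda_f=\langle X_f,\mu_v(z)\rangle$ for all $f\in F_v$. For $f\in F$, $r_f:\Delta\to\mathbb{R}_{\ge0}$ is $r_f(\xi)=(2(\langle X_f,\xi\rangle+\lambda_f))^{1/2}$. The map $s_v:U_v\to Z_v$ is given by $s_v(z)_f=z_f$ for $f\in F_v$ and $s_v(z)_{f'}=r_{f'}(\mu_v(z))$ for $f'\in F\setminus F_v$, and $\psi_v:U_v\to M_v$ is $s_v$ followed by the projection $Z_v\to M_v$; $\psi_v$ is a $T$-equivariant symplectomorphism from $U_v$ onto $M_v$. The embedding $\iota_v:\mathbb{R}^{F_v}/\mathbb{Z}^{F_v}\to\mathbb{R}^F/\mathbb{Z}^F$ extends by zero on $F\setminus F_v$; $\exp\circ\pi'\circ\iota_v:\mathbb{R}^{F_v}/\mathbb{Z}^{F_v}\to T$ is an isomorphism, and $T$ acts on $\mathbb{C}^{F_v}$ through its inverse and the action $(t\cdot z)_f=e^{2\pi i t_f}z_f$. $\mathbb{C}^{F_v}$ carries the symplectic form $\frac{1}{2\pi}\sum_{f\in F_v}dx_f\wedge dy_f$. *)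

(* Defs.v *)
From HB Require Import structures.
From mathcomp Require Import all_boot all_order all_algebra.
From mathcomp Require Import all_classical all_reals all_analysis.
From mathcomp Require Import ring.

Set Implicit Arguments.
Unset Strict Implicit.
Unset Printing Implicit Defensive.

Import Order.TTheory GRing.Theory Num.Theory.
Import numFieldNormedType.Exports.

Local Open Scope classical_set_scope.
Local Open Scope ring_scope.

Section SmoothMaps.
Context {R : realType}.

(* For finite-dimensional [V]: [f] is [k] times continuously differentiable on
   the open set [O]. *)
Fixpoint Ck {V W : normedModType R} (k : nat) (O : set V) (f : V -> W) : Prop :=
  if k is k'.+1 then
    (forall x, O x -> differentiable f x) /\
    (forall v : V, Ck k' O (fun x => 'D_v f x))
  else forall x, O x -> {for x, continuous f}.

Definition smooth {V W : normedModType R} (O : set V) (f : V -> W) : Prop :=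
  forall k, Ck k O f.

(* [f], restricted to [D], is locally of the form [g \o e] with [g] smooth.
   With [e] a chart, this says that [f] is smooth on [D] in that chart; with [e]
   the inclusion of a subset of [V], that [f] locally extends to a smooth map
   on an open subset of [V]. *)
Definition smooth_via {X : Type} {V W : normedModType R}
    (e : X -> V) (D : set X) (f : X -> W) : Prop :=
  forall x, D x -> exists O : set V, exists g : V -> W,
    [/\ open O, O (e x), smooth O g &
        forall y, D y -> O (e y) -> f y = g (e y)].

Definition smooth_on {V W : normedModType R} (S : set V) (f : V -> W) : Prop :=
  smooth_via id S f.

(* Slice charts: [h] is a diffeomorphism from an open neighbourhood of [x] onto
   an open subset of R^k x R^l, mapping [S] to R^k x {0}. *)
Definition smooth_submanifold {V : normedModType R} (S : set V) (k : nat) : Prop :=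
  forall x, S x -> exists (l : nat) (O : set V) (h : V -> 'rV[R]_k * 'rV[R]_l),
    [/\ open O, O x, smooth O h, set_inj O h & open (h @` O)] /\
    smooth_via h O id /\
    O `&` S = O `&` [set y | (h y).2 = 0].

End SmoothMaps.

(* The model space may depend on the chart, so that coordinates in C^J can be
   used for varying index sets J. *)
Record atlas (R : realType) (X : topologicalType) := Atlas {
  idx : Type;
  model : idx -> normedModType R;
  dom : idx -> set X;
  chart : forall i, X -> model i }.

Arguments model {R X} a i.
Arguments dom {R X} a i _.
Arguments chart {R X} a i _.

Section Manifolds.
Context {R : realType}.
Local Notation atlas := (@atlas R).

Definition has_dim (E : normedModType R) (m : nat) : Prop :=
  exists f : {linear 'rV[R]_m -> E}, bijective f.

Definition smooth_atlas {X : topologicalType} (m : nat) (A : atlas X) : Prop :=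
  [/\ forall i, has_dim (model A i) m,
      forall i, open (dom A i),
      \bigcup_(i in [set: idx A]) dom A i = [set: X],
      forall i, [/\ {within dom A i, continuous (chart A i)},
                    set_inj (dom A i) (chart A i) &
                    forall U, open U -> U `<=` dom A i ->
                      open (chart A i @` U)] &
      forall i j, smooth_via (chart A i) (dom A i `&` dom A j) (chart A j)].

Definition smooth_manifold {X : topologicalType} (m : nat) (A : atlas X) : Prop :=
  [/\ hausdorff_space X, @second_countable X & smooth_atlas m A].

Definition flat_atlas (V : normedModType R) : atlas V :=
  @Atlas R V unit (fun=> V) (fun=> setT) (fun=> id).

Definition prod_atlas {X Y : topologicalType} (A : atlas X) (B : atlas Y) :
    atlas (X * Y)%type :=
  @Atlas R (X * Y)%type (idx A * idx B)%type
    (fun ij => (model A ij.1 * model B ij.2)%type)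
    (fun ij => dom A ij.1 `*` dom B ij.2)
    (fun ij z => (chart A ij.1 z.1, chart B ij.2 z.2)).

Definition smooth_map {X Y : topologicalType} (A : atlas X) (B : atlas Y)
    (f : X -> Y) : Prop :=
  continuous f /\
  forall i j, smooth_via (chart A i) (dom A i `&` f @^-1` dom B j)
                (fun x => chart B j (f x)).

(* A 2-form is given by its coordinate expressions: [w i a u v] is the value, at
   the point with coordinates [a] in the chart [i], on the tangent vectors with
   coordinates [u] and [v]; only points [a] in the image of the chart matter. *)
Definition two_form {X : topologicalType} (A : atlas X) : Type :=
  forall i : idx A, model A i -> model A i -> model A i -> R.

(* [w] is the pull-back of [w'] under [f]; [g] is any map representing [f] in
   the coordinates [i] and [j]. *)
Definition pullback_eq {X Y : topologicalType} (A : atlas X) (B : atlas Y)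
    (f : X -> Y) (w' : two_form B) (w : two_form A) : Prop :=
  forall i j (g : model A i -> model B j),
    (forall y, dom A i y -> dom B j (f y) -> g (chart A i y) = chart B j (f y)) ->
    forall x, dom A i x -> dom B j (f x) -> forall u v,
      w' j (chart B j (f x)) ('d g (chart A i x) u) ('d g (chart A i x) v) =
      w i (chart A i x) u v.

(* Compatibility of the coordinate expressions is invariance under the identity
   map; the last two clauses say that the form is closed and nondegenerate. *)
Definition symplectic_form {X : topologicalType} (A : atlas X)
    (w : two_form A) : Prop :=
  pullback_eq id w w /\
  forall i, let c := chart A i in
  [/\ forall x, dom A i x -> forall a u u' v,
        w i (c x) (a *: u + u') v = a * w i (c x) u v + w i (c x) u' v,
      forall x, dom A i x -> forall u, w i (c x) u u = 0,
      forall u v, smooth_on (c @` dom A i) (fun b => w i b u v),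
      forall x, dom A i x -> forall u1 u2 u3,
        'D_u1 (fun b => w i b u2 u3) (c x) + 'D_u2 (fun b => w i b u3 u1) (c x)
        + 'D_u3 (fun b => w i b u1 u2) (c x) = 0 &
      forall x, dom A i x -> forall u, (forall v, w i (c x) u v = 0) -> u = 0].

End Manifolds.

Definition pairing {R : realType} {n : nat} (Y xi : 'rV[R]_n) : R :=
  \sum_i Y ord0 i * xi ord0 i.

(* [T] is a compact connected commutative Lie group of dimension [n]. Its Lie
   algebra is identified with R^n (and the dual of the latter with R^n via
   [pairing]); under such an identification the exponential map is a smooth
   homomorphism R^n -> T which restricts to a diffeomorphism from a neighbourhood
   of 0 onto a neighbourhood of the unit. *)
Definition torus_with_exp {R : realType} {n : nat} {T : topologicalZmodType}
    (AT : atlas R T) (texp : {additive 'rV[R]_n -> T}) : Prop :=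
  [/\ smooth_manifold n AT, compact [set: T], connected [set: T],
      smooth_map (prod_atlas AT AT) AT (fun st => st.1 + st.2) &
      smooth_map AT AT -%R] /\
  smooth_map (flat_atlas 'rV[R]_n) AT texp /\
  exists O : set 'rV[R]_n,
    [/\ open O, O 0, set_inj O texp, open (texp @` O) &
        forall a, smooth_via (fun Y => chart AT a (texp Y))
                    (O `&` texp @^-1` dom AT a) id].

Section Polytopes.
Context {R : realType} {n : nat}.
Implicit Types (S D : set 'rV[R]_n).

Definition affine_dim S (k : nat) : Prop :=
  exists2 x0, S x0 & exists A : 'M[R]_(k, n),
    [/\ row_free A, forall i, S (x0 + row i A) &
        forall x, S x -> (x - x0 <= A)%MS].

Definition convex_polytope D : Prop :=
  bounded_set D /\
  exists (m : nat) (Y : 'I_m -> 'rV[R]_n) (c : 'I_m -> R),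
    D = [set xi | forall i, 0 <= pairing (Y i) xi + c i].

Definition is_face D S : Prop :=
  exists (Y : 'rV[R]_n) (c : R),
    (forall xi, D xi -> 0 <= pairing Y xi + c) /\
    S = D `&` [set xi | pairing Y xi + c = 0] /\ S !=set0.

Definition is_facet D S : Prop :=
  is_face D S /\ exists2 k, k.+1 = n & affine_dim S k.

Definition vertices D : set 'rV[R]_n := [set v | is_face D [set v]].

End Polytopes.

(* [F] indexes the facets of [Delta]; [normal] and [offset] are the X_f and lambda_f. *)
Record polytope_data (R : realType) (n : nat) (F : finType) := PolytopeData {
  Delta : set 'rV[R]_n;
  facet : F -> set 'rV[R]_n;
  normal : F -> 'rV[R]_n;
  offset : F -> R }.

Section Delzant.
Context {R : realType} {n : nat} {F : finType}.
Variable P : polytope_data R n F.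

Definition facets_at (v : 'rV[R]_n) : {set F} := [set f | `[< facet P f v >]]%SET.

Definition facet_index (v : 'rV[R]_n) : finType := {f : F | f \in facets_at v}.

Definition delzant {T : zmodType} (texp : {additive 'rV[R]_n -> T}) : Prop :=
  let lattice := [set Y : 'rV[R]_n | texp Y = 0] in
  [/\ convex_polytope (Delta P) /\ affine_dim (Delta P) n,
      injective (facet P) /\
        (forall S, is_facet (Delta P) S <-> exists f, facet P f = S),
      forall f,
        facet P f `<=` [set xi | pairing (normal P f) xi + offset P f = 0] /\
        Delta P `<=` [set xi | 0 <= pairing (normal P f) xi + offset P f],
      forall f, lattice (normal P f) /\
        (forall (k : nat) Y, lattice Y -> normal P f = Y *+ k -> k = 1%N) &
      forall v, vertices (Delta P) v ->
        (forall Y, lattice Y ->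
           exists c : F -> int, Y = \sum_(f in facets_at v) normal P f *~ c f) /\
        (forall c : F -> int, \sum_(f in facets_at v) normal P f *~ c f = 0 ->
           forall f, f \in facets_at v -> c f = 0)].

End Delzant.

(* z = x + iy in C^I is stored as the pair (x, y). *)
Definition Cspace (R : realType) (I : finType) : normedModType R :=
  ('rV[R]_#|I| * 'rV[R]_#|I|)%type.

Section ComplexSpace.
Context {R : realType}.

Definition mkC {I : finType} (x y : I -> R) : Cspace R I :=
  (\row_j x (enum_val j), \row_j y (enum_val j)).

Context {I : finType}.
Implicit Types (z u w : Cspace R I).

Definition rePart z (i : I) : R := z.1 ord0 (enum_rank i).
Definition imPart z (i : I) : R := z.2 ord0 (enum_rank i).

(* |z_i|^2 / 2 *)
Definition mu z (i : I) : R := (rePart z i ^+ 2 + imPart z i ^+ 2) / 2.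

(* (t . z)_i = e^{2 pi i t_i} z_i. Elements of R^I / Z^I are given by
   representatives in R^I throughout. *)
Definition rotate (t : I -> R) z : Cspace R I :=
  mkC (fun i => cos (2 * pi * t i) * rePart z i - sin (2 * pi * t i) * imPart z i)
      (fun i => sin (2 * pi * t i) * rePart z i + cos (2 * pi * t i) * imPart z i).

(* (1 / 2 pi) \sum_i dx_i /\ dy_i *)
Definition sigma u w : R :=
  (2 * pi)^-1 * \sum_i (rePart u i * imPart w i - imPart u i * rePart w i).

Lemma rePart_mkC (x y : I -> R) i : rePart (mkC x y) i = x i.
Proof. by rewrite /rePart mxE enum_rankK. Qed.

Lemma imPart_mkC (x y : I -> R) i : imPart (mkC x y) i = y i.
Proof. by rewrite /imPart mxE enum_rankK. Qed.

Lemma Cspace_ext z w :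
  (forall i, rePart z i = rePart w i) -> (forall i, imPart z i = imPart w i) ->
  z = w.
Proof.
case: z w => [x y] [x' y'] /= hre him; congr (_, _); apply/rowP => j.
  by have := hre (enum_val j); rewrite /rePart enum_valK.
by have := him (enum_val j); rewrite /imPart enum_valK.
Qed.

Lemma rotate0 z : rotate (fun=> 0) z = z.
Proof.
apply: Cspace_ext => i; rewrite (rePart_mkC, imPart_mkC) mulr0 cos0 sin0.
  by rewrite mul1r mul0r subr0.
by rewrite mul1r mul0r add0r.
Qed.

Lemma rotateD s t z : rotate (fun i => s i + t i) z = rotate s (rotate t z).
Proof.
apply: Cspace_ext => i; rewrite !(rePart_mkC, imPart_mkC) mulrDr cosD sinD; ring.
Qed.

Lemma mu_rotate t z i : mu (rotate t z) i = mu z i.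
Proof.
rewrite /mu rePart_mkC imPart_mkC; congr (_ / _).
have := cos2Dsin2 (2 * pi * t i).
set c := cos _; set s := sin _; set x := rePart z i; set y := imPart z i => h.
by rewrite -[RHS]mul1r -h; ring.
Qed.

End ComplexSpace.

Section Reduction.
Context {R : realType} {n : nat} {F : finType} {T : zmodType}.
Variables (P : polytope_data R n F) (texp : {additive 'rV[R]_n -> T}).
Implicit Types (t : F -> R) (v xi : 'rV[R]_n).

(* pi : R^F -> t, and its transpose, with R^F identified with its dual *)
Definition piF t : 'rV[R]_n := \sum_f t f *: normal P f.
Definition piF_dual xi : F -> R := fun f => pairing (normal P f) xi.

(* preimage of N in R^F *)
Definition in_N t : Prop := texp (piF t) = 0.

(* mu_N z = lambda_N, as linear forms on the kernel of pi *)
Definition Zset : set (Cspace R F) :=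
  [set z | forall Y : F -> R, piF Y = 0 ->
     \sum_f Y f * mu z f = \sum_f Y f * offset P f].

Definition Ztype : topologicalType := set_type Zset.

Lemma rotate_Zset t (z : Ztype) : rotate t (val z) \in Zset.
Proof.
apply/mem_set => Y hY; have /set_mem/(_ Y hY) <- := valP z.
by apply: eq_bigr => f _; rewrite mu_rotate.
Qed.

Definition rotateZ t (z : Ztype) : Ztype :=
  exist (fun x => x \in Zset) _ (rotate_Zset t z).

Definition N_orbit_rel (z w : Ztype) : bool :=
  `[< exists2 t, in_N t & w = rotateZ t z >].

Lemma in_N0 : in_N (fun=> 0).
Proof.
by rewrite /in_N /piF big1 ?raddf0 // => f _; rewrite scale0r.
Qed.

Lemma in_ND s t : in_N s -> in_N t -> in_N (fun f => s f + t f).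
Proof.
rewrite /in_N /piF => hs ht.
under eq_bigr do rewrite scalerDl.
by rewrite big_split raddfD /= hs ht addr0.
Qed.

Lemma in_NN t : in_N t -> in_N (fun f => - t f).
Proof.
rewrite /in_N /piF => ht.
under eq_bigr do rewrite scaleNr.
by rewrite sumrN raddfN /= ht oppr0.
Qed.

Lemma N_orbit_equiv : equiv_class_of N_orbit_rel.
Proof.
split.
- move=> z; apply/asboolP; exists (fun=> 0); first exact: in_N0.
  by apply: val_inj; rewrite /= rotate0.
- have sym z w : N_orbit_rel z w -> N_orbit_rel w z.
    move=> /asboolP[t ht ->]; apply/asboolP; exists (fun f => - t f).
      exact: in_NN.
    apply: val_inj; rewrite /= -rotateD -[LHS]rotate0; congr (rotate _ _).
    by apply/funext => f; rewrite addNr.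
  by move=> z w; apply/idP/idP; exact: sym.
- move=> w z x /asboolP[s hs ->] /asboolP[t ht ->]; apply/asboolP.
  exists (fun f => t f + s f); first exact: in_ND.
  by apply: val_inj; rewrite /= rotateD.
Qed.

Canonical N_orbit_equivRel := EquivRelPack N_orbit_equiv.

Definition Mspace : topologicalType :=
  quotient_topology {eq_quot N_orbit_equivRel}%qT.

Definition projM (z : Ztype) : Mspace := \pi_({eq_quot N_orbit_equivRel})%qT z.

Definition rho v (z : Cspace R F) : Cspace R (facet_index P v) :=
  mkC (fun f => rePart z (val f)) (fun f => imPart z (val f)).

Definition Uset v : set (Cspace R (facet_index P v)) := interior (rho v @` Zset).
Arguments Uset v _ : clear implicits.

Definition Zv v : set Ztype := [set z | Uset v (rho v (val z))].

Definition Mv v : set Mspace := projM @` Zv v.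

Definition Delta_v v : set 'rV[R]_n :=
  Delta P `\` \bigcup_(f in [set f | f \notin facets_at P v]) facet P f.

(* At a vertex of a Delzant polytope this description is satisfied by exactly
   one vector. *)
Definition mu_v v (z : Cspace R (facet_index P v)) : 'rV[R]_n :=
  get [set xi | forall f : facet_index P v,
         mu z f - offset P (val f) = pairing (normal P (val f)) xi].
Arguments mu_v v z : clear implicits.

Definition r_f (f : F) xi : R :=
  Num.sqrt (2 * (pairing (normal P f) xi + offset P f)).

Definition s_v v (z : Cspace R (facet_index P v)) : Cspace R F :=
  mkC (fun f => if insub f is Some f' then rePart z f' else r_f f (mu_v v z))
      (fun f => if insub f is Some f' then imPart z f' else 0).
Arguments s_v v z : clear implicits.

(* graph of psi_v *)
Definition psi_v v (z : Cspace R (facet_index P v)) (m : Mspace) : Prop :=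
  Uset v z /\ exists2 w : Ztype, val w = s_v v z & projM w = m.
Arguments psi_v v z m : clear implicits.

(* inverse of psi_v *)
Definition phi_v v (m : Mspace) : Cspace R (facet_index P v) :=
  get [set z | psi_v v z m].

Definition iota_v v (t : facet_index P v -> R) : F -> R :=
  fun f => if insub f is Some f' then t f' else 0.

Definition M_atlas : atlas R Mspace :=
  @Atlas R Mspace {v : 'rV[R]_n | vertices (Delta P) v}
    (fun i => Cspace R (facet_index P (sval i)))
    (fun i => Mv (sval i))
    (fun i => phi_v (sval i)).

(* Tangent vectors of Z are the velocities of smooth curves in Z. *)
Definition smooth_curve (g : R -> Ztype) : Prop :=
  smooth (setT : set R) (fun s => val (g s)).

(* The projection Z -> M is a smooth submersion: the smooth structure given by
   the atlas is the one that M has as a quotient of Z. *)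
Definition smooth_submersion_projM : Prop :=
  forall i : idx M_atlas,
    smooth_via val (projM @^-1` dom M_atlas i)
      (fun z => chart M_atlas i (projM z)) /\
    forall z, dom M_atlas i (projM z) -> forall u : model M_atlas i,
      exists2 g : R -> Ztype, smooth_curve g & g 0 = z /\
        derive1 (fun s => chart M_atlas i (projM (g s))) 0 = u.

(* p^* w = sigma on Z *)
Definition reduced_form (w : two_form M_atlas) : Prop :=
  forall g1 g2 : R -> Ztype, smooth_curve g1 -> smooth_curve g2 ->
    g1 0 = g2 0 -> forall i, let c := chart M_atlas i in
    dom M_atlas i (projM (g1 0)) ->
    w i (c (projM (g1 0))) (derive1 (fun s => c (projM (g1 s))) 0)
                           (derive1 (fun s => c (projM (g2 s))) 0) =
    sigma (derive1 (fun s => val (g1 s)) 0) (derive1 (fun s => val (g2 s)) 0).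

End Reduction.

Arguments rho {R n F} P v z.
Arguments Uset {R n F} P v _.
Arguments Zv {R n F} P v _.
Arguments Mv {R n F T} P texp v _.
Arguments mu_v {R n F} P v z.
Arguments s_v {R n F} P v z.
Arguments psi_v {R n F T} P texp v z m.
Arguments phi_v {R n F T} P texp v m.
Arguments projM {R n F T} P texp z.
Arguments iota_v {R n F} P v t f.

Section Hamiltonian.
Context {R : realType} {n : nat} {T : topologicalZmodType} {X : topologicalType}.
Variables (AT : atlas R T) (texp : {additive 'rV[R]_n -> T}) (A : atlas R X).

Definition smooth_action (act : T -> X -> X) : Prop :=
  [/\ forall m, act 0 m = m,
      forall s t m, act (s + t) m = act s (act t m) &
      smooth_map (prod_atlas AT A) A (fun sm => act sm.1 sm.2)].

Definition effective (act : T -> X -> X) : Prop :=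
  forall t, (forall m, act t m = m) -> t = 0.

(* The action preserves the form [w], and the T-invariant smooth map [muX] to
   the dual of the Lie algebra satisfies i(Y_X) w = - d<Y, muX> for all Y; here
   [h] is any map representing <Y, muX> in the coordinates [i]. *)
Definition hamiltonian_action (w : two_form A) (act : T -> X -> X)
    (muX : X -> 'rV[R]_n) : Prop :=
  [/\ forall t, pullback_eq (act t) w w,
      smooth_map A (flat_atlas 'rV[R]_n) muX,
      forall t m, muX (act t m) = muX m &
      forall (Y : 'rV[R]_n) i (h : model A i -> R),
        (forall m, dom A i m -> h (chart A i m) = pairing Y (muX m)) ->
        forall m, dom A i m -> forall u,
          w i (chart A i m)
            (derive1 (fun s : R => chart A i (act (texp (s *: Y)) m)) 0) u =
          - 'D_u h (chart A i m)].

End Hamiltonian.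

(* Main.v *)
Require Import Defs.
From HB Require Import structures.
From mathcomp Require Import all_boot all_order all_algebra.
From mathcomp Require Import all_classical all_reals all_analysis.
From mathcomp Require Import ring lra.
From mathcomp Require Import complex.

Set Implicit Arguments.
Unset Strict Implicit.
Unset Printing Implicit Defensive.

Import Order.TTheory GRing.Theory Num.Theory.
Import numFieldNormedType.Exports.
Import Normc.

Local Open Scope classical_set_scope.
Local Open Scope ring_scope.

(** A point z belongs to the level set Z iff there is xi with |z_f|^2 / 2 = <X_f, xi> + lambda_f
    for all facets f ([ZsetP]). Since Delta is the intersection of its facet half-spaces
    ([DeltaE]), xi lies in Delta, and z_f vanishes iff xi lies on the facet f. The facets
    through xi all contain some vertex v ([vertex_of_face]), and Z_v consists of the points of Z
    whose coordinates outside F_v do not vanish ([ZvE]); hence the Z_v cover Z. Compactness of Z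
    follows from that of Delta.

    The normals X_f, f in F_v, form a Z-basis of the lattice, and a basis over R because the
    lattice is discrete ([normal_free], proved by Diophantine approximation, and
    [ex_dual_basis]). Write X_f' = sum_f c_f'f X_f with integers c_f'f, and put
      phihat(z)_f = z_f prod_(f' outside F_v) (z_f' / |z_f'|)^(c_f'f).
    This is smooth where the coordinates outside F_v do not vanish and invariant under N.
    An element of N may be prescribed outside F_v, and is then determined mod Z^F; choosing it
    so as to make the z_f' positive moves z to s_v(phihat(z)) ([N_normal_form]). So phihat is the chart
    phi_v read on Z, and all that concerns charts becomes explicit: they are homeomorphisms,
    the transitions phihat_v' o s_v are smooth, and rotation by t on Z becomes rotation by the
    coordinates of pi(t) in the basis at v ([phihat_rotate]). The U_v are star-shaped and have
    classes of generic points in common, hence M is connected; it is Hausdorff because M_v is the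
    preimage of Delta_v under the moment map. That Z is a submanifold is seen from an explicit
    slice chart ([slice_chart]).

    For the symplectic form, consider a curve in Z. The phases in phihat add to the velocity of
    the coordinate f a rotation with speed sum_f' c_f'f theta_f', where theta_f' is the angular
    velocity of z_f', while |z_f'|^2 / 2 = sum_f c_f'f |z_f|^2 / 2 + constant on Z. The two
    effects combine to the terms of sigma outside F_v, so the chart takes sigma on Z to the standard
    form ([sigma_phihat]). Every tangent vector in a chart comes from a curve in Z
    ([curve_exists]); hence the standard forms define the unique reduced form, and every map
    of M induced by a rotation of Z preserves it ([std_form_invariant]), which gives both the
    agreement of the forms on overlaps and the invariance under T.

    The exponential map is onto T ([texp_surjective]), so rotations of Z induce an action of T. In
    the chart at v it is the rotation action through the coordinates in the basis X_f, which is
    smooth by the existence of smooth local logarithms ([local_log]), effective because a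
    generic point has nonzero coordinates, and Hamiltonian with moment map mu_v by a
    computation in polar coordinates ([act_hamiltonian]). *)

(** * Smooth calculus *)
Definition mklinear {R : realType} {V W : normedModType R} {f : V -> W} (l : linear f) :
  {linear V -> W} := HB.pack f (GRing.isLinear.Build _ _ _ _ _ l).

Section SmoothCalculus.
Context {R : realType}.
Implicit Types V W U : normedModType R.

Lemma near_eq_differentiable V W (f g : V -> W) x :
  (\forall y \near x, f y = g y) -> differentiable f x -> differentiable g x.
Proof.
move=> fg df.
have [dc _] := (diff_locallyP x f).1 df.
have gE : g \o shift x = cst (g x) + 'd f x +o_ 0 id.
  apply/eqaddoP => e e0.
  have /diff_locally/eqaddoP /(_ e e0) := df.
  have fg0 : \forall h \near (0 : V), f (h + x) = g (h + x).
    by have := fg; rewrite (near_shift 0) /= subr0.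
  apply: filterS2 fg0 => h hfg; rewrite !fctE /= hfg.
  by rewrite (nbhs_singleton fg).
have dE := diff_unique dc gE.
by apply/diff_locallyP; rewrite dE; split.
Qed.

Lemma Ck_ext k V W (O : set V) (f g : V -> W) :
  open O -> (forall x, O x -> f x = g x) -> Ck k O f -> Ck k O g.
Proof.
move=> oO; elim: k f g => [|k IH] f g fg /=.
  move=> h x Ox; have cf := h x Ox; rewrite /prop_for /continuous_at -(fg x Ox).
  apply: cvg_trans cf; apply: near_eq_cvg.
  have : nbhs x O by exact: open_nbhs_nbhs.
  by apply: filterS => y /fg.
move=> [df Df].
have near_fg x : O x -> \forall y \near x, f y = g y.
  move=> Ox; have : nbhs x O by exact: open_nbhs_nbhs.
  by apply: filterS => y /fg.
split=> [x Ox|v].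
  by apply: near_eq_differentiable (df x Ox); exact: near_fg.
apply: IH (Df v) => x Ox; apply: near_eq_derive; exact: near_fg.
Qed.

Lemma Ck_sub k V W (O O' : set V) (f : V -> W) :
  O' `<=` O -> Ck k O f -> Ck k O' f.
Proof.
move=> O'O; elim: k f => [|k IH] f /= => [h x /O'O|[df Df]]; first exact: h.
by split=> [x /O'O|v]; [exact: df | apply: IH].
Qed.

Lemma Ck_pred k V W (O : set V) (f : V -> W) : Ck k.+1 O f -> Ck k O f.
Proof.
elim: k f => [|k IH] f [df Df]; first by move=> x /df /differentiable_continuous.
by split=> // v; apply: IH; exact: Df.
Qed.

Lemma Ck_cst k V W (O : set V) (a : W) : Ck k O (fun _ : V => a).
Proof.
elim: k a => [|k IH] a /=; first by move=> x _; exact: cst_continuous.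
split=> [x _|v]; first exact: differentiable_cst.
have -> : (fun x : V => 'D_v (fun=> a) x) = fun=> 0; last exact: IH.
by apply/funext => x; rewrite derive_cst.
Qed.

Lemma Ck_add k V W (O : set V) (f g : V -> W) : open O ->
  Ck k O f -> Ck k O g -> Ck k O (fun x => f x + g x).
Proof.
move=> oO; elim: k f g => [|k IH] f g /=.
  by move=> hf hg x Ox; apply: cvgD; [exact: hf|exact: hg].
move=> [df Df] [dg Dg]; split=> [x Ox|v].
  by apply: differentiableD; [exact: df|exact: dg].
apply: Ck_ext (IH _ _ (Df v) (Dg v)) => // x Ox.
by rewrite -deriveD //; apply: diff_derivable; [exact: df|exact: dg].
Qed.

Lemma Ck_lin k V W U (O : set V) (f : V -> W) (L : {linear W -> U}) : open O ->
  continuous L -> Ck k O f -> Ck k O (fun x => L (f x)).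
Proof.
move=> oO cL; elim: k f => [|k IH] f /=.
  by move=> hf x Ox; apply: continuous_comp; [exact: hf|exact: cL].
move=> [df Df].
have dLf x : O x -> differentiable (L \o f) x.
  by move=> Ox; apply: differentiable_comp; [exact: df|exact: linear_differentiable].
split=> [//|v].
apply: Ck_ext (IH _ (Df v)) => // x Ox.
rewrite (deriveE v (df x Ox)) -[RHS]/('D_v (L \o f) x) (deriveE v (dLf x Ox)).
have -> : 'd (L \o f) x = L \o 'd f x :> (V -> U) by
  rewrite (diff_comp (df x Ox) (linear_differentiable _ cL)) (diff_lin _ cL).
by [].
Qed.

Lemma Ck_mul k V (O : set V) (f g : V -> R) : open O ->
  Ck k O f -> Ck k O g -> Ck k O (fun x => f x * g x).
Proof.
move=> oO; elim: k f g => [|k IH] f g.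
  by move=> hf hg x Ox; apply: cvgM; [exact: hf|exact: hg].
move=> hf hg; case: (hf) => df Df; case: (hg) => dg Dg; split=> [x Ox|v].
  by apply: differentiableM; [exact: df|exact: dg].
have key := Ck_add oO (IH _ _ (Ck_pred hf) (Dg v)) (IH _ _ (Ck_pred hg) (Df v)).
apply: (Ck_ext oO) key => // x Ox.
by rewrite -deriveM //; apply: diff_derivable; [exact: df|exact: dg].
Qed.

Lemma continuous_sum (X : topologicalType) W (I : Type) (r : seq I) (f : I -> X -> W) :
  (forall i, continuous (f i)) -> continuous (fun x => \sum_(i <- r) f i x).
Proof.
move=> cf; apply: (@continuous_big W I +%R 0 xpredT _ X r f) => //.
exact: add_continuous.
Qed.

Lemma Ck_sum k V W (O : set V) (I : Type) (r : seq I) (f : I -> V -> W) :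
  open O -> (forall i, Ck k O (f i)) -> Ck k O (fun x => \sum_(i <- r) f i x).
Proof.
move=> oO cf; elim: r => [|i r IH].
  by apply: Ck_ext (Ck_cst k O 0) => // x _; rewrite big_nil.
by apply: Ck_ext (Ck_add oO (cf i) IH) => // x _; rewrite big_cons.
Qed.

Lemma Ck_scale k V W (O : set V) (f : V -> R) (w : W) :
  open O -> Ck k O f -> Ck k O (fun x => f x *: w).
Proof.
move=> oO.
have sl : linear (fun r : R => r *: w) by move=> a x y; rewrite scalerDl scalerA.
pose L : {linear R -> W} := mklinear sl.
by apply: (@Ck_lin _ _ _ _ _ _ L) => // x; exact: scalel_continuous.
Qed.

(** In finite dimension a linear bijection with R^m is automatically a homeomorphism:
    the norm of the image has a positive minimum on the unit sphere of R^m, which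
    bounds the inverse. Hence the coordinates are continuous, and smoothness can be
    tested on real-valued components. *)
Lemma has_dim_coordinates (W : normedModType R) m : has_dim W m ->
  exists (e : 'I_m -> W) (c : 'I_m -> {linear W -> R}),
    (forall i, continuous (c i)) /\ forall w, w = \sum_i c i w *: e i.
Proof.
move=> [f [g fK gK]].
have gl : linear g.
  by move=> a x y; apply: (can_inj fK); rewrite gK linearP !gK.
pose gL : {linear W -> 'rV[R]_m} := mklinear gl.
have cf : continuous f.
  have -> : (f : _ -> _) = fun x => \sum_i x ord0 i *: f (delta_mx ord0 i).
    apply/funext => x; rewrite {1}(row_sum_delta x) linear_sum.
    by apply: eq_bigr => i _; rewrite linearZ.
  apply: continuous_sum => i x.
  apply: (@continuous_comp _ _ _ (fun x : 'rV[R]_m => x ord0 i)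
    (fun r => r *: f (delta_mx ord0 i))).
    exact: coord_continuous.
  exact: scalel_continuous.
have cg : continuous gL.
  apply/linear_bounded_continuous/linear_boundedP.
  pose S : set 'rV[R]_m := [set x | `|x| = 1].
  have cS : compact S.
    apply: bounded_closed_compact.
      by exists 1; split => // t t1 x; rewrite /S /= => ->; exact: ltW.
    apply: (preimage_closed _ (@closed_eq R 1)) => y _; exact: norm_continuous.
  have [S0|S0] := pselect (S !=set0); last first.
    have := nbhs_pinfty_ge (num_real (0 : R)); apply: filterS => r r0 w.
    suff -> : gL w = 0 by rewrite normr0 mulr_ge0.
    apply: contra_notP S0 => /eqP w0; exists (`|gL w|^-1 *: gL w).
    by rewrite /S /= normrZ normfV normr_id mulVf ?normr_eq0.
  have cfS : {within S, continuous (fun x => `|f x|)}.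
    apply: continuous_subspaceT => x.
    by apply: (@continuous_comp _ _ _ f Num.norm); [exact: cf|exact: norm_continuous].
  have [x0 Sx0 min] := compact_EVT_min S0 cS cfS.
  have {}Sx0 : `|x0| = 1 by move: Sx0; rewrite inE.
  have fx0 : 0 < `|f x0|.
    rewrite normr_gt0; apply/eqP => h.
    move: Sx0; rewrite -(fK x0) h -[g]/(gL : _ -> _) linear0 normr0 => /esym/eqP.
    by rewrite oner_eq0.
  have := nbhs_pinfty_ge (num_real (`|f x0|^-1)); apply: filterS => r hr w.
  have [->|w0] := eqVneq (gL w) 0.
    by rewrite normr0 mulr_ge0 // (le_trans _ hr) // invr_ge0.
  have /min : `|gL w|^-1 *: gL w \in S.
    by rewrite inE /S /= normrZ normfV normr_id mulVf ?normr_eq0.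
  rewrite linearZ /= gK normrZ normfV normr_id ler_pdivlMl ?normr_gt0 // => h.
  have {h} : `|gL w| <= `|f x0|^-1 * `|w| by rewrite ler_pdivlMl // mulrC.
  by move=> /le_trans; apply; apply: ler_wpM2r.
exists (fun i => f (delta_mx ord0 i)).
have cl i : linear (fun w => gL w ord0 i : R).
  by move=> a x y; rewrite linearP !mxE.
pose c i : {linear W -> R} :=
  mklinear (cl i).
exists c.
split=> [i x /=|w].
  apply: (@continuous_comp _ _ _ gL (fun M => M ord0 i)); first exact: cg.
  exact: coord_continuous.
rewrite -{1}(gK w) {1}(row_sum_delta (g w)) linear_sum.
by apply: eq_bigr => i _; rewrite linearZ.
Qed.

(** The chain rule in coordinates expresses the derivatives of a composite by sums of
    products of functions of the same kind, with one order of differentiability less;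
    this is what makes the induction go through. *)
Lemma Ck_comp_real k V W m (O : set V) (O' : set W) (f : V -> W) (g : W -> R) :
  has_dim W m -> open O -> open O' -> (forall x, O x -> O' (f x)) ->
  Ck k O f -> Ck k O' g -> Ck k O (fun x => g (f x)).
Proof.
move=> /has_dim_coordinates [e [c [cc ce]]] oO oO' fO.
elim: k f g fO => [|k IH] f g fO.
  by move=> hf hg x Ox; apply: continuous_comp; [exact: hf|exact/hg/fO].
move=> hf hg; case: (hf) => df Df; case: (hg) => dg Dg.
have dgf x : O x -> differentiable (g \o f) x.
  by move=> Ox; apply: differentiable_comp; [exact: df|exact/dg/fO].
split=> [//|v].
have key : Ck k O (fun x => \sum_i c i ('D_v f x) * 'D_(e i) g (f x)).
  apply: Ck_sum => // i; apply: Ck_mul => //.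
    by apply: Ck_lin => //; exact: Df.
  by apply: (IH f ('D_(e i) g)) => //; [exact: Ck_pred|exact: Dg].
apply: Ck_ext key => // x Ox.
rewrite -[RHS]/('D_v (g \o f) x) (deriveE v (dgf x Ox)).
have -> : 'd (g \o f) x = 'd g (f x) \o 'd f x :> (V -> R).
  by rewrite (diff_comp (df x Ox) (dg _ (fO _ Ox))).
rewrite /= -(deriveE v (df x Ox)) {2}(ce ('D_v f x)) linear_sum.
by apply: eq_bigr => i _; rewrite linearZ /= (deriveE _ (dg _ (fO _ Ox))).
Qed.

Lemma Ck_comp k V W U m l (O : set V) (O' : set W) (f : V -> W) (g : W -> U) :
  has_dim W m -> has_dim U l -> open O -> open O' -> (forall x, O x -> O' (f x)) ->
  Ck k O f -> Ck k O' g -> Ck k O (fun x => g (f x)).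
Proof.
move=> dW /has_dim_coordinates [e [c [cc ce]]] oO oO' fO hf hg.
have key : Ck k O (fun x => \sum_i c i (g (f x)) *: e i).
  apply: Ck_sum => // i; apply: Ck_scale => //.
  by apply: (Ck_comp_real dW oO oO' fO hf (g := fun w => c i (g w))); exact: Ck_lin.
by apply: Ck_ext key => // x Ox; rewrite -ce.
Qed.

Lemma has_dim_real : has_dim R 1.
Proof.
have fl : linear (fun x : 'rV[R]_1 => x ord0 ord0 : R) by move=> a x y; rewrite !mxE.
pose f : {linear 'rV[R]_1 -> R} :=
  mklinear fl.
exists f.
exists (fun r => const_mx r) => [x|r] /=; last by rewrite mxE.
by apply/rowP => i; rewrite mxE (ord1 i).
Qed.

Lemma has_dim_rV m : has_dim 'rV[R]_m m.
Proof. by exists idfun; exists id. Qed.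

Lemma has_dim_prod V W m l : has_dim V m -> has_dim W l -> has_dim (V * W)%type (m + l).
Proof.
move=> [f [f' fK f'K]] [g [g' gK g'K]].
pose h (x : 'rV[R]_(m + l)) : (V * W)%type := (f (lsubmx x), g (rsubmx x)).
have hl : linear h by move=> a x y; rewrite /h !linearP.
pose hL : {linear 'rV[R]_(m + l) -> (V * W)%type} :=
  mklinear hl.
exists hL.
exists (fun p => row_mx (f' p.1) (g' p.2)) => [x|[p q]] /=.
  by rewrite /h /= fK gK hsubmxK.
by rewrite /h row_mxKl row_mxKr f'K g'K.
Qed.

Lemma smooth_ext V W (O : set V) (f g : V -> W) :
  open O -> (forall x, O x -> f x = g x) -> smooth O f -> smooth O g.
Proof. by move=> oO fg sf k; apply: Ck_ext (sf k). Qed.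

Lemma smooth_sub V W (O O' : set V) (f : V -> W) :
  O' `<=` O -> smooth O f -> smooth O' f.
Proof. by move=> OO sf k; apply: Ck_sub (sf k). Qed.

Lemma smooth_differentiable V W (O : set V) (f : V -> W) x :
  smooth O f -> O x -> differentiable f x.
Proof. by move=> /(_ 1)[df _] /df. Qed.

Lemma smooth_continuous V W (O : set V) (f : V -> W) x :
  smooth O f -> O x -> {for x, continuous f}.
Proof. by move=> /(_ 0); apply. Qed.

Lemma smooth_cst V W (O : set V) (a : W) : smooth O (fun _ => a).
Proof. by move=> k; exact: Ck_cst. Qed.

Lemma smooth_add V W (O : set V) (f g : V -> W) : open O ->
  smooth O f -> smooth O g -> smooth O (fun x => f x + g x).
Proof. by move=> oO sf sg k; apply: Ck_add. Qed.

Lemma smooth_lin_comp V W U (O : set V) (f : V -> W) (L : {linear W -> U}) :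
  open O -> continuous L -> smooth O f -> smooth O (fun x => L (f x)).
Proof. by move=> oO cL sf k; apply: Ck_lin. Qed.

Lemma smooth_mul V (O : set V) (f g : V -> R) : open O ->
  smooth O f -> smooth O g -> smooth O (fun x => f x * g x).
Proof. by move=> oO sf sg k; apply: Ck_mul. Qed.

Lemma smooth_opp V (O : set V) (f : V -> R) : open O ->
  smooth O f -> smooth O (fun x => - f x).
Proof.
move=> oO sf; apply: smooth_ext (smooth_mul oO (@smooth_cst V R O (-1)) sf) => // x _.
by rewrite mulN1r.
Qed.

Lemma smooth_sum V W (O : set V) (I : Type) (r : seq I) (f : I -> V -> W) :
  open O -> (forall i, smooth O (f i)) -> smooth O (fun x => \sum_(i <- r) f i x).
Proof. by move=> oO sf k; apply: Ck_sum => // i; exact: sf. Qed.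

Lemma smooth_scale V W (O : set V) (f : V -> R) (w : W) :
  open O -> smooth O f -> smooth O (fun x => f x *: w).
Proof. by move=> oO sf k; apply: Ck_scale. Qed.

Lemma smooth_comp V W U m l (O : set V) (O' : set W) (f : V -> W) (g : W -> U) :
  has_dim W m -> has_dim U l -> open O -> open O' -> (forall x, O x -> O' (f x)) ->
  smooth O f -> smooth O' g -> smooth O (fun x => g (f x)).
Proof.
by move=> dW dU oO oO' fO sf sg k; exact: (Ck_comp dW dU oO oO' fO (sf k) (sg k)).
Qed.

Lemma smooth_id V : smooth (setT : set V) (fun x => x).
Proof.
case=> [|k]; first by move=> x _; exact: cvg_id.
split=> [x _|v]; first by apply: ex_diff; exact: is_diff_id.
have -> : (fun x : V => 'D_v (fun x => x) x) = fun=> v; last exact: Ck_cst.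
by apply/funext => x; rewrite derive_id.
Qed.

(** For functions of one real variable a directional derivative is the ordinary one,
    up to a constant factor. *)
Lemma Ck_real_derive k (O : set R) (f df : R -> R) : open O ->
  (forall x, O x -> is_derive x (1 : R) f (df x)) -> Ck k O df -> Ck k.+1 O f.
Proof.
move=> oO fdf hd; split=> [x Ox|v]; first by apply/derivable1_diffP; case: (fdf x Ox).
apply: Ck_ext (Ck_mul oO (Ck_cst k O v) hd) => // x Ox.
have dfx : differentiable f x by apply/derivable1_diffP; case: (fdf x Ox).
rewrite deriveE // -[v in RHS]mulr1 -[v * 1 in RHS]/(v *: (1 : R)) linearZ /= -deriveE //.
by case: (fdf x Ox) => _ ->.
Qed.

Lemma smooth_inv : smooth [set x : R | x != 0] (fun x => x^-1).
Proof.
have oO := @open_neq R 0.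
elim=> [|k IH]; first by move=> x x0; exact: inv_continuous.
apply: (@Ck_real_derive k _ _ (fun x => - 1 * (x^-1 * x^-1))) => //.
  move=> x x0; apply: is_derive_eq; first exact: is_deriveV.
  by rewrite mulN1r /GRing.scale /= mulr1 expr2 invfM.
by apply: Ck_mul => //; [exact: Ck_cst|exact: Ck_mul].
Qed.

Lemma smooth_sqrt : smooth [set x : R | 0 < x] Num.sqrt.
Proof.
have oO : open [set x : R | 0 < x] by exact: open_gt.
elim=> [|k IH]; first by move=> x x0; exact: sqrt_continuous.
apply: (@Ck_real_derive k _ _ (fun x => 2^-1 * (Num.sqrt x)^-1)) => //.
  by move=> x x0; rewrite -invfM; exact: is_derive1_sqrt.
apply: Ck_mul => //; first exact: Ck_cst.
have sO (x : R) : 0 < x -> Num.sqrt x != 0 by move=> x0; rewrite gt_eqF // sqrtr_gt0.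
exact: (Ck_comp_real has_dim_real oO (@open_neq R 0) sO IH (smooth_inv k)).
Qed.

Lemma smooth_trigo k : Ck k [set: R] sin /\ Ck k [set: R] cos.
Proof.
have oT : open [set: R] by exact: openT.
elim: k => [|k [IHs IHc]].
  by split=> x _; [have := @continuous_sin R x|have := @continuous_cos R x].
split.
  by apply: (@Ck_real_derive k _ _ cos) => // x _; exact: is_derive_sin.
apply: (@Ck_real_derive k _ _ (fun x => -1 * sin x)) => //.
  by move=> x _; rewrite mulN1r; exact: is_derive_cos.
by apply: Ck_mul => //; exact: Ck_cst.
Qed.

Lemma smooth_sin : smooth [set: R] sin.
Proof. by move=> k; have [] := smooth_trigo k. Qed.

Lemma smooth_cos : smooth [set: R] cos.
Proof. by move=> k; have [] := smooth_trigo k. Qed.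

End SmoothCalculus.

(** Openness of the domains below: each is given by finitely many positivity conditions. *)
Lemma open_forall_pos {R : realType} (V : normedModType R) (I : finType) (p : pred I)
    (g : I -> V -> R) : (forall i, continuous (g i)) ->
  open [set x | forall i, p i -> 0 < g i x].
Proof.
move=> cg; rewrite openE => x /= h; rewrite /interior.
have near1 i : \forall y \near x, p i -> 0 < g i y.
  have [pi|pi] := boolP (p i); last exact: filterE.
  have cs' : nbhs x [set y | 0 < g i y].
    apply: (cg i x [set r : R | 0 < r]).
    by apply: open_nbhs_nbhs; split; [exact: open_gt|exact: h].
  by apply: filterS cs' => y hy _.
exact: (filter_forall _ near1).
Qed.

Section SmoothCalculusPairs.
Context {R : realType}.
Implicit Types V W U : normedModType R.

Lemma smooth_pair V W U (O : set V) (f : V -> W) (g : V -> U) : open O ->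
  smooth O f -> smooth O g -> smooth O (fun x => (f x, g x) : (W * U)%type).
Proof.
move=> oO sf sg.
have l1 : linear (fun w : W => (w, 0) : (W * U)%type).
  by move=> a x y; congr (_, _); rewrite /= ?scaler0 ?addr0.
have l2 : linear (fun u : U => (0, u) : (W * U)%type).
  by move=> a x y; congr (_, _); rewrite /= ?scaler0 ?addr0.
pose L1 : {linear W -> (W * U)%type} := mklinear l1.
pose L2 : {linear U -> (W * U)%type} := mklinear l2.
have c1 : continuous L1 by move=> x; apply: cvg_pair; [exact: cvg_id|exact: cvg_cst].
have c2 : continuous L2 by move=> x; apply: cvg_pair; [exact: cvg_cst|exact: cvg_id].
apply: smooth_ext (smooth_add oO (smooth_lin_comp oO c1 sf) (smooth_lin_comp oO c2 sg)) => // x _.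
by congr (_, _); rewrite /= ?addr0 ?add0r.
Qed.

Lemma smooth_fst_comp V W U (O : set V) (f : V -> (W * U)%type) : open O ->
  smooth O f -> smooth O (fun x => (f x).1).
Proof.
move=> oO sf; apply: (@smooth_lin_comp _ _ _ _ _ _ fst) => //.
by move=> x; exact: cvg_fst.
Qed.

Lemma smooth_snd_comp V W U (O : set V) (f : V -> (W * U)%type) : open O ->
  smooth O f -> smooth O (fun x => (f x).2).
Proof.
move=> oO sf; apply: (@smooth_lin_comp _ _ _ _ _ _ snd) => //.
by move=> x; exact: cvg_snd.
Qed.

Lemma smooth_row V (O : set V) m (f : 'I_m -> V -> R) : open O ->
  (forall i, smooth O (f i)) -> smooth O (fun x => \row_i f i x).
Proof.
move=> oO sf.
have key : smooth O (fun x => \sum_i f i x *: (delta_mx 0 i : 'rV[R]_m)).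
  by apply: smooth_sum => // i; exact: smooth_scale.
apply: smooth_ext key => // x _.
by rewrite [RHS]row_sum_delta; apply: eq_bigr => i _; rewrite mxE.
Qed.

Lemma smooth_coord_comp V (O : set V) m (f : V -> 'rV[R]_m) i : open O ->
  smooth O f -> smooth O (fun x => f x ord0 i).
Proof.
move=> oO sf.
have l : linear (fun x : 'rV[R]_m => x ord0 i : R) by move=> a x y; rewrite !mxE.
pose L : {linear 'rV[R]_m -> R} := mklinear l.
by apply: (@smooth_lin_comp _ _ _ _ _ _ L) => //; exact: coord_continuous.
Qed.

Lemma smooth_preimage_open V W (O : set V) (O' : set W) (f : V -> W) :
  open O -> smooth O f -> open O' -> open (O `&` f @^-1` O').
Proof.
move=> oO sf oO'; rewrite openE => x [Ox O'fx]; rewrite /interior.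
apply: filterI; first exact: open_nbhs_nbhs.
by apply: (smooth_continuous sf Ox); exact: open_nbhs_nbhs.
Qed.

Lemma smooth_via_continuous_at (Xt : topologicalType) V W (e : Xt -> V) (D : set Xt)
    (f : Xt -> W) x :
  nbhs x D -> {for x, continuous e} -> smooth_via e D f -> {for x, continuous f}.
Proof.
move=> xD ce sf; have Dx := nbhs_singleton xD.
have [U0 [g [oO Oex sg fg]]] := sf x Dx.
rewrite /prop_for /continuous_at fg //.
have cge : g (e y) @[y --> x] --> g (e x).
  apply: (@continuous_comp _ _ _ e g x ce); exact: smooth_continuous sg Oex.
apply: cvg_trans cge; apply: near_eq_cvg.
have : nbhs x (D `&` e @^-1` U0) by apply: filterI => //; apply: ce; exact: open_nbhs_nbhs.
by apply: filterS => y [Dy Oy]; rewrite fg.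
Qed.

(** The common case in which one smooth coordinate expression serves all points. *)
Lemma smooth_via_of_smooth (Xt : Type) V W (e : Xt -> V) (D : set Xt) (f : Xt -> W) O g :
  open O -> smooth O g -> (forall y, D y -> O (e y)) ->
  (forall y, D y -> f y = g (e y)) -> smooth_via e D f.
Proof. by move=> oO sg DO fg x Dx; exists O, g; split=> // [|y Dy _]; [exact: DO|exact: fg]. Qed.

End SmoothCalculusPairs.

(** * Points of an atlas *)
Section AtlasFacts.
Context {R : realType} {X : topologicalType} {m : nat} {A : atlas R X}.
Hypothesis hA : smooth_atlas m A.

Lemma atlas_chart_continuous i x : dom A i x -> {for x, continuous (chart A i)}.
Proof.
move=> ix; have [_ /(_ i) od _ /(_ i) [cont _ _] _] := hA.
move: cont; rewrite continuous_open_subspace // => /(_ x); apply.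
by rewrite inE.
Qed.

Lemma atlas_dom_nbhs i x : dom A i x -> nbhs x (dom A i).
Proof. by move=> ix; have [_ /(_ i) od _ _ _] := hA; exact: open_nbhs_nbhs. Qed.

Lemma atlas_cover x : exists i, dom A i x.
Proof.
have [_ _ cov _ _] := hA.
have : setT x by []. by rewrite -cov => -[i _ ix]; exists i.
Qed.

End AtlasFacts.

(** * Affine functions and convex polytopes *)
Section Pairing.
Context {R : realType} {n : nat}.
Implicit Types (X Y xi : 'rV[R]_n).

Lemma pairingC X Y : pairing X Y = pairing Y X.
Proof. by apply: eq_bigr => i _; rewrite mulrC. Qed.

Lemma pairingDr X Y xi : pairing X (Y + xi) = pairing X Y + pairing X xi.
Proof. by rewrite -big_split; apply: eq_bigr => i _; rewrite mxE mulrDr. Qed.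

Lemma pairingZr a X Y : pairing X (a *: Y) = a * pairing X Y.
Proof. by rewrite /pairing mulr_sumr; apply: eq_bigr => i _; rewrite mxE mulrCA. Qed.

Lemma pairingDl X Y xi : pairing (X + Y) xi = pairing X xi + pairing Y xi.
Proof. by rewrite pairingC pairingDr !(pairingC xi). Qed.

Lemma pairingZl a X Y : pairing (a *: X) Y = a * pairing X Y.
Proof. by rewrite pairingC pairingZr pairingC. Qed.

Lemma pairingNr X Y : pairing X (- Y) = - pairing X Y.
Proof. by rewrite -scaleN1r pairingZr mulN1r. Qed.

Lemma pairingBr X Y xi : pairing X (Y - xi) = pairing X Y - pairing X xi.
Proof. by rewrite pairingDr pairingNr. Qed.

Lemma pairing0r X : pairing X 0 = 0.
Proof. by rewrite -(scale0r 0) pairingZr mul0r. Qed.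

Lemma pairing0l X : pairing 0 X = 0.
Proof. by rewrite pairingC pairing0r. Qed.

Lemma pairing_suml (I : Type) (r : seq I) (p : pred I) (f : I -> 'rV[R]_n) xi :
  pairing (\sum_(i <- r | p i) f i) xi = \sum_(i <- r | p i) pairing (f i) xi.
Proof.
by apply: (big_morph (pairing^~ xi)); [move=> X Y; rewrite pairingDl|rewrite pairing0l].
Qed.

Lemma pairing_sumr (I : Type) (r : seq I) (p : pred I) X (f : I -> 'rV[R]_n) :
  pairing X (\sum_(i <- r | p i) f i) = \sum_(i <- r | p i) pairing X (f i).
Proof. by rewrite pairingC pairing_suml; apply: eq_bigr => i _; rewrite pairingC. Qed.

Lemma pairing_mulmx X Y : X *m Y^T = (pairing X Y)%:M.
Proof.
by apply/matrixP => i j; rewrite !ord1 !mxE eqxx mulr1n; apply: eq_bigr => k _; rewrite mxE.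
Qed.

Lemma pairing_rows (m : nat) (A : 'M[R]_(m, n)) Y :
  A *m Y^T = 0 <-> forall i, pairing (row i A) Y = 0.
Proof.
split=> [h i|h].
  have := pairing_mulmx (row i A) Y; rewrite -row_mul h row0.
  by move=> /matrixP /(_ 0 0); rewrite !mxE eqxx mulr1n.
apply/row_matrixP => i; rewrite row_mul pairing_mulmx h row0.
by apply/matrixP => a b; rewrite !mxE mul0rn.
Qed.

Lemma pairing_eq0 Y : (forall X, pairing X Y = 0) -> Y = 0.
Proof.
move=> h; have /pairing_rows : forall i, pairing (row i 1%:M) Y = 0 by [].
by rewrite mul1mx => /(congr1 trmx); rewrite trmxK trmx0.
Qed.

Lemma pairing_continuous X : continuous (pairing X).
Proof.
apply: continuous_sum => i x.
apply: (@continuous_comp _ _ _ (fun x : 'rV[R]_n => x ord0 i) (fun r => X ord0 i * r)).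
  exact: coord_continuous.
exact: mulrl_continuous.
Qed.

(** A set of dimension n - 1 spans a hyperplane, so the linear parts of the affine functions
    that vanish on it are all in the one-dimensional annihilator of its directions. *)
Lemma affine_hyperplane_unique (S : set 'rV[R]_n) k X l Y c : k.+1 = n ->
  affine_dim S k -> X != 0 ->
  (forall xi, S xi -> pairing X xi + l = 0) ->
  (forall xi, S xi -> pairing Y xi + c = 0) ->
  exists a, Y = a *: X /\ c = a * l.
Proof.
move=> kn [x0 Sx0 [A [Afree SA _]]] X0 XS YS.
have kerA W d : (forall xi, S xi -> pairing W xi + d = 0) -> (W <= kermx A^T)%MS.
  move=> WS; apply/sub_kermxP/trmx_inj; rewrite trmx_mul trmxK trmx0.
  apply/pairing_rows => i; rewrite pairingC.
  have := WS _ (SA i); rewrite pairingDr addrAC (WS _ Sx0) add0r; exact.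
have [a Ya] : exists a, Y = a *: X.
  apply/sub_rVP; apply: submx_trans (kerA _ _ YS) _.
  have := mxrank_leqif_sup (kerA _ _ XS); move=> [_ <-].
  have nk : (n - k)%N = 1%N by rewrite -kn subSnn.
  by rewrite mxrank_ker mxrank_tr (eqP Afree) nk rank_rV X0.
exists a; split=> //.
have := YS _ Sx0; have := XS _ Sx0.
rewrite Ya pairingZl => /eqP; rewrite addr_eq0 => /eqP -> /eqP.
by rewrite mulrN addrC subr_eq0 => /eqP.
Qed.

End Pairing.

(** Feasibility of small steps: positive values stay nonnegative under a small perturbation
    and zero values are kept by directions in which they do not change. *)
Lemma exists_small_step {R : realType} (I : finType) (a b : I -> R) :
  (forall i, 0 < a i \/ (a i = 0 /\ b i = 0)) ->
  exists2 e, 0 < e & forall i, 0 <= a i + e * b i.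
Proof.
move=> h; pose d i := if 0 < a i then a i / (`|b i| + 1) else 1.
have d0 i : 0 < d i.
  by rewrite /d; case: ifP => // ai; rewrite divr_gt0 // ltr_wpDl.
exists (\big[Num.min/1]_i d i).
  by apply/bigmin_gtP; split.
move=> i; have [ai|[-> ->]] := h i; last by rewrite mulr0 addr0.
have le : \big[Num.min/1]_i d i <= d i by exact: bigmin_le.
have e0 : 0 < \big[Num.min/1]_i d i by apply/bigmin_gtP; split.
move: le e0; set e := \big[_/_]_i d i => le e0.
rewrite -lerBlDl sub0r lerNl -mulrN.
apply: (@le_trans _ _ (e * (`|b i| + 1))).
  apply: ler_wpM2l; first exact: ltW.
  by rewrite (le_trans (ler_norm _)) // normrN lerDl.
move: le; rewrite /d ai ler_pdivlMr //; exact: ltr_wpDl.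
Qed.

Section ConvexPolytope.
Context {R : realType} {n : nat}.
Implicit Types (X Y xi : 'rV[R]_n).

(** The barycentre of affinely independent points of D: an affine function that is
    nonnegative on D and vanishes there vanishes at all of them, hence is constant. *)
Lemma interior_point (D : set 'rV[R]_n) : convex_polytope D -> affine_dim D n ->
  exists2 x0, D x0 & forall Y c, (forall xi, D xi -> 0 <= pairing Y xi + c) ->
    Y != 0 -> 0 < pairing Y x0 + c.
Proof.
move=> [_ [m [Yi [ci DE]]]] [x1 Dx1 [A [Afree DA _]]].
pose k : R := (n.+1%:R)^-1.
have k0 : 0 < k by rewrite invr_gt0 ltr0n.
have knat : k * n%:R + k = 1.
  by rewrite -{2}(mulr1 k) -mulrDr natr1 mulVf // pnatr_eq0.
(* k = 1 / (n + 1), so x0 is the barycentre of x1 and the n points x1 + row i A *)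
pose x0 := x1 + k *: \sum_i row i A.
have x0E Y c : pairing Y x0 + c =
    k * (pairing Y x1 + c) + \sum_i k * (pairing Y (x1 + row i A) + c).
  rewrite -mulr_sumr.
  under eq_bigr do rewrite pairingDr addrAC.
  rewrite big_split /= sumr_const card_ord -pairing_sumr -mulr_natl.
  rewrite /x0 pairingDr pairingZr; set S := pairing Y (\sum_i _).
  by transitivity ((k * n%:R + k) * (pairing Y x1 + c) + k * S); [rewrite knat; ring|ring].
have x0ge Y c : (forall xi, D xi -> 0 <= pairing Y xi + c) -> 0 <= pairing Y x0 + c.
  move=> h; rewrite x0E addr_ge0 //; first by rewrite mulr_ge0 ?h // ltW.
  by apply: sumr_ge0 => i _; rewrite mulr_ge0 ?h // ltW.
exists x0; first by rewrite DE => i; apply: x0ge => xi; rewrite DE; apply.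
move=> Y c h Y0; rewrite lt_def x0ge // andbT; apply/eqP => e0; case/negP: Y0; apply/eqP.
have : \sum_i k * (pairing Y (x1 + row i A) + c) = 0 /\ k * (pairing Y x1 + c) = 0.
  have p1 : 0 <= k * (pairing Y x1 + c) by rewrite mulr_ge0 ?h // ltW.
  have p2 : 0 <= \sum_i k * (pairing Y (x1 + row i A) + c).
    by apply: sumr_ge0 => i _; rewrite mulr_ge0 ?h // ltW.
  move: e0; rewrite x0E => /eqP; rewrite paddr_eq0 // => /andP[/eqP -> /eqP ->]; by [].
move=> [/eqP]; rewrite psumr_eq0; last by move=> i _; rewrite mulr_ge0 ?h // ltW.
move=> /allP hi /eqP; rewrite mulf_eq0 gt_eqF //= => /eqP h1.
have : A *m Y^T = 0.
  apply/pairing_rows => i; have := hi i; rewrite mem_index_enum => /(_ isT).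
  by rewrite mulf_eq0 gt_eqF //= pairingDr addrAC h1 add0r pairingC => /eqP.
have Au : A \in unitmx by rewrite -row_free_unit.
move=> /(congr1 (mulmx (invmx A))); rewrite mulmxA mulVmx // mul1mx mulmx0.
by move/(congr1 trmx); rewrite trmxK trmx0.
Qed.

(** When y satisfies one inequality with equality and the others strictly, small steps along
    the hyperplane remain in D, so that D meets the hyperplane in dimension n - 1. *)
Lemma hyperplane_facet (I : finType) (J : {set I}) (Yi : I -> 'rV[R]_n) ci j y D :
  D = [set xi | forall i, i \in J -> 0 <= pairing (Yi i) xi + ci i] -> j \in J ->
  Yi j != 0 -> pairing (Yi j) y + ci j = 0 ->
  (forall i, i \in J -> i != j -> 0 < pairing (Yi i) y + ci i) ->
  is_facet D (D `&` [set xi | pairing (Yi j) xi + ci j = 0]).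
Proof.
move=> DE jJ Y0 yj yi.
have Dy : D y.
  rewrite DE => i iJ; have [->|ij] := eqVneq i j; first by rewrite yj.
  by apply: ltW; exact: yi.
split.
  exists (Yi j), (ci j); split; first by move=> xi; rewrite DE; apply.
  by split=> //; exists y.
have n0 : (0 < n)%N.
  rewrite lt0n; apply/eqP => n0; case/eqP: Y0; apply/rowP => -[i hi].
  by exfalso; move: hi; rewrite n0.
pose K := kermx (Yi j)^T; pose B := row_base K.
have rK : \rank K = n.-1 by rewrite mxrank_ker mxrank_tr rank_rV Y0 subn1.
exists (\rank K); first by rewrite rK prednK.
have BY i : pairing (Yi j) (row i B) = 0.
  rewrite pairingC; move: i; apply/pairing_rows.
  by apply/sub_kermxP; rewrite eq_row_base.
have [e e0 he] : exists2 e, 0 < e & forall p : 'I_(\rank K) * I, 0 <=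
    (if (p.2 \in J) && (p.2 != j) then pairing (Yi p.2) y + ci p.2 else 0) +
    e * (if (p.2 \in J) && (p.2 != j) then pairing (Yi p.2) (row p.1 B) else 0).
  apply: exists_small_step => -[i l] /=; case: ifP => [/andP[h1 h2]|_]; last by right.
  by left; exact: yi.
exists y; first by split.
exists (e *: B); split.
- by rewrite /row_free (mxrank_scale_nz _ (lt0r_neq0 e0)); exact: row_base_free.
- move=> i; have rowE : row i (e *: B) = e *: row i B by rewrite linearZ.
  have onj : pairing (Yi j) (y + row i (e *: B)) + ci j = 0.
    by rewrite rowE pairingDr pairingZr BY mulr0 addr0.
  split=> //; rewrite DE => l lJ.
  have [->|lj] := eqVneq l j; first by rewrite onj.
  by have := he (i, l); rewrite /= lJ lj rowE pairingDr pairingZr addrAC.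
- move=> x [_ /= hx]; rewrite (eqmx_scale _ (lt0r_neq0 e0)) eq_row_base.
  apply/sub_kermxP; rewrite pairing_mulmx pairingC pairingBr.
  have -> : pairing (Yi j) x - pairing (Yi j) y = 0.
    by apply/eqP; rewrite subr_eq0 -(inj_eq (addIr (ci j))) hx yj.
  by rewrite raddf0.
Qed.

(** A polytope is the intersection of the half-spaces of its facets. In a minimal system of
    inequalities for D each member j is irredundant: some xj violates j alone. On the
    segment from an interior point x0 to xj the inequality j becomes an equality at a point
    where the others are strict, so j defines a facet ([hyperplane_facet]) and is a
    positive multiple of the inequality given for that facet. *)
Lemma facet_inequalities (D : set 'rV[R]_n) (xi : 'rV[R]_n) :
  convex_polytope D -> affine_dim D n ->
  (forall S, is_facet D S -> exists Y c, [/\ Y != 0, 0 <= pairing Y xi + c,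
     S `<=` [set x | pairing Y x + c = 0] & D `<=` [set x | 0 <= pairing Y x + c]]) ->
  D xi.
Proof.
move=> cD dD hxi; have [x0 Dx0 x0P] := interior_point cD dD.
have [_ [m [Yi [ci DE]]]] := cD.
pose sat (J : {set 'I_m}) x := forall i, i \in J -> 0 <= pairing (Yi i) x + ci i.
pose p (J : {set 'I_m}) := `[< forall x, sat J x -> D x >].
have [J /minsetP[/asboolP pJ minJ]] : {J | minset p J}.
  by apply: ex_minset; exists [set: 'I_m]%SET; apply/asboolP => x hx; rewrite DE => i; exact: hx.
have DJ : D = [set x | sat J x].
  by apply/seteqP; split=> x /=; [rewrite DE => h i _; exact: h | exact: pJ].
rewrite DJ => j jJ.
have Dge i x : D x -> 0 <= pairing (Yi i) x + ci i by rewrite DE; apply.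
have [xj satj xjneg] : exists2 xj, sat (J :\ j)%SET xj & pairing (Yi j) xj + ci j < 0.
  apply: contrapT => h.
  have /minJ : p (J :\ j)%SET.
    apply/asboolP => x hx; rewrite DJ => i iJ.
    have [ij|ij] := eqVneq i j; last by apply: hx; rewrite in_setD1 ij.
    by rewrite leNgt; apply/negP => hlt; apply: h; exists x => //; rewrite -ij.
  move=> /(_ (subsetDl _ _)) /setP /(_ j); rewrite !inE eqxx jJ; done.
have Yn0 i : i \in J -> Yi i != 0.
  move=> iJ; apply/eqP => Y0.
  have /minJ : p (J :\ i)%SET.
    apply/asboolP => x hx; rewrite DJ => l lJ.
    have [->|li] := eqVneq l i; last by apply: hx; rewrite in_setD1 li.
    by have := Dge i _ Dx0; rewrite Y0 !pairing0l.
  move=> /(_ (subsetDl _ _)) /setP /(_ i); rewrite !inE eqxx iJ; done.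
have pos i : i \in J -> 0 < pairing (Yi i) x0 + ci i.
  by move=> iJ; apply: x0P; [exact: Dge | exact: Yn0].
set s := pairing (Yi j) x0 + ci j; set r := pairing (Yi j) xj + ci j.
have s0 : 0 < s by exact: pos.
have r0 : r < 0 by [].
have sr : 0 < s - r by rewrite subr_gt0 (lt_trans r0).
(* the point of the segment from x0 to xj where inequality j is an equality *)
pose y := (s - r)^-1 *: (s *: xj - r *: x0).
have yE i : pairing (Yi i) y + ci i =
  (s - r)^-1 * (s * (pairing (Yi i) xj + ci i) - r * (pairing (Yi i) x0 + ci i)).
  rewrite /y pairingZr pairingBr !pairingZr.
  by field; rewrite gt_eqF.
have yj0 : pairing (Yi j) y + ci j = 0 by rewrite yE -/r -/s; ring.
have ypos i : i \in J -> i != j -> 0 < pairing (Yi i) y + ci i.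
  move=> iJ ij; rewrite yE; apply: mulr_gt0; first by rewrite invr_gt0.
  apply: ltr_wpDl; first by apply: mulr_ge0; [exact: ltW|apply: satj; rewrite in_setD1 ij].
  by rewrite -mulNr; apply: mulr_gt0; [rewrite oppr_gt0|exact: pos].
have fS := hyperplane_facet DJ jJ (Yn0 j jJ) yj0 ypos.
have [Y [c [Y0 Yxi SY DY]]] := hxi _ fS.
have [_ [k kn dimS]] := fS.
have [|a [YE cE]] := affine_hyperplane_unique kn dimS Y0 SY (Y := Yi j) (c := ci j).
  by move=> x [].
have Yx0 := x0P _ _ DY Y0.
have a0 : 0 < a.
  have := pos j jJ; rewrite YE cE pairingZl -mulrDr.
  by rewrite pmulr_lgt0.
by rewrite YE cE pairingZl -mulrDr mulr_ge0 // ltW.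
Qed.

End ConvexPolytope.

(** * Faces and vertices of a Delzant polytope *)
Section DelzantPolytope.
Context {R : realType} {n : nat} {F : finType} {T : zmodType}.
Variables (P : polytope_data R n F) (texp : {additive 'rV[R]_n -> T}).
Hypothesis hP : delzant P texp.
Implicit Types (Y xi v : 'rV[R]_n).

Local Notation X := (normal P).

(** The scaled distance from xi to the hyperplane of the facet f; on the level set this
    will be the value of |z_f|^2 / 2. *)
Definition slack (f : F) xi : R := pairing (X f) xi + offset P f.

Lemma slack_shift f xi Y : slack f (xi + Y) = slack f xi + pairing (X f) Y.
Proof. by rewrite /slack pairingDr addrAC. Qed.

Lemma normal_neq0 f : X f != 0.
Proof.
have [_ _ _ /(_ f) [_ prim] _] := hP.
apply/eqP => X0; have := prim 2 0; rewrite /= raddf0 X0 mul0rn.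
by move=> /(_ erefl erefl).
Qed.

Lemma Delta_slack f xi : Delta P xi -> 0 <= slack f xi.
Proof. by have [_ _ /(_ f) [_ h] _ _] := hP; exact: h. Qed.

(** The affine function defining the face is a multiple of the slack of f
    ([affine_hyperplane_unique]), so it vanishes wherever that slack does. *)
Lemma facetE f : facet P f = Delta P `&` [set xi | slack f xi = 0].
Proof.
have [_ [_ fac] /(_ f) [fsub _] _ _] := hP.
have [[Y [c [Yge [YE Y0]]]] [k kn dimf]] : is_facet (Delta P) (facet P f).
  by apply/fac; exists f.
have [a [Ya ca]] : exists a, Y = a *: X f /\ c = a * offset P f.
  apply: affine_hyperplane_unique kn dimf (normal_neq0 f) _ _.
    exact: fsub.
  by move=> xi; rewrite YE => -[].
apply/seteqP; split=> xi.
  by move=> fxi; split; [move: fxi; rewrite YE => -[]|exact: fsub].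
move=> [Dxi]; rewrite YE /= /slack => s0; split=> //=.
by rewrite Ya ca pairingZl -mulrDr s0 mulr0.
Qed.

Lemma DeltaE : Delta P = [set xi | forall f, 0 <= slack f xi].
Proof.
apply/seteqP; split=> xi; first by move=> Dxi f; exact: Delta_slack.
move=> hxi; have [[cD dD] [_ fac] ineq _ _] := hP.
apply: facet_inequalities cD dD _ => S /fac [f <-].
have [fsub Dsub] := ineq f.
exists (X f), (offset P f); split => //; first exact: normal_neq0.
exact: hxi.
Qed.

Lemma facets_atE xi f : Delta P xi -> (f \in facets_at P xi) = (slack f xi == 0).
Proof.
move=> Dxi; rewrite inE facetE; apply/asboolP/eqP => [[]//|s0]; by split.
Qed.

Lemma slack_gt0 xi f : Delta P xi -> (f \notin facets_at P xi) = (0 < slack f xi).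
Proof. by move=> Dxi; rewrite facets_atE // lt_def (Delta_slack f Dxi) andbT. Qed.

Lemma interior_slack : exists2 x0, Delta P x0 & forall f, 0 < slack f x0.
Proof.
have [[cD dD] _ _ _ _] := hP.
have [x0 Dx0 h] := interior_point cD dD; exists x0 => // f.
by apply: h; [move=> xi; exact: Delta_slack | exact: normal_neq0].
Qed.

Lemma vertex_Delta v : vertices (Delta P) v -> Delta P v.
Proof. by move=> [Y [c [_ [/seteqP[/(_ v erefl) []]]]]]. Qed.

(** The sum of the inequalities of all facets through v supports Delta exactly at v. *)
Lemma spanning_vertex v : Delta P v ->
  (forall Y, (forall f, f \in facets_at P v -> pairing (X f) Y = 0) -> Y = 0) ->
  vertices (Delta P) v.
Proof.
move=> Dv span.
exists (\sum_(f in facets_at P v) X f), (\sum_(f in facets_at P v) offset P f).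
have E xi : pairing (\sum_(f in facets_at P v) X f) xi +
    \sum_(f in facets_at P v) offset P f = \sum_(f in facets_at P v) slack f xi.
  by rewrite pairing_suml -big_split.
split=> [xi Dxi|].
  by rewrite E; apply: sumr_ge0 => f _; exact: Delta_slack.
split; last by exists v.
apply/seteqP; split=> xi.
  move=> ->; split=> //=; rewrite E big1 // => f.
  by rewrite facets_atE // => /eqP.
move=> [Dxi /=]; rewrite E => /eqP; rewrite psumr_eq0; last by move=> *; exact: Delta_slack.
move=> /allP h; apply/eqP; rewrite -subr_eq0; apply/eqP; apply: span => f fv.
have := h f; rewrite mem_index_enum fv => /(_ isT) /eqP sf.
have := fv; rewrite facets_atE // => /eqP sv.
by move: (slack_shift f v (xi - v)); rewrite subrKC sf sv add0r.
Qed.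

(** Otherwise Delta would contain a segment around v in a direction parallel to all facets
    through v, and no supporting hyperplane could isolate v. *)
Lemma vertex_spanning v : vertices (Delta P) v ->
  forall Y, (forall f, f \in facets_at P v -> pairing (X f) Y = 0) -> Y = 0.
Proof.
move=> hv Y hY; have Dv := vertex_Delta hv.
have step Y' : (forall f, f \in facets_at P v -> pairing (X f) Y' = 0) ->
    exists2 e, 0 < e & Delta P (v + e *: Y').
  move=> hY'; have [e e0 he] : exists2 e, 0 < e & forall f, 0 <= slack f v + e * pairing (X f) Y'.
    apply: exists_small_step => f; have [fv|] := boolP (f \in facets_at P v).
      by right; rewrite hY' //; split=> //; apply/eqP; rewrite -facets_atE.
    by rewrite slack_gt0 // => ?; left.
  by exists e => //; rewrite DeltaE => f; rewrite slack_shift pairingZr.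
have [e e0 De] := step Y hY.
have [e' e'0 De'] : exists2 e, 0 < e & Delta P (v + e *: (- Y)).
  by apply: step => f fv; rewrite pairingNr hY // oppr0.
have [Y0 [c [Yge [vE _]]]] := hv.
have vv : pairing Y0 v + c = 0 by move/seteqP: vE => [/(_ v erefl) []].
have Y00 : pairing Y0 Y = 0.
  apply/le_anti/andP; split.
    have := Yge _ De'; rewrite pairingDr addrAC vv add0r pairingZr pairingNr.
    by rewrite pmulr_rge0 // oppr_ge0.
  by have := Yge _ De; rewrite pairingDr addrAC vv add0r pairingZr pmulr_rge0.
have : [set v] (v + e *: Y).
  by rewrite vE; split=> //=; rewrite pairingDr addrAC vv add0r pairingZr Y00 mulr0.
move=> /= /eqP; rewrite -subr_eq0 addrAC subrr add0r scaler_eq0 gt_eqF //=.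
by move/eqP.
Qed.

(** Among the points of Delta lying on all the facets through xi, one lying on as many
    facets as possible is a vertex: if a direction parallel to these facets were left, one
    could follow it, Delta being bounded, until a further facet is met. *)
Lemma vertex_of_face xi : Delta P xi ->
  exists2 v, vertices (Delta P) v & facets_at P xi \subset facets_at P v.
Proof.
move=> Dxi.
pose p (S : {set F}) := `[< exists2 eta, Delta P eta &
  facets_at P eta = S /\ facets_at P xi \subset S >].
have [S /maxsetP[/asboolP[v Dv [<- xiv]] maxS]] : {S | maxset p S}.
  by apply: ex_maxset; exists (facets_at P xi); apply/asboolP; exists xi.
exists v => //; apply: spanning_vertex => // Y hY.
apply: contrapT => /eqP Y0.
have [f0 f0neg] : exists f, pairing (X f) Y < 0.
  apply: contrapT => hn.
  have DY t : 0 <= t -> Delta P (v + t *: Y).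
    move=> t0; rewrite DeltaE => f; rewrite slack_shift pairingZr.
    rewrite addr_ge0 ?Delta_slack // mulr_ge0 // leNgt; apply/negP => h.
    by apply: hn; exists f.
  have [[[[M [_ bD]] _] _] _ _ _ _] := hP.
  pose K := Num.max M 0 + 1.
  have MK : M < K by rewrite /K ltr_pwDr // le_max lexx.
  have K0 : 0 <= K by rewrite /K addr_ge0 // le_max lexx orbT.
  have nY : 0 < `|Y| by rewrite normr_gt0.
  have t0 : 0 <= (K + `|v| + 1) / `|Y| by rewrite divr_ge0 // addr_ge0 // addr_ge0.
  have := bD K MK _ (DY _ t0); apply/negP; rewrite -ltNge.
  rewrite addrC; apply: lt_le_trans (lerB_normD _ _).
  rewrite normrZ ger0_norm // divfK ?gt_eqF //.
  by rewrite addrAC addrK ltrDl.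
(* the time at which the facet f is met when leaving v in direction Y *)
pose c f := slack f v / - pairing (X f) Y.
pose f1 := [arg min_(f < f0 | pairing (X f) Y < 0) c f]%O.
have [f1neg f1min] : pairing (X f1) Y < 0 /\
    forall f, pairing (X f) Y < 0 -> c f1 <= c f.
  rewrite /f1.
  by case: (Order.TotalTheory.arg_minP (P := fun f => pairing (X f) Y < 0) c f0neg).
have f1v : f1 \notin facets_at P v.
  by apply/negP => /hY f10; move: f1neg; rewrite f10 ltxx.
have c0 : 0 < c f1 by rewrite divr_gt0 ?oppr_gt0 // -slack_gt0.
have Dw : Delta P (v + c f1 *: Y).
  rewrite DeltaE => f; rewrite slack_shift pairingZr.
  have [fneg|fpos] := ltP (pairing (X f) Y) 0; last first.
    by rewrite addr_ge0 ?Delta_slack // mulr_ge0 // ltW.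
  have := f1min f fneg; rewrite {2}/c ler_pdivlMr ?oppr_gt0 //.
  by rewrite mulrN -subr_ge0 opprK.
have /maxS : p (facets_at P (v + c f1 *: Y)).
  apply/asboolP; exists (v + c f1 *: Y) => //; split=> //.
  apply: (fintype.subset_trans xiv); apply/fintype.subsetP => f fv.
  rewrite facets_atE // slack_shift pairingZr hY // mulr0 addr0 -facets_atE //.
have sub : facets_at P v \subset facets_at P (v + c f1 *: Y).
  apply/fintype.subsetP => f fv.
  by rewrite facets_atE // slack_shift pairingZr hY // mulr0 addr0 -facets_atE.
move=> /(_ sub) E; case/negP: f1v; rewrite -E facets_atE // slack_shift pairingZr.
by rewrite /c invrN mulrN mulNr divfK ?(ltr0_neq0 f1neg) // subrr.
Qed.

Lemma ex_vertex : exists v, vertices (Delta P) v.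
Proof.
have [x0 /vertex_of_face [v hv _] _] := interior_slack; by exists v.
Qed.

End DelzantPolytope.

(** * Diophantine approximation *)
Section Pigeonhole.
Context {R : realType}.

(** Simultaneous approximation: by the pigeonhole principle two multiples of [a] have their
    fractional parts in the same small box, and p is the difference of the multipliers. *)
Lemma dirichlet (F : finType) (a : F -> R) (M : nat) :
  exists2 p : R, 1 <= `|p| & exists c : F -> int,
    forall f, `|(c f)%:~R - p * a f| < M.+1%:R^-1.
Proof.
pose fr (k : nat) f : R := k%:R * a f - (Num.floor (k%:R * a f))%:~R.
have fr0 k f : 0 <= fr k f by rewrite subr_ge0 ge_floor.
have fr1 k f : fr k f < 1.
  by rewrite ltrBlDl -[X in _ + X]/(1%:~R) -intrD floorD1_gt.
pose N := #|{ffun F -> 'I_M.+1}|.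
pose g (k : 'I_N.+1) : {ffun F -> 'I_M.+1} := [ffun f => inord (Num.truncn (M.+1%:R * fr k f))].
have [k [k' [kk' gkk']]] : exists k k', k != k' /\ g k = g k'.
  apply: contrapT => h.
  have /leq_card : injective g.
    by move=> k k' gk; apply/eqP; apply: contrapT => /negP kk'; apply: h; exists k, k'.
  by rewrite card_ord ltnn.
exists (k'%:R - k%:R).
  have -> : (k'%:R - k%:R : R) = (k'%:Z - k%:Z)%:~R by rewrite intrB.
  apply: norm_intr_ge1; first exact: intr_int.
  by rewrite intr_eq0 subr_eq0 eq_sym eqz_nat.
exists (fun f => Num.floor (k'%:R * a f) - Num.floor (k%:R * a f)) => f.
have tr (j : 'I_N.+1) : (g j f)%:R <= M.+1%:R * fr j f < (g j f).+1%:R.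
  rewrite ffunE inordK ?truncn_itv //; first by rewrite mulr_ge0.
  rewrite -(ltr_nat R); apply: le_lt_trans (_ : M.+1%:R * fr j f < _).
    by rewrite truncn_le // mulr_ge0.
  by rewrite -[X in _ < X]mulr1 ltr_pM2l // ltr0n.
have /andP[h1 h2] := tr k; have /andP[h3 h4] := tr k'.
rewrite -gkk' in h3 h4.
have -> : (Num.floor (k'%:R * a f) - Num.floor (k%:R * a f))%:~R - (k'%:R - k%:R) * a f
   = fr k f - fr k' f by rewrite intrB /fr; ring.
rewrite -[X in _ < X]mulr1 ltr_pdivlMl ?ltr0n //.
rewrite -[M.+1%:R]ger0_norm // -normrM ltr_norml mulrBr.
by rewrite -natr1 in h2 h4; apply/andP; split; lra.
Qed.
End Pigeonhole.

(** * The exponential map of the torus *)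
Section Torus.
Context {R : realType} {n : nat} {T : topologicalZmodType}.
Variables (AT : atlas R T) (texp : {additive 'rV[R]_n -> T}).
Hypothesis hT : torus_with_exp AT texp.

Lemma lattice_discrete :
  exists2 e, 0 < e & forall Y : 'rV[R]_n, `|Y| < e -> texp Y = 0 -> Y = 0.
Proof.
have [_ [_ [U0 [oU U00 inj _ _]]]] := hT.
have : nbhs (0 : 'rV[R]_n) U0 by exact: open_nbhs_nbhs.
move=> /nbhs_normP [e /= e0 sub].
exists e => // Y Ye texpY; apply: inj; rewrite ?inE ?raddf0 //.
by apply: sub; rewrite /= sub0r normrN.
Qed.

Lemma texp_open_image : exists2 H : set T, open H & H 0 /\ H `<=` range texp.
Proof.
have [_ [_ [U0 [oU U00 _ oim _]]]] := hT.
exists (texp @` U0) => //; split; first by exists 0; rewrite ?raddf0.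
by move=> _ [Y _ <-]; exists Y.
Qed.

Lemma translate_nbhs (H : set T) (t : T) : open H -> H 0 -> nbhs t [set s | H (s - t)].
Proof.
move=> oH H0.
have ct : {for t, continuous (fun s : T => s - t)}.
  apply: (@continuous_comp _ _ _ (fun s => (s, - t)) (fun z : T * T => z.1 + z.2)).
    by apply: cvg_pair; [exact: cvg_id|exact: cvg_cst].
  exact: add_continuous.
by apply: ct; rewrite subrr; exact: open_nbhs_nbhs.
Qed.

(** The image of the exponential map is an open subgroup, hence also closed, and T is
    connected. *)
Lemma texp_surjective t : exists Y, texp Y = t.
Proof.
have [H oH [H0 Hsub]] := texp_open_image.
have [[_ _ conn _ _] _] := hT.
have oR : open (range texp).
  rewrite openE => _ [Y _ <-]; apply: filterS (translate_nbhs _ oH H0) => s /Hsub [Y' _ Y'E].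
  by exists (Y' + Y) => //; rewrite raddfD /= Y'E subrK.
have cR : closed (range texp).
  rewrite -openC openE => s sN; apply: filterS (translate_nbhs _ oH H0) => s' /Hsub [Y' _ Y'E].
  move=> [Y _ YE]; apply: sN; exists (Y - Y') => //.
  by rewrite raddfB /= Y'E YE opprB addrC subrK.
have /seteqP[_ /(_ t I) [Y _ YE]] : range texp = setT.
  apply: conn; first by exists (texp 0); exists 0.
    by exists (range texp); rewrite ?setTI.
  by exists (range texp); rewrite ?setTI.
by exists Y.
Qed.

Lemma torus_atlas : smooth_atlas n AT.
Proof. by have [[[]]] := hT. Qed.

(** A logarithm near an arbitrary point t0 = texp Y0 is obtained from the one near the unit,
    t |-> Y0 + log (t - t0); it is smooth in the charts because the group operations are. *)
Lemma local_log a t0 : dom AT a t0 -> exists (D : set T) (l : T -> 'rV[R]_n),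
  [/\ open D, D t0, D `<=` dom AT a, forall t, D t -> texp (l t) = t &
      smooth_via (chart AT a) D l].
Proof.
move=> at0.
have hA := torus_atlas.
have [Y0 Y0E] := texp_surjective t0.
have [b bt0] := atlas_cover hA (- t0).
have [c c0] := atlas_cover hA 0.
have [dimA _ _ _ _] := hA.
have [[_ _ _ [cadd sadd] _] [_ [U0 [oU U00 injU oim slog]]]] := hT.
have dadd : (dom (prod_atlas AT AT) (a, b) `&`
    (fun st : T * T => st.1 + st.2) @^-1` dom AT c) (t0, - t0).
  by split=> //=; rewrite subrr.
have [W1 [g1 [oO1 O1t0 sg1 g1E]]] := sadd (a, b) c (t0, - t0) dadd.
have dlog : (U0 `&` texp @^-1` dom AT c) 0 by split=> //=; rewrite raddf0.
have [W2 [g2 [oO2 O20 sg2 g2E]]] := slog c 0 dlog.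
rewrite raddf0 in O20.
(* t - t0 is the sum of t and the fixed element - t0, so only the first variable moves *)
pose kap := chart AT b (- t0).
rewrite /= -/kap in O1t0.
pose D := [set t | [/\ dom AT a t, W1 (chart AT a t, kap), (texp @` U0) (t - t0),
   dom AT c (t - t0) & W2 (chart AT c (t - t0))]].
have csub t : {for t, continuous (fun s : T => s - t0)}.
  apply: (@continuous_comp _ _ _ (fun s => (s, - t0)) (fun z : T * T => z.1 + z.2)).
    by apply: cvg_pair; [exact: cvg_id|exact: cvg_cst].
  exact: add_continuous.
have oD : open D.
  rewrite openE => t [at_ O1t Ut ct O2t].
  have n1 := atlas_dom_nbhs hA at_.
  have n2 : \forall s \near t, W1 (chart AT a s, kap).
    have cc : (chart AT a s, kap) @[s --> t] --> (chart AT a t, kap).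
      by apply: cvg_pair; [exact: (atlas_chart_continuous hA at_)|exact: cvg_cst].
    by apply: cc; exact: open_nbhs_nbhs.
  have n3 : \forall s \near t, (texp @` U0) (s - t0) by apply: csub; exact: open_nbhs_nbhs.
  have n4 : \forall s \near t, dom AT c (s - t0) by apply: csub; exact: (atlas_dom_nbhs hA ct).
  have n5 : \forall s \near t, W2 (chart AT c (s - t0)).
    have cc := @continuous_comp _ _ _ _ _ t (csub t) (atlas_chart_continuous hA ct).
    by apply: cc; exact: open_nbhs_nbhs.
  by near=> s; split; near: s.
pose l t := Y0 + g2 (g1 (chart AT a t, kap)).
have g1D t : D t -> g1 (chart AT a t, kap) = chart AT c (t - t0).
  by move=> [at_ O1t _ ct _]; have := g1E (t, - t0) (conj (conj at_ bt0) ct) O1t.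
exists D, l; split=> //.
- split=> //=.
  + by rewrite subrr; exists 0; rewrite ?raddf0.
  + by rewrite subrr.
  + by rewrite subrr.
- by move=> t [].
- move=> t Dt; rewrite /l g1D // raddfD /= Y0E.
  have [_ _ [Y UY YE] ct O2t] := Dt.
  rewrite -YE -(g2E Y); first by rewrite YE subrKC.
    by split=> //=; rewrite YE.
  by rewrite YE.
- pose inc (x : model AT a) : (model AT a * model AT b)%type := (x, kap).
  have sinc : smooth setT inc.
    by apply: smooth_pair; [exact: openT|exact: smooth_id|exact: smooth_cst].
  have oQ : open (setT `&` inc @^-1` W1) by apply: smooth_preimage_open => //; exact: openT.
  have dab := has_dim_prod (dimA a) (dimA b).
  have s1 : smooth (setT `&` inc @^-1` W1) (fun x => g1 (inc x)).
    apply: (smooth_comp dab (dimA c) oQ oO1) => //; first by move=> x [].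
    exact: smooth_sub sinc.
  have oQ' := smooth_preimage_open oQ s1 oO2.
  apply: (smooth_via_of_smooth (g := fun x => Y0 + g2 (g1 (inc x))) oQ') => //.
    apply: smooth_add => //; first exact: smooth_cst.
    apply: (smooth_comp (dimA c) (has_dim_rV n) oQ' oO2) => //; first by move=> x [].
    by apply: smooth_sub s1 => x [].
  move=> t Dt; have [_ O1t _ _ O2t] := Dt; split=> //=.
  by rewrite /inc g1D.
Unshelve. all: by end_near. Qed.

End Torus.

(** * The basis of normals at a vertex *)
Section VertexBasis.
Context {R : realType} {n : nat} {F : finType} {T : topologicalZmodType}.
Variables (AT : atlas R T) (texp : {additive 'rV[R]_n -> T}).
Variables (P : polytope_data R n F).
Hypothesis hT : torus_with_exp AT texp.
Hypothesis hP : delzant P texp.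
Implicit Types (Y xi v : 'rV[R]_n).

Local Notation X := (normal P).

Lemma texp_normal f : texp (X f) = 0.
Proof. by have [_ _ _ /(_ f) [h _] _] := hP. Qed.

Lemma texp_int_comb (S : {set F}) (c : F -> int) :
  texp (\sum_(f in S) X f *~ c f) = 0.
Proof. by rewrite raddf_sum big1 // => f _; rewrite raddfMz /= texp_normal mul0rz. Qed.

(** A Z-basis of a discrete subgroup is independent over R. A real relation could be
    approximated by integral ones: with p a - c small, the lattice vector given by c is
    close to 0 ([dirichlet]), hence 0, hence c = 0; then |a f| <= |p a f| is small. *)
Lemma normal_free v (a : F -> R) : vertices (Delta P) v ->
  \sum_(f in facets_at P v) a f *: X f = 0 -> forall f, f \in facets_at P v -> a f = 0.
Proof.
move=> hv a0 f fv.
have [_ _ _ _ /(_ v hv) [_ indep]] := hP.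
have [e e0 he] := lattice_discrete hT.
pose C := \sum_(f in facets_at P v) `|X f|.
have C0 : 0 <= C by apply: sumr_ge0.
suff bnd (M : nat) : C / e < M.+1%:R -> `|a f| < M.+1%:R^-1.
  apply/eqP; rewrite -normr_le0 leNgt; apply/negP => af0.
  pose M := Num.truncn (Num.max (C / e) `|a f|^-1).
  have hM : Num.max (C / e) `|a f|^-1 < M.+1%:R by exact: truncnS_gt.
  move: hM; rewrite gt_max => /andP[/bnd h1 h2].
  move: h1; rewrite ltNge => /negP; apply.
  by rewrite -[leRHS]invrK lef_pV2 ?posrE ?invr_gt0 // ltW.
move=> hM; have [p p1 [c hc]] := dirichlet a M.
have E : \sum_(f in facets_at P v) X f *~ c f =
   \sum_(f in facets_at P v) ((c f)%:~R - p * a f) *: X f.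
  have p0 : \sum_(f in facets_at P v) (p * a f) *: X f = 0.
    under eq_bigr do rewrite -scalerA.
    by rewrite -scaler_sumr a0 scaler0.
  under [RHS]eq_bigr do rewrite scalerBl.
  by rewrite sumrB p0 subr0; apply: eq_bigr => g _; rewrite scaler_int.
have c0 : \sum_(f in facets_at P v) X f *~ c f = 0.
  apply: he (texp_int_comb _ _); rewrite E.
  apply: le_lt_trans (ler_norm_sum _ _ _) _.
  apply: (@le_lt_trans _ _ (M.+1%:R^-1 * C)).
    rewrite /C mulr_sumr; apply: ler_sum => g _; rewrite normrZ.
    by apply: ler_wpM2r => //; exact: ltW.
  by rewrite ltr_pdivrMl ?ltr0n // -ltr_pdivrMr.
have := hc f; rewrite (indep c c0 f fv) sub0r normrN normrM.
by apply: le_lt_trans; rewrite ler_peMl.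
Qed.

Definition dual_basis v (e : F -> 'rV[R]_n) : Prop :=
  (forall f g, f \in facets_at P v -> g \in facets_at P v ->
     pairing (X f) (e g) = (f == g)%:R) /\
  forall Y, Y = \sum_(f in facets_at P v) pairing Y (e f) *: X f.

Lemma ex_dual_basis v : vertices (Delta P) v ->
  #|facets_at P v| = n /\ exists e, dual_basis v e.
Proof.
move=> hv; set S := facets_at P v.
pose A := \matrix_(i < #|S|) X (enum_val i).
have Afree : row_free A.
  rewrite -kermx_eq0; apply/rowV0P => u /sub_kermxP uA.
  apply/rowP => i; rewrite mxE.
  pose a f := \sum_(j < #|S| | enum_val j == f) u 0 j.
  have aE j : a (enum_val j) = u 0 j.
    by rewrite /a (big_pred1 j) // => l /=; rewrite (inj_eq enum_val_inj).
  rewrite -aE; apply: (normal_free hv); last exact: enum_valP.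
  rewrite -[RHS]uA mulmx_sum_row big_enum_val.
  by apply: eq_bigr => j _; rewrite aE rowK.
have Afull : row_full A.
  rewrite /row_full -mxrank_tr -/(row_free A^T) -kermx_eq0; apply/rowV0P => u /sub_kermxP uA.
  apply: (vertex_spanning hP hv) => f fS.
  have /pairing_rows/(_ (enum_rank_in fS f)) : A *m u^T = 0.
    by apply: trmx_inj; rewrite trmx_mul trmxK uA trmx0.
  by rewrite rowK enum_rankK_in.
split.
  by move: Afull Afree; rewrite /row_full /row_free => /eqP -> /eqP.
have [B AB] := row_freeP Afree; have [L LA] := row_fullP Afull.
have {L LA} BA : B *m A = 1%:M by rewrite -LA -[L in RHS]mulmx1 -AB mulmxA LA mul1mx.
pose e f := \sum_(j < #|S| | enum_val j == f) (col j B)^T.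
have eE j : e (enum_val j) = (col j B)^T.
  by rewrite /e (big_pred1 j) // => l /=; rewrite (inj_eq enum_val_inj).
have pe Y j : pairing Y (e (enum_val j)) = (Y *m B) 0 j.
  by rewrite eE mxE; apply: eq_bigr => k _; rewrite !mxE.
exists e; split=> [f g fS gS|Y].
  have fi : f = enum_val (enum_rank_in fS f) by rewrite enum_rankK_in.
  have gj : g = enum_val (enum_rank_in fS g) by rewrite enum_rankK_in.
  rewrite fi gj (inj_eq enum_val_inj) pe -(rowK (fun i => X (enum_val i))).
  by rewrite -row_mul AB !mxE.
rewrite big_enum_val -[LHS]mulmx1 -BA mulmxA mulmx_sum_row.
by apply: eq_bigr => j _; rewrite pe rowK.
Qed.

(** The basis dual to the normals at v. Its members span the edges of Delta issuing from v. *)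
Definition edge v : F -> 'rV[R]_n := xget (fun=> 0) [set e | dual_basis v e].

Lemma edge_dual v : vertices (Delta P) v -> dual_basis v (edge v).
Proof.
move=> /ex_dual_basis [_ [e he]].
exact: (@xgetPex _ (fun=> 0) [set e | dual_basis v e] (ex_intro _ e he)).
Qed.

Lemma card_facets_at v : vertices (Delta P) v -> #|facets_at P v| = n.
Proof. by move=> /ex_dual_basis []. Qed.

Lemma edge_decomp v xi : vertices (Delta P) v ->
  xi = \sum_(f in facets_at P v) pairing (X f) xi *: edge v f.
Proof.
move=> hv; have [_ h] := edge_dual hv.
apply/eqP; rewrite -subr_eq0; apply/eqP/pairing_eq0 => Y.
rewrite pairingBr {1}(h Y) pairing_suml pairing_sumr -sumrB big1 // => f _.
by rewrite pairingZl pairingZr mulrC subrr.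
Qed.

Lemma normal_coef_int v f' : vertices (Delta P) v ->
  exists c : F -> int, forall f, f \in facets_at P v -> pairing (X f') (edge v f) = (c f)%:~R.
Proof.
move=> hv; have [h1 _] := edge_dual hv.
have [_ _ _ _ /(_ v hv) [span _]] := hP.
have [c cE] := span _ (texp_normal f').
exists c => f fv; rewrite {1}cE pairing_suml (bigD1 f) //= big1 ?addr0.
  by rewrite -scaler_int pairingZl h1 // eqxx mulr1.
by move=> g /andP[gv gf]; rewrite -scaler_int pairingZl h1 // (negbTE gf) mulr0.
Qed.

(** The integers c_f'f in X_f' = sum_f c_f'f X_f, with f in F_v. They govern all changes of
    charts. *)
Definition coef v (f' f : F) : int := Num.floor (pairing (X f') (edge v f)).

Lemma coefE v f' f : vertices (Delta P) v -> f \in facets_at P v ->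
  pairing (X f') (edge v f) = (coef v f' f)%:~R.
Proof.
by move=> hv fv; have [c cE] := normal_coef_int f' hv; rewrite /coef cE // intrKfloor.
Qed.

Lemma normal_coef v f' : vertices (Delta P) v ->
  X f' = \sum_(f in facets_at P v) (coef v f' f)%:~R *: X f.
Proof.
move=> hv; have [_ h] := edge_dual hv; rewrite {1}(h (X f')).
by apply: eq_bigr => f fv; rewrite -coefE.
Qed.

Lemma lattice_coord_int v Y f : vertices (Delta P) v -> f \in facets_at P v ->
  texp Y = 0 -> pairing Y (edge v f) \is a Num.int.
Proof.
move=> hv fv tY; have [h1 _] := edge_dual hv.
have [_ _ _ _ /(_ v hv) [span _]] := hP.
have [c cE] := span _ tY.
rewrite {1}cE pairing_suml (bigD1 f) //= big1 ?addr0.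
  by rewrite -scaler_int pairingZl h1 // eqxx mulr1 intr_int.
by move=> g /andP[gv gf]; rewrite -scaler_int pairingZl h1 // (negbTE gf) mulr0.
Qed.

Lemma lattice_of_coord v Y : vertices (Delta P) v ->
  (forall f, f \in facets_at P v -> pairing Y (edge v f) \is a Num.int) -> texp Y = 0.
Proof.
move=> hv hY; have [_ h] := edge_dual hv.
rewrite (h Y) -(texp_int_comb (facets_at P v) (fun f => Num.floor (pairing Y (edge v f)))).
by congr (texp _); apply: eq_bigr => f /hY /floorK {1}<-; rewrite scaler_int.
Qed.

End VertexBasis.

(** * Unit complex numbers *)
Section Cis.
Context {R : realType}.
Local Notation C := (complex R).
Implicit Types (t : R) (w : C).

(** The exponential e^{2 pi i t}. *)
Definition cis t : C := Complex (cos (2 * pi * t)) (sin (2 * pi * t)).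

Lemma cisD s t : cis (s + t) = cis s * cis t.
Proof.
apply/eqP; rewrite eq_complex /=; rewrite mulrDr cosD sinD.
by rewrite eqxx /= addrC.
Qed.

Lemma cis0 : cis 0 = 1.
Proof. by rewrite /cis mulr0 cos0 sin0. Qed.

Lemma cis_neq0 t : cis t != 0.
Proof.
apply/eqP => h; have := cisD t (- t); rewrite h mul0r subrr cis0 => /esym/eqP.
by rewrite eq_sym oner_eq0.
Qed.

Lemma cisN t : cis (- t) = (cis t)^-1.
Proof.
apply: (mulfI (cis_neq0 t)); rewrite -cisD subrr cis0 divff //; exact: cis_neq0.
Qed.

Lemma cis_natmul t k : cis (k%:R * t) = cis t ^+ k.
Proof.
elim: k => [|k IH]; first by rewrite mul0r cis0 expr0.
by rewrite -natr1 mulrDl mul1r cisD IH exprSr.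
Qed.

Lemma cis_intmul t (k : int) : cis (k%:~R * t) = cis t ^ k.
Proof.
case: k => k; first exact: cis_natmul.
have -> : (Negz k)%:~R * t = - (k.+1%:R * t) by rewrite NegzE mulrNz mulNr.
by rewrite cisN cis_natmul.
Qed.

Lemma cis_sum (I : Type) (r : seq I) (p : pred I) (f : I -> R) :
  cis (\sum_(i <- r | p i) f i) = \prod_(i <- r | p i) cis (f i).
Proof. by apply: (big_morph cis cisD cis0). Qed.

Lemma normc_cis t : normc (cis t) = 1.
Proof. by rewrite /normc /cis cos2Dsin2 sqrtr1. Qed.

Lemma cis_int t : t \is a Num.int -> cis t = 1.
Proof.
move=> /floorK <-; rewrite -[_%:~R]mulr1 cis_intmul.
suff -> : cis 1 = 1 by rewrite exp1rz.
by rewrite /cis mulr1 mulr_natl cos2pi sin2pi.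
Qed.

Lemma cis_eq1 t : cis t = 1 -> t \is a Num.int.
Proof.
pose x := t - (Num.floor t)%:~R => ct.
have x0 : 0 <= x by rewrite subr_ge0 ge_floor.
have x1 : x < 1.
  by rewrite ltrBlDl -[X in _ + X]/(1%:~R) -intrD floorD1_gt.
have : cis x = 1 by rewrite cisD ct mul1r cisN cis_int ?invr1 // intr_int.
move=> /(congr1 (@complex.Re R)) /= cx.
suff x00 : x = 0 by rewrite -(subrK (Num.floor t)%:~R t) -/x x00 add0r intr_int.
have pi0 := pi_gt0 R.
have inj (y : R) : 0 <= y <= pi -> cos y = 1 -> y = 0.
  move=> yI cy; apply: cos_inj; rewrite ?in_itv //= ?cos0 //.
  by rewrite lexx ltW.
have [xh|xh] := leP x (1 / 2).
  have : 2 * pi * x = 0.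
    apply: inj => //; apply/andP; split; first by rewrite !mulr_ge0 // ltW.
    by rewrite mulrC mulrA ger_pMl // ; lra.
  by move/eqP; rewrite mulf_eq0 gt_eqF ?mulr_gt0 //= => /eqP.
have : 2 * pi * (1 - x) = 0.
  apply: inj; last by rewrite mulrBr mulr1 mulr_natl cosB cos2pi sin2pi -mulr_natl cx; ring.
  apply/andP; split; first by rewrite !mulr_ge0 // ?ltW // subr_gt0.
  by rewrite mulrC mulrA ger_pMl //; lra.
move/eqP; rewrite mulf_eq0 gt_eqF ?mulr_gt0 //= => /eqP; lra.
Qed.

Lemma unit_cis w : normc w = 1 -> exists t, cis t = w.
Proof.
case: w => a b; rewrite /normc => h.
have {}h : a ^+ 2 + b ^+ 2 = 1.
  by rewrite -[LHS]sqr_sqrtr ?h ?expr1n // addr_ge0 // sqr_ge0.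
have b2 : 0 <= b ^+ 2 by exact: sqr_ge0.
have a1 : -1 <= a <= 1.
  by rewrite -ler_norml -sqrtr_sqr -[leRHS]sqrtr1; apply: ler_wsqrtr; rewrite -h lerDl.
have pi0 : 2 * pi != 0 :> R by rewrite mulf_neq0 // gt_eqF // pi_gt0.
have sb : Num.sqrt (1 - a ^+ 2) = `|b|.
  by rewrite -h addrAC subrr add0r sqrtr_sqr.
have [b0|b0] := leP 0 b.
  exists (acos a / (2 * pi)); rewrite /cis mulrCA divff // mulr1 acosK ?sin_acos ?in_itv //=.
  by rewrite sb ger0_norm.
exists (- (acos a / (2 * pi))); rewrite /cis mulrN mulrCA divff // mulr1 cosN sinN.
by rewrite acosK ?sin_acos ?in_itv //= sb ltr0_norm // opprK.
Qed.

Lemma normc_ge0 w : 0 <= normc w.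
Proof. by case: w => a b; exact: sqrtr_ge0. Qed.

Lemma normc_eq0 w : (normc w == 0) = (w == 0).
Proof. by apply/eqP/eqP => [/eq0_normc|->] //; exact: normc0. Qed.

Lemma normc_real (r : R) : normc (Complex r 0) = `|r|.
Proof. by rewrite /normc expr0n /= addr0 sqrtr_sqr. Qed.

Lemma normcX w k : normc (w ^+ k) = normc w ^+ k.
Proof. by elim: k => [|k IH]; rewrite ?expr0 ?normc1 // !exprS normcM IH. Qed.

Lemma real_complex_eq0 (r : R) : (Complex r 0 == 0) = (r == 0).
Proof. by rewrite eq_complex /= eqxx andbT. Qed.

Definition phase w : C := w / Complex (normc w) 0.

Lemma phase_cis t w : phase (cis t * w) = cis t * phase w.
Proof. by rewrite /phase normcM normc_cis mul1r mulrA. Qed.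

Lemma phase_pos (r : R) : 0 < r -> phase (Complex r 0) = 1.
Proof.
move=> r0; rewrite /phase normc_real gtr0_norm // divff //.
by rewrite real_complex_eq0 gt_eqF.
Qed.

Lemma normc_phase w : w != 0 -> normc (phase w) = 1.
Proof.
move=> w0; rewrite /phase normcM normcV normc_real ger0_norm ?normc_ge0 //.
by rewrite divff // normc_eq0.
Qed.

Lemma phaseE w : w != 0 -> w = phase w * Complex (normc w) 0.
Proof.
by move=> w0; rewrite /phase divfK // real_complex_eq0 normc_eq0.
Qed.

Lemma normc_expz w (k : int) : normc w = 1 -> normc (w ^ k) = 1.
Proof.
move=> w1; case: k => k; first by rewrite -exprnP normcX w1 expr1n.
by rewrite NegzE -exprnN normcV normcX w1 expr1n invr1.
Qed.

Lemma normc_prod (I : Type) (r : seq I) (p : pred I) (h : I -> C) :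
  normc (\prod_(i <- r | p i) h i) = \prod_(i <- r | p i) normc (h i).
Proof. exact: (big_morph (@normc R) (@normcM R) (@normc1 R)). Qed.

End Cis.

(** * Complex coordinates *)
Section ComplexCoordinates.
Context {R : realType} {I : finType}.
Local Notation C := (complex R).
Implicit Types z w : Cspace R I.

(** The coordinate z_i as a complex number; rotations become multiplications. *)
Definition zc z (i : I) : C := Complex (rePart z i) (imPart z i).

Definition ofC (w : I -> C) : Cspace R I :=
  mkC (fun i => complex.Re (w i)) (fun i => complex.Im (w i)).

Lemma zc_ofC h i : zc (ofC h) i = h i.
Proof. by rewrite /zc rePart_mkC imPart_mkC; case: (h i). Qed.

Lemma zc_inj z w : (forall i, zc z i = zc w i) -> z = w.
Proof. by move=> h; apply: Cspace_ext => i; have [] := h i. Qed.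

Lemma rePart_lin (a : R) z w i :
  rePart (a *: z + w) i = a * rePart z i + rePart w i.
Proof. by rewrite /rePart !mxE. Qed.

Lemma imPart_lin (a : R) z w i :
  imPart (a *: z + w) i = a * imPart z i + imPart w i.
Proof. by rewrite /imPart !mxE. Qed.

Lemma zc_rotate t z i : zc (rotate t z) i = cis (t i) * zc z i.
Proof.
apply/eqP; rewrite eq_complex /= rePart_mkC imPart_mkC eqxx /=.
by rewrite addrC.
Qed.

Lemma mu_zc z i : mu z i = normc (zc z i) ^+ 2 / 2.
Proof. by rewrite /mu /normc /= sqr_sqrtr // addr_ge0 // sqr_ge0. Qed.

Lemma mu_ge0 z i : 0 <= mu z i.
Proof. by rewrite mu_zc divr_ge0 // sqr_ge0. Qed.

Lemma mu_gt0 z i : (0 < mu z i) = (zc z i != 0).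
Proof.
rewrite mu_zc pmulr_lgt0 ?invr_gt0 // lt_def sqr_ge0 andbT sqrf_eq0.
by rewrite normc_eq0.
Qed.

End ComplexCoordinates.

(** * Smooth complex-valued functions *)
Section SmoothComplex.
Context {R : realType}.
Local Notation C := (complex R).
Implicit Types V W : normedModType R.

Definition csmooth V (D : set V) (h : V -> C) : Prop :=
  smooth D (fun x => complex.Re (h x)) /\ smooth D (fun x => complex.Im (h x)).

Variables (V : normedModType R) (D : set V).
Hypothesis oD : open D.

Lemma csmooth_ext (h g : V -> C) :
  (forall x, D x -> h x = g x) -> csmooth D h -> csmooth D g.
Proof.
by move=> hg [h1 h2]; split; [apply: smooth_ext h1|apply: smooth_ext h2] => // x /hg ->.
Qed.

Lemma csmooth_cst (a : C) : csmooth D (fun=> a).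
Proof. by split; exact: smooth_cst. Qed.

Lemma csmooth_mul (h g : V -> C) : csmooth D h -> csmooth D g -> csmooth D (fun x => h x * g x).
Proof.
move=> [h1 h2] [g1 g2]; split.
  have key := smooth_add oD (smooth_mul oD h1 g1) (smooth_opp oD (smooth_mul oD h2 g2)).
  apply: smooth_ext key => // x _.
  by case: (h x) (g x) => [a b] [c d].
apply: smooth_ext (smooth_add oD (smooth_mul oD h1 g2) (smooth_mul oD h2 g1)) => // x _.
by case: (h x) (g x) => [a b] [c d].
Qed.

Lemma smooth_invr (f : V -> R) : (forall x, D x -> f x != 0) -> smooth D f ->
  smooth D (fun x => (f x)^-1).
Proof.
move=> f0 sf.
exact: (smooth_comp has_dim_real has_dim_real oD (@open_neq R 0) f0 sf smooth_inv).
Qed.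

Lemma smooth_normsq (h : V -> C) : csmooth D h ->
  smooth D (fun x => complex.Re (h x) ^+ 2 + complex.Im (h x) ^+ 2).
Proof.
move=> [h1 h2].
apply: smooth_ext (smooth_add oD (smooth_mul oD h1 h1) (smooth_mul oD h2 h2)) => // x _.
Qed.

Lemma csmooth_inv (h : V -> C) : (forall x, D x -> h x != 0) -> csmooth D h ->
  csmooth D (fun x => (h x)^-1).
Proof.
move=> h0 sh; have sn := smooth_normsq sh; have [h1 h2] := sh.
have n0 x : D x -> complex.Re (h x) ^+ 2 + complex.Im (h x) ^+ 2 != 0.
  move=> /h0; case: (h x) => a b /=; rewrite eq_complex negb_and /= => ab.
  by rewrite paddr_eq0 ?sqr_ge0 // !sqrf_eq0 negb_and.
have si := smooth_invr n0 sn.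
split.
  by apply: smooth_ext (smooth_mul oD h1 si) => // x _; case: (h x).
apply: smooth_ext (smooth_opp oD (smooth_mul oD h2 si)) => // x _; case: (h x) => a b //=.
Qed.

Lemma csmooth_real (f : V -> R) : smooth D f -> csmooth D (fun x => Complex (f x) 0).
Proof. by move=> sf; split => //; exact: smooth_cst. Qed.

Lemma csmooth_expn (h : V -> C) k : csmooth D h -> csmooth D (fun x => h x ^+ k).
Proof.
move=> sh; elim: k => [|k IH]; first exact: csmooth_cst.
by apply: csmooth_ext (csmooth_mul sh IH) => x _; rewrite exprS.
Qed.

Lemma csmooth_expz (h : V -> C) (k : int) : (forall x, D x -> h x != 0) -> csmooth D h ->
  csmooth D (fun x => h x ^ k).
Proof.
move=> h0 sh; case: k => k; first exact: csmooth_expn.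
apply: csmooth_inv; last exact: csmooth_expn.
by move=> x Dx; rewrite expf_neq0 // h0.
Qed.

Lemma csmooth_prod (I : Type) (r : seq I) (p : pred I) (h : I -> V -> C) :
  (forall i, p i -> csmooth D (h i)) -> csmooth D (fun x => \prod_(i <- r | p i) h i x).
Proof.
move=> sh; elim: r => [|i r IH].
  by apply: csmooth_ext (csmooth_cst 1) => x _; rewrite big_nil.
have [pi|npi] := boolP (p i).
  by apply: csmooth_ext (csmooth_mul (sh i pi) IH) => x _; rewrite big_cons pi.
by apply: csmooth_ext IH => x _; rewrite big_cons (negbTE npi).
Qed.

Lemma smooth_sqrt_comp (f : V -> R) : (forall x, D x -> 0 < f x) -> smooth D f ->
  smooth D (fun x => Num.sqrt (f x)).
Proof.
move=> f0 sf.
exact: (smooth_comp has_dim_real has_dim_real oD (@open_gt R 0) f0 sf smooth_sqrt).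
Qed.

Lemma csmooth_phase (h : V -> C) : (forall x, D x -> h x != 0) -> csmooth D h ->
  csmooth D (fun x => phase (h x)).
Proof.
move=> h0 sh; apply: csmooth_mul => //.
apply: csmooth_inv.
  by move=> x /h0; rewrite real_complex_eq0 normc_eq0.
apply: csmooth_real.
have n0 x : D x -> 0 < complex.Re (h x) ^+ 2 + complex.Im (h x) ^+ 2.
  move=> /h0; case: (h x) => a b /=; rewrite eq_complex negb_and /= => ab.
  by rewrite lt_def paddr_eq0 ?sqr_ge0 // !sqrf_eq0 negb_and ab addr_ge0 ?sqr_ge0.
apply: smooth_ext (smooth_sqrt_comp n0 (smooth_normsq sh)) => // x _.
by case: (h x).
Qed.

Lemma csmooth_zc (I : finType) (f : V -> Cspace R I) i :
  smooth D f -> csmooth D (fun x => zc (f x) i).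
Proof.
move=> sf; split=> /=.
  exact: (smooth_coord_comp _ oD (smooth_fst_comp oD sf)).
exact: (smooth_coord_comp _ oD (smooth_snd_comp oD sf)).
Qed.

Lemma smooth_ofC (I : finType) (h : I -> V -> C) : (forall i, csmooth D (h i)) ->
  smooth D (fun x => ofC (fun i => h i x)).
Proof.
move=> sh; apply: smooth_pair => //.
  apply: (smooth_row (f := fun j x => complex.Re (h (enum_val j) x))) => // j.
  by have [] := sh (enum_val j).
apply: (smooth_row (f := fun j x => complex.Im (h (enum_val j) x))) => // j.
by have [] := sh (enum_val j).
Qed.

Lemma csmooth_cis (f : V -> R) : smooth D f -> csmooth D (fun x => cis (f x)).
Proof.
move=> sf; have s2 := smooth_mul oD (smooth_cst D (2 * pi : R)) sf.
split.
  exact: (smooth_comp has_dim_real has_dim_real oD openT (fun _ _ => I) s2 smooth_cos).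
exact: (smooth_comp has_dim_real has_dim_real oD openT (fun _ _ => I) s2 smooth_sin).
Qed.

Lemma smooth_mu (I : finType) (f : V -> Cspace R I) i :
  smooth D f -> smooth D (fun x => mu (f x) i).
Proof.
move=> sf; have s1 := smooth_normsq (csmooth_zc i sf).
apply: smooth_ext (smooth_mul oD s1 (smooth_cst D (2^-1 : R))) => // x _.
Qed.

End SmoothComplex.

Lemma has_dim_Cspace {R : realType} (I : finType) : has_dim (Cspace R I) (#|I| + #|I|).
Proof. by apply: has_dim_prod; exact: has_dim_rV. Qed.

(** * The level set and its parametrization over a vertex *)
Section LevelSet.
Context {R : realType} {n : nat} {F : finType} {T : topologicalZmodType}.
Variables (AT : atlas R T) (texp : {additive 'rV[R]_n -> T}).
Variables (P : polytope_data R n F).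
Hypothesis hT : torus_with_exp AT texp.
Hypothesis hP : delzant P texp.
Implicit Types (Y xi v : 'rV[R]_n) (t : F -> R).

Local Notation X := (normal P).
Local Notation C := (complex R).
Local Notation edge := (edge P).
Local Notation coef := (coef P).
Local Notation slack := (slack P).
Local Notation Fv := (facets_at P).

Lemma big_facet_index v (V : nmodType) (g : F -> V) :
  \sum_(f : facet_index P v) g (val f) = \sum_(f in Fv v) g f.
Proof.
rewrite [RHS](@reindex_omap _ _ _ _ (facet_index P v) val
  (fun f => insub f : option (facet_index P v))) /=.
  by apply: eq_bigl => f; rewrite valK eqxx andbT (valP f).
by move=> f fv; rewrite insubT.
Qed.

Lemma facet_indexP v (f : facet_index P v) : val f \in Fv v.
Proof. exact: valP. Qed.

Definition facet_of v f (fv : f \in Fv v) : facet_index P v := exist _ f fv.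

Lemma val_facet_of v f (fv : f \in Fv v) : val (facet_of fv) = f.
Proof. by []. Qed.

Lemma normal_span Y Y' : (forall f, pairing (X f) Y = pairing (X f) Y') -> Y = Y'.
Proof.
have [v hv] := ex_vertex hP; move=> h.
apply/eqP; rewrite -subr_eq0; apply/eqP/(vertex_spanning hP hv) => f _.
by rewrite pairingBr h subrr.
Qed.

Lemma slack_inj xi xi' v : vertices (Delta P) v ->
  (forall f, f \in Fv v -> slack f xi = slack f xi') -> xi = xi'.
Proof.
move=> hv h; apply/eqP; rewrite -subr_eq0; apply/eqP/(vertex_spanning hP hv) => f fv.
by rewrite pairingBr; apply/eqP; rewrite subr_eq0 -(inj_eq (addIr (offset P f))); apply/eqP/h.
Qed.

(** The point of the dual of the Lie algebra whose slacks at the facets of F_v take the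
    values m; it depends on m in F_v only. *)
Definition from_mu v (m : F -> R) : 'rV[R]_n :=
  \sum_(f in Fv v) (m f - offset P f) *: edge v f.

Lemma slack_from_mu v m f : vertices (Delta P) v -> f \in Fv v -> slack f (from_mu v m) = m f.
Proof.
move=> hv fv; have [h1 _] := edge_dual hT hP hv.
rewrite /slack /from_mu pairing_sumr (bigD1 f) //= big1 ?addr0.
  by rewrite pairingZr h1 // eqxx mulr1 subrK.
by move=> g /andP[gv gf]; rewrite pairingZr h1 // eq_sym (negbTE gf) mulr0.
Qed.

Lemma slack_normal_coef v f' xi : vertices (Delta P) v ->
  slack f' xi - offset P f' = \sum_(f in Fv v) (coef v f' f)%:~R * (slack f xi - offset P f).
Proof.
move=> hv; rewrite /slack addrK {1}(normal_coef hT hP f' hv) pairing_suml.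
by apply: eq_bigr => f _; rewrite pairingZl addrK.
Qed.

(** The relations defining Z say that mu z - lambda annihilates the kernel of pi, and the
    annihilator of that kernel is the image of the transpose of pi. Concretely, the
    differences X_f' - sum_f c_f'f X_f give the relations that determine the remaining
    coordinates by those in F_v. *)
Lemma ZsetP z : Zset P z <-> exists xi, forall f, mu z f = slack f xi.
Proof.
split=> [hz|[xi h] Y Y0]; last first.
  apply/eqP; rewrite -subr_eq0 -sumrB; apply/eqP.
  under eq_bigr do rewrite -mulrBr h /slack addrK -pairingZl.
  by rewrite -pairing_suml -/(piF P Y) Y0 pairing0l.
have [v hv] := ex_vertex hP.
exists (from_mu v (mu z)) => f'.
pose Y f := (f == f')%:R - (if f \in Fv v then (coef v f' f)%:~R else 0) : R.
have sumY (V : lmodType R) (g : F -> V) :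
    \sum_f Y f *: g f = g f' - \sum_(f in Fv v) (coef v f' f)%:~R *: g f.
  under eq_bigr do rewrite scalerBl.
  rewrite sumrB; congr (_ - _).
    rewrite (bigD1 f') //= eqxx scale1r big1 ?addr0 // => f /negbTE ->.
    by rewrite scale0r.
  rewrite [RHS]big_mkcond; apply: eq_bigr => f _; case: ifP => //; by rewrite scale0r.
have Y0 : piF P Y = 0 by rewrite /piF sumY {1}(normal_coef hT hP f' hv) subrr.
have := hz Y Y0; rewrite (sumY R^o) (sumY R^o) => E.
have := slack_normal_coef f' (from_mu v (mu z)) hv.
under eq_bigr => f fv do rewrite slack_from_mu // mulrBr.
rewrite sumrB => E'; apply: (addIr (- offset P f')); rewrite E'.
rewrite /GRing.scale /= in E.
move: E; set a := \sum_(_ in _) _; set b := \sum_(_ in _) _ => E; lra.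
Qed.

(** The moment map on Z before passing to the quotient. *)
Definition muZ (z : Cspace R F) : 'rV[R]_n := get [set xi | forall f, mu z f = slack f xi].

Lemma muZP z : Zset P z -> forall f, mu z f = slack f (muZ z).
Proof.
move=> /ZsetP [xi h].
exact: (@getPex _ [set xi | forall f, mu z f = slack f xi] (ex_intro _ xi h)).
Qed.

Lemma muZ_unique z xi : (forall f, mu z f = slack f xi) -> muZ z = xi.
Proof.
move=> h; have hz : Zset P z by apply/ZsetP; exists xi.
have [v hv] := ex_vertex hP.
by apply: (slack_inj hv) => f _; rewrite -muZP.
Qed.

Lemma muZ_Delta z : Zset P z -> Delta P (muZ z).
Proof. by move=> hz; rewrite (DeltaE hP) => f; rewrite -muZP // mu_ge0. Qed.

Section AtVertex.
Variable v : 'rV[R]_n.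
Hypothesis hv : vertices (Delta P) v.
Local Notation Cv := (Cspace R (facet_index P v)).

Lemma mu_vP (w : Cv) (f : facet_index P v) : mu w f = slack (val f) (mu_v P v w).
Proof.
pose m (f : F) := if insub f is Some f' then mu w f' else 0.
have ex : exists xi, forall f : facet_index P v,
    mu w f - offset P (val f) = pairing (X (val f)) xi.
  exists (from_mu v m) => g.
  have := slack_from_mu m hv (facet_indexP g); rewrite {2}/m valK /slack => <-.
  by rewrite addrK.
rewrite /slack -(@getPex _ [set xi | forall f : facet_index P v,
    mu w f - offset P (val f) = pairing (X (val f)) xi] ex f).
by rewrite subrK.
Qed.

Lemma mu_v_unique (w : Cv) xi : (forall f, mu w f = slack (val f) xi) -> mu_v P v w = xi.
Proof.
move=> h; apply: (slack_inj hv) => f fv.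
by have := h (facet_of fv); rewrite mu_vP val_facet_of.
Qed.

Lemma mu_vE (w : Cv) :
  mu_v P v w = \sum_(f : facet_index P v) (mu w f - offset P (val f)) *: edge v (val f).
Proof.
rewrite {1}(edge_decomp hT hP (mu_v P v w) hv) -big_facet_index.
by apply: eq_bigr => f _; rewrite mu_vP /slack addrK.
Qed.

Lemma mu_v_rho z : Zset P z -> mu_v P v (rho P v z) = muZ z.
Proof.
move=> hz; apply: mu_v_unique => f; rewrite -muZP //.
by rewrite /mu rePart_mkC imPart_mkC.
Qed.

Lemma mu_v_smooth : smooth setT (mu_v P v).
Proof.
have key : smooth setT (fun w : Cv => \sum_(f : facet_index P v)
    (mu w f + - offset P (val f)) *: edge v (val f)).
  apply: smooth_sum => [|f]; first exact: openT.
  apply: smooth_scale; first exact: openT.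
  apply: smooth_add; [exact: openT| |exact: smooth_cst].
  by apply: (@smooth_mu _ _ _ _ _ id); [exact: openT|exact: smooth_id].
by apply: smooth_ext key => [|w _]; [exact: openT|rewrite mu_vE].
Qed.

Lemma slack_mu_v_smooth f : smooth setT (fun w : Cv => slack f (mu_v P v w)).
Proof.
have l : linear (pairing (X f)) by move=> a x y; rewrite pairingDr pairingZr.
pose L : {linear 'rV[R]_n -> R} := mklinear l.
apply: smooth_add; [exact: openT| |exact: smooth_cst].
by apply: (@smooth_lin_comp _ _ _ _ _ _ L);
  [exact: openT|exact: pairing_continuous|exact: mu_v_smooth].
Qed.

(** |z_f|^2 is homogeneous of degree 2 and mu_v(0) = v, so scaling w moves mu_v(w) on the
    ray from v. *)
Lemma mu_v_scale (c : R) (w : Cv) : mu_v P v (c *: w) = c ^+ 2 *: mu_v P v w + (1 - c ^+ 2) *: v.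
Proof.
apply: mu_v_unique => f.
have -> : mu (c *: w) f = c ^+ 2 * mu w f by rewrite /mu /rePart /imPart !mxE; field.
rewrite mu_vP /slack pairingDr !pairingZr.
have : slack (val f) v = 0.
  apply/eqP; rewrite -(facets_atE hP); [exact: facet_indexP|exact: (vertex_Delta hv)].
by rewrite /slack => /eqP; rewrite addr_eq0 => /eqP ->; ring.
Qed.

Lemma slack_mu_v_scale (c : R) (w : Cv) f : slack f (mu_v P v (c *: w)) =
  c ^+ 2 * slack f (mu_v P v w) + (1 - c ^+ 2) * slack f v.
Proof. by rewrite mu_v_scale /slack pairingDr !pairingZr; ring. Qed.

Lemma slack_vertex f : f \notin Fv v -> 0 < slack f v.
Proof. by rewrite (slack_gt0 hP) //; exact: (vertex_Delta hv). Qed.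

Lemma zc_s_v_in (w : Cv) (f : facet_index P v) : zc (s_v P v w) (val f) = zc w f.
Proof. by rewrite /zc /s_v rePart_mkC imPart_mkC valK. Qed.

Lemma zc_s_v_out (w : Cv) f : f \notin Fv v ->
  zc (s_v P v w) f = Complex (r_f P f (mu_v P v w)) 0.
Proof. by move=> fv; rewrite /zc /s_v rePart_mkC imPart_mkC insubF // (negbTE fv). Qed.

Lemma mu_s_v (w : Cv) : (forall f, f \notin Fv v -> 0 <= slack f (mu_v P v w)) ->
  forall f, mu (s_v P v w) f = slack f (mu_v P v w).
Proof.
move=> h f; have [fv|fv] := boolP (f \in Fv v).
  by rewrite mu_zc (zc_s_v_in w (facet_of fv)) -mu_zc mu_vP val_facet_of.
rewrite mu_zc zc_s_v_out // normc_real /r_f ger0_norm ?sqrtr_ge0 //.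
by rewrite sqr_sqrtr ?mulr_ge0 ?h // mulrC mulKf.
Qed.

Lemma rho_s_v (w : Cv) : rho P v (s_v P v w) = w.
Proof.
apply: Cspace_ext => f; rewrite (rePart_mkC, imPart_mkC) /s_v (rePart_mkC, imPart_mkC) valK //.
Qed.

Lemma s_v_Zset (w : Cv) : (forall f, f \notin Fv v -> 0 <= slack f (mu_v P v w)) ->
  Zset P (s_v P v w).
Proof. by move=> h; apply/ZsetP; exists (mu_v P v w) => f; rewrite mu_s_v. Qed.

Lemma open_slack_pos : open [set w : Cv | forall f, f \notin Fv v -> 0 < slack f (mu_v P v w)].
Proof.
apply: (@open_forall_pos _ _ F (fun f => f \notin Fv v) (fun f w => slack f (mu_v P v w))).
by move=> f w; exact: (smooth_continuous (slack_mu_v_smooth f)).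
Qed.

(** On the image of Z every slack is nonnegative. If one with f outside F_v vanished at an
    interior point w, then w could be scaled by some c > 1 inside the image; as the
    slack is positive at v, it would be negative at mu_v(c w) ([slack_mu_v_scale]). *)
Lemma UsetE : Uset P v = [set w | forall f, f \notin Fv v -> 0 < slack f (mu_v P v w)].
Proof.
apply/seteqP; split=> w /=; last first.
  move=> h; have : nbhs w [set w : Cv | forall f, f \notin Fv v -> 0 < slack f (mu_v P v w)].
    by apply: open_nbhs_nbhs; split=> //; exact: open_slack_pos.
  apply: filterS => w' hw'; exists (s_v P v w'); last exact: rho_s_v.
  by apply: s_v_Zset => f /hw' /ltW.
move=> hw f fv.
have hw' w' : (rho P v @` Zset P) w' -> 0 <= slack f (mu_v P v w').
  by move=> [z hz <-]; rewrite mu_v_rho // (Delta_slack hP) //; exact: muZ_Delta.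
have := hw' _ (interior_subset hw); rewrite le_eqVlt => /orP[/eqP s0|//].
have cscal : {for (1 : R), continuous (fun c : R => c *: w)} by exact: scalel_continuous.
have : \forall c \near (1 : R), 0 <= slack f (mu_v P v (c *: w)).
  have cs' : nbhs (1 : R) [set c : R | (rho P v @` Zset P) (c *: w)].
    by apply: (cscal (rho P v @` Zset P)); rewrite scale1r.
  by apply: filterS cs' => c; exact: hw'.
move=> /nbhs_normP [e /= e0 he].
have : 0 <= slack f (mu_v P v ((1 + e / 2) *: w)).
  by apply: he; rewrite /= opprD addrA subrr add0r normrN ger0_norm ?divr_ge0 ?ltW //; lra.
rewrite slack_mu_v_scale -s0 mulr0 add0r pmulr_lge0; last exact: slack_vertex.
rewrite subr_ge0 sqrrD expr1n mul1r; have : 0 < e / 2 by lra.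
by move: (sqr_ge0 (e / 2)) => ? ?; lra.
Qed.

Lemma ZvE (z : Ztype P) : Zv P v z <-> forall f, f \notin Fv v -> zc (val z) f != 0.
Proof.
have hz : Zset P (val z) by exact: (set_mem (valP z)).
rewrite /Zv /= UsetE /= mu_v_rho //.
by split=> h f /h; rewrite -mu_gt0 muZP.
Qed.

(** The chart at v read on Z: an explicit inverse of s_v modulo N. The powers of the phases
    outside F_v are chosen so that the result is invariant under N ([phihat_N]), and they
    are 1 on the image of s_v. *)
Definition phihat (z : Cspace R F) : Cv :=
  ofC (fun f : facet_index P v => zc z (val f) *
    \prod_(f' | f' \notin Fv v) phase (zc z f') ^ coef v f' (val f)).

Lemma zc_phihat z f : zc (phihat z) f = zc z (val f) *
  \prod_(f' | f' \notin Fv v) phase (zc z f') ^ coef v f' (val f).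
Proof. exact: zc_ofC. Qed.

(** The coordinates of pi(t) in the basis at v. *)
Definition tcoord t : facet_index P v -> R := fun f => pairing (piF P t) (edge v (val f)).

Lemma tcoordE t f : tcoord t f =
  t (val f) + \sum_(f' | f' \notin Fv v) (coef v f' (val f))%:~R * t f'.
Proof.
have [h1 _] := edge_dual hT hP hv.
rewrite /tcoord /piF pairing_suml (bigID (fun g => g \in Fv v)) /=; congr (_ + _).
  rewrite (bigD1 (val f)) /=; last exact: facet_indexP.
  rewrite pairingZl h1 ?eqxx ?mulr1 ?big1 ?addr0 //; try exact: facet_indexP.
  move=> g /andP[gv gf]; rewrite pairingZl h1 ?(negbTE gf) ?mulr0 //.
  exact: facet_indexP.
apply: eq_bigr => g _; rewrite pairingZl mulrC (coefE hT hP) //; exact: facet_indexP.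
Qed.

Lemma phihat_rotate t z : phihat (rotate t z) = rotate (tcoord t) (phihat z).
Proof.
apply: zc_inj => f.
apply: (etrans (zc_phihat (rotate t z) f)).
apply: esym; apply: (etrans (zc_rotate (tcoord t) (phihat z) f)); apply: esym.
rewrite [in RHS](zc_phihat z f).
rewrite (zc_rotate t z (val f)).
rewrite tcoordE cisD cis_sum.
rewrite -!mulrA; congr (_ * _); rewrite mulrCA; congr (_ * _).
rewrite -big_split; apply: eq_bigr => f' _.
by rewrite (zc_rotate t z f') phase_cis expfzMl cis_intmul.
Qed.

(** An element of N can thus be prescribed freely outside F_v; the condition then fixes its
    components in F_v modulo the integers. *)
Lemma in_N_tcoord t : in_N P texp t <-> forall f, tcoord t f \is a Num.int.
Proof.
split=> [Nt f|h]; first exact: (lattice_coord_int hT hP hv (facet_indexP f) Nt).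
by apply: (lattice_of_coord hT hP hv) => f fv; exact: (h (facet_of fv)).
Qed.

Lemma rotate_int (J : finType) (s : J -> R) (w : Cspace R J) :
  (forall f, s f \is a Num.int) -> rotate s w = w.
Proof. by move=> h; apply: zc_inj => f; rewrite zc_rotate cis_int // mul1r. Qed.

Lemma phihat_N t z : in_N P texp t -> phihat (rotate t z) = phihat z.
Proof. by move=> /in_N_tcoord h; rewrite phihat_rotate rotate_int. Qed.

Lemma phihat_s_v (w : Cv) : Uset P v w -> phihat (s_v P v w) = w.
Proof.
rewrite UsetE => h; apply: zc_inj => f; rewrite zc_phihat zc_s_v_in big1 ?mulr1 // => f' f'v.
rewrite zc_s_v_out // phase_pos ?exp1rz // /r_f sqrtr_gt0 mulr_gt0 //.
exact: h.
Qed.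

Lemma mu_phihat z f : (forall f, f \notin Fv v -> zc z f != 0) -> mu (phihat z) f = mu z (val f).
Proof.
move=> h; rewrite !mu_zc zc_phihat normcM normc_prod big1 ?mulr1 // => f' /h z0.
by rewrite normc_expz // normc_phase.
Qed.

Lemma mu_v_phihat (z : Ztype P) : Zv P v z -> mu_v P v (phihat (val z)) = muZ (val z).
Proof.
move=> /ZvE h; apply: mu_v_unique => f; rewrite mu_phihat // muZP //.
exact: (set_mem (valP z)).
Qed.

Lemma phihat_Uset (z : Ztype P) : Zv P v z -> Uset P v (phihat (val z)).
Proof.
move=> zv; rewrite UsetE /= mu_v_phihat // => f fv.
rewrite -muZP ?mu_gt0; last exact: (set_mem (valP z)).
by move: zv => /ZvE; apply.
Qed.

(** An element of N rotates all coordinates outside F_v to the positive half-line; what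
    remains is a point of the image of s_v, because the moduli are those of z. *)
Lemma N_normal_form (z : Ztype P) : Zv P v z ->
  exists2 t, in_N P texp t & rotate t (val z) = s_v P v (phihat (val z)).
Proof.
move=> zv; have h := (ZvE z).1 zv.
have hz : Zset P (val z) by exact: (set_mem (valP z)).
have ex f : exists s, f \notin Fv v -> cis s = (phase (zc (val z) f))^-1.
  have [fv|fv] := boolP (f \in Fv v); first by exists 0.
  have [|s sE] := @unit_cis R (phase (zc (val z) f))^-1.
    by rewrite normcV normc_phase ?invr1 ?h.
  by exists s.
have [s sE] := boolp.choice ex.
(* outside F_v the angles of z are cancelled; in F_v the value is forced by membership in N *)
pose t f := if f \in Fv v then - \sum_(f' | f' \notin Fv v) (coef v f' f)%:~R * s f' else s f.
have tN : in_N P texp t.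
  apply/in_N_tcoord => f; rewrite tcoordE {1}/t facet_indexP.
  rewrite [X in _ + X](eq_bigr (fun f' => (coef v f' (val f))%:~R * s f')) ?addNr //.
  by move=> f' f'v; rewrite /t (negbTE f'v).
exists t => //; apply: zc_inj => f; rewrite zc_rotate.
have [fv|fv] := boolP (f \in Fv v); last first.
  rewrite zc_s_v_out // /t (negbTE fv) sE // mulrC {1}(phaseE (h f fv)).
  have ph0 : phase (zc (val z) f) != 0.
    by rewrite -normc_eq0 normc_phase ?oner_eq0 // h.
  rewrite mulrAC divff // mul1r; congr (Complex _ _).
  rewrite /r_f mu_v_phihat // -/(slack _ _) -muZP // mu_zc mulrCA divff // mulr1.
  by rewrite sqrtr_sqr ger0_norm // normc_ge0.
rewrite (zc_s_v_in _ (facet_of fv)) zc_phihat val_facet_of mulrC; congr (_ * _).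
rewrite /t fv -sumrN cis_sum; apply: eq_bigr => f' f'v.
by rewrite -mulrN cis_intmul cisN (sE _ f'v) invrK.
Qed.

End AtVertex.
End LevelSet.

(** * General topology of subsets *)
Lemma compact_set_type {X : topologicalType} (A : set X) : compact A -> compact [set: A].
Proof.
move=> cA G FG _; pose G' := (val : A -> X) @ G.
have FG' : ProperFilter G' by exact: fmap_proper_filter.
have G'A : G' A.
  rewrite /G' /= /fmap /= (_ : _ @^-1` _ = setT); first exact: filterT.
  by apply/seteqP; split=> // x _ /=; exact: (set_mem (valP x)).
have [x [Ax clx]] := cA G' FG' G'A.
exists (exist _ x (mem_set Ax) : A); split=> // B C GB [C' [[D oD <-] /= Dx DC]].
have sub : B `<=` (val : A -> X) @^-1` (val @` B) by move=> y By; exists y.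
have G'B : G' (val @` B) by exact: (filterS sub GB).
have [_ [[y By <-] Dy]] := clx _ _ G'B (open_nbhs_nbhs (conj oD Dx)).
by exists y; split=> //; exact: DC.
Qed.

Lemma continuous_to_set_type {X Y : topologicalType} (A : set Y) (f : X -> A) x :
  {for x, continuous (fun y => val (f y))} -> {for x, continuous f}.
Proof.
move=> cf B [B' [[D oD <-] /= Dx DB]].
have : nbhs x [set y | D (val (f y))] by apply: (cf D); exact: open_nbhs_nbhs.
by apply: filterS => y; exact: DB.
Qed.

(** Compact metric spaces are second countable; the given point provides the base point
    required by the general result. *)
Lemma compact_second_countable_inhabited {R : realType} (X : pseudoMetricType R) (x0 : X) :
  compact [set: X] -> @second_countable X.
Proof.
move=> cX; pose pX : pseudoPMetricType R := HB.pack X (isPointed.Build X x0).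
exact: (@compact_second_countable R pX).
Qed.

(** The segments from the origin to the points of the set cover it and share the origin. *)
Lemma star_connected {R : realType} (V : normedModType R) (A : set V) :
  A 0 -> (forall w (c : R), A w -> 0 <= c <= 1 -> A (c *: w)) -> connected A.
Proof.
move=> A0 star.
pose seg (w : V) : set V := [set c *: w | c in `[(0 : R), 1]].
have -> : A = \bigcup_(w in A) seg w.
  apply/seteqP; split=> w.
    move=> Aw; exists w => //; exists 1; last by rewrite scale1r.
    by rewrite /= in_itv /= ler01 lexx.
  by move=> [w' Aw' [c /=]]; rewrite in_itv /= => c01 <-; exact: star.
apply: bigcup_connected.
  by exists 0 => w Aw; exists 0; rewrite ?scale0r //= in_itv /= lexx ler01.
move=> w _; apply: connected_continuous_connected; first exact: segment_connected.
by apply: continuous_subspaceT => c; exact: scalel_continuous.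
Qed.

(** * The reduced space *)
Section ReducedSpace.
Context {R : realType} {n : nat} {F : finType} {T : topologicalZmodType}.
Variables (AT : atlas R T) (texp : {additive 'rV[R]_n -> T}).
Variables (P : polytope_data R n F).
Hypothesis hT : torus_with_exp AT texp.
Hypothesis hP : delzant P texp.
Implicit Types (Y xi v : 'rV[R]_n) (t : F -> R) (z : Ztype P).

Local Notation X := (normal P).
Local Notation slack := (slack P).
Local Notation Fv := (facets_at P).
Local Notation Z := (Ztype P).
Local Notation M := (Mspace P texp).
Local Notation p := (projM P texp).
Local Notation phihat := (phihat P).

Lemma projM_eqP z z' : p z = p z' <-> exists2 t, in_N P texp t & z' = rotateZ t z.
Proof.
split.
  by move=> /(eqmodP (N_orbit_equivRel P texp)) /asboolP.
by move=> h; apply/(eqmodP (N_orbit_equivRel P texp))/asboolP.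
Qed.

Lemma projM_surj (m : M) : exists z, p z = m.
Proof. by exists (repr m); exact: reprK. Qed.

Lemma projM_repr (m : M) : p (repr m) = m.
Proof. exact: reprK. Qed.

Lemma projM_continuous : continuous p.
Proof. exact: (@pi_continuous Z {eq_quot (N_orbit_equivRel P texp)}%qT). Qed.

Lemma ZsetZ z : Zset P (val z).
Proof. exact: (set_mem (valP z)). Qed.

Lemma val_Z_continuous : continuous (val : Z -> Cspace R F).
Proof. exact: initial_continuous. Qed.

(** Joint smoothness in the angles and the point; the torus action is smooth for this reason. *)
Lemma smooth_rotate (V : normedModType R) (D : set V) (I : finType) (f : V -> I -> R)
    (g : V -> Cspace R I) : open D -> (forall i, smooth D (f^~ i)) -> smooth D g ->
  smooth D (fun x => rotate (f x) (g x)).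
Proof.
move=> oD sf sg.
have key : smooth D (fun x => ofC (fun i => cis (f x i) * zc (g x) i)).
  apply: (smooth_ofC oD (h := fun i x => cis (f x i) * zc (g x) i)) => i.
  by apply: csmooth_mul => //; [exact: csmooth_cis | exact: csmooth_zc].
by apply: smooth_ext key => // x _; apply: zc_inj => i; rewrite zc_ofC zc_rotate.
Qed.

Lemma rotate_smooth (I : finType) (t : I -> R) : smooth setT (rotate t : Cspace R I -> Cspace R I).
Proof.
apply: (smooth_rotate (f := fun _ => t)); first exact: openT.
  by move=> i; exact: smooth_cst.
exact: smooth_id.
Qed.

Lemma rotateZ_continuous t : continuous (rotateZ t : Z -> Z).
Proof.
move=> z; apply: continuous_to_set_type => /=.
apply: (@continuous_comp _ _ _ (val : Z -> Cspace R F) (rotate t)); first exact: val_Z_continuous.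
exact: (smooth_continuous (rotate_smooth t)).
Qed.

(** The saturation of an open set is a union of its rotations. *)
Lemma projM_open (A : set Z) : open A -> open (p @` A).
Proof.
move=> oA; rewrite /open /= /quotient_open openE => z [a Aa /esym/projM_eqP [t tN aE]].
rewrite /interior.
have : nbhs z (rotateZ t @^-1` A).
  by apply: (@rotateZ_continuous t z A); apply: open_nbhs_nbhs; rewrite -aE.
apply: filterS => z' Az'; exists (rotateZ t z') => //.
by apply/esym/projM_eqP; exists t.
Qed.

Lemma muZ_rotate t z : muZ P (rotate t (val z)) = muZ P (val z).
Proof.
apply: (muZ_unique hT hP) => f; rewrite mu_rotate (muZP hT hP) //; exact: ZsetZ.
Qed.

(** The moment map of M, read on representatives; [muT_projM] shows independence of the choice. *)
Definition muT (m : M) : 'rV[R]_n := muZ P (val (repr m)).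

Lemma muT_projM z : muT (p z) = muZ P (val z).
Proof.
have /projM_eqP [t tN E] : p z = p (repr (p z)) by rewrite projM_repr.
by rewrite /muT E /= muZ_rotate.
Qed.

Lemma mu_muT z f : mu (val z) f = slack f (muT (p z)).
Proof. by rewrite muT_projM (muZP hT hP) //; exact: ZsetZ. Qed.

Lemma muZ_from_mu v (z : Cspace R F) : vertices (Delta P) v -> Zset P z ->
  muZ P z = from_mu P v (mu z).
Proof.
move=> hv hz; apply: (slack_inj hP hv) => f fv.
by rewrite (slack_from_mu hT hP) // (muZP hT hP).
Qed.

Lemma from_mu_smooth v : smooth setT (fun z : Cspace R F => from_mu P v (mu z)).
Proof.
have key : smooth setT (fun z : Cspace R F =>
    \sum_f (if f \in Fv v then mu z f + - offset P f else 0) *: edge P v f).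
  apply: smooth_sum => [|f]; first exact: openT.
  apply: smooth_scale; first exact: openT.
  case: (f \in Fv v); last exact: smooth_cst.
  apply: smooth_add; [exact: openT| |exact: smooth_cst].
  by apply: (@smooth_mu _ _ _ _ _ id); [exact: openT|exact: smooth_id].
apply: smooth_ext key => [|z _]; first exact: openT.
rewrite /from_mu [RHS]big_mkcond; apply: eq_bigr => f _.
by case: ifP => // _; rewrite scale0r.
Qed.

Lemma muT_continuous : continuous muT.
Proof.
apply/(@quotient_continuous Z {eq_quot (N_orbit_equivRel P texp)}%qT) => z.
have [v hv] := ex_vertex hP.
have -> : muT \o \pi_(quotient_topology {eq_quot (N_orbit_equivRel P texp)})%qT =
    (fun z : Z => from_mu P v (mu (val z))).
  by apply/funext => z' /=; rewrite -(muZ_from_mu hv (ZsetZ z')) -muT_projM.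
have cz : {for z, continuous ((fun z : Cspace R F => from_mu P v (mu z)) \o
    (val : Z -> Cspace R F))}.
  apply: continuous_comp.
    exact: val_Z_continuous.
  exact: (smooth_continuous (from_mu_smooth v)).
exact: cz.
Qed.

Section Chart.
Variable v : 'rV[R]_n.
Hypothesis hv : vertices (Delta P) v.
Local Notation Cv := (Cspace R (facet_index P v)).

(** The open subset of C^F on which [phihat v] is smooth; it cuts out Z_v in Z. *)
Definition Dv : set (Cspace R F) := [set z | forall f, f \notin Fv v -> zc z f != 0].

Lemma open_Dv : open Dv.
Proof.
have -> : Dv = [set z : Cspace R F | forall f, f \notin Fv v -> 0 < mu z f].
  by apply/seteqP; split=> z h f /h; rewrite mu_gt0.
have cmu f : continuous (fun z : Cspace R F => mu z f).
  by move=> z; exact: (smooth_continuous (smooth_mu openT f (@smooth_id R (Cspace R F)))).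
exact: (open_forall_pos _ cmu).
Qed.

Lemma phihat_smooth : smooth Dv (phihat v).
Proof.
have oD := open_Dv; have sid : smooth Dv (fun z : Cspace R F => z).
  by apply: smooth_sub (@smooth_id R _).
apply: smooth_ofC => // f; apply: csmooth_mul => //; first exact: csmooth_zc.
apply: csmooth_prod => // f' f'v; apply: csmooth_expz => //.
  by move=> z /(_ f' f'v) h; rewrite -normc_eq0 normc_phase ?oner_eq0.
apply: csmooth_phase => //; last exact: csmooth_zc.
by move=> z; apply.
Qed.

Lemma ZvDv z : Zv P v z <-> Dv (val z).
Proof. exact: (ZvE hT hP hv). Qed.

Lemma open_Zv : open (Zv P v).
Proof.
rewrite (_ : Zv P v = (val : Z -> Cspace R F) @^-1` Dv); last by apply/seteqP; split=> z /ZvDv.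
by apply: open_comp open_Dv => z _; exact: val_Z_continuous.
Qed.

Lemma Zv_rotateZ t z : Zv P v (rotateZ t z) <-> Zv P v z.
Proof.
rewrite !ZvDv /Dv /=; split=> h f /h; rewrite zc_rotate mulf_eq0 negb_or; first by move=> /andP[].
by move=> ->; rewrite cis_neq0.
Qed.

Lemma MvP z : Mv P texp v (p z) <-> Zv P v z.
Proof.
split=> [[z' zv' /projM_eqP [t tN ->]]|zv]; first by apply/Zv_rotateZ.
by exists z.
Qed.

Lemma open_Mv : open (Mv P texp v).
Proof. by apply: projM_open; exact: open_Zv. Qed.

(** z_f vanishes iff the slack of f does at the moment image, that is iff the image lies on
    the facet f. *)
Lemma MvE : Mv P texp v = muT @^-1` Delta_v P v.
Proof.
apply/seteqP; split=> m; have [z <-] := projM_surj m.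
  move=> /MvP/ZvDv zv; rewrite /= muT_projM; split; first exact: (muZ_Delta hT hP (ZsetZ z)).
  move=> [f /= fv]; rewrite (facetE hP) => -[_ /= ]; rewrite -(muZP hT hP (ZsetZ z)).
  by move=> mu0; have := zv f fv; rewrite -mu_gt0 mu0 ltxx.
rewrite /= muT_projM => -[Dz h]; apply/MvP/ZvDv => f fv; rewrite -mu_gt0 lt_def mu_ge0 andbT.
apply/eqP => mu0; apply: h; exists f => //; rewrite (facetE hP); split=> //=.
by rewrite -(muZP hT hP (ZsetZ z)).
Qed.

(** The relation to the explicit chart: N-invariance of [phihat] gives one direction,
    [N_normal_form] the other. *)
Lemma psi_vP (w : Cv) z : psi_v P texp v w (p z) <-> Zv P v z /\ w = phihat v (val z).
Proof.
split=> [[Uw [zeta zetaE /projM_eqP [t tN zE]]]|[zv ->]].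
  have zz : Zv P v zeta.
    apply/(ZvE hT hP hv) => f fv; rewrite zetaE zc_s_v_out // real_complex_eq0 gt_eqF //.
    by rewrite sqrtr_gt0 mulr_gt0 //; move: Uw; rewrite (UsetE hT hP hv); apply.
  rewrite zE; split; first by apply/Zv_rotateZ.
  by rewrite /= (phihat_N hT hP hv) // zetaE (phihat_s_v hT hP hv).
split; first exact: (phihat_Uset hT hP hv).
have [t tN tE] := N_normal_form hT hP hv zv.
by exists (rotateZ t z) => //; apply/esym/projM_eqP; exists t.
Qed.

Lemma phi_v_projM z : Zv P v z -> phi_v P texp v (p z) = phihat v (val z).
Proof.
move=> zv.
have : psi_v P texp v (phi_v P texp v (p z)) (p z).
  apply: (@getPex _ [set w | psi_v P texp v w (p z)]); exists (phihat v (val z)).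
  exact/psi_vP.
by move=> /psi_vP [].
Qed.

Lemma psi_v_phi_v m : Mv P texp v m -> psi_v P texp v (phi_v P texp v m) m.
Proof.
have [z <-] := projM_surj m; move=> /MvP zv; apply/psi_vP; split => //.
exact: phi_v_projM.
Qed.

Lemma phi_v_psi_v w m : psi_v P texp v w m -> Mv P texp v m /\ phi_v P texp v m = w.
Proof.
by have [z <-] := projM_surj m; move=> /psi_vP [zv ->]; split; [apply/MvP|exact: phi_v_projM].
Qed.

Lemma phi_v_inj : set_inj (Mv P texp v) (phi_v P texp v).
Proof.
move=> m m'; rewrite !inE => hm hm' E.
have [_ [z zE <-]] := psi_v_phi_v hm; have [_ [z' z'E <-]] := psi_v_phi_v hm'.
by congr (p _); apply: val_inj; rewrite zE z'E E.
Qed.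

Lemma phi_v_Uset m : Mv P texp v m -> Uset P v (phi_v P texp v m).
Proof. by move=> /psi_v_phi_v []. Qed.

(** The map s_v with values in Z, completed by a default value outside U_v, where s_v may
    leave Z. *)
Definition lift_v (z0 : Z) (w : Cv) : Z := insubd z0 (s_v P v w).
Definition point_v (z0 : Z) (w : Cv) : M := p (lift_v z0 w).

Lemma val_lift_v z0 w : Uset P v w -> val (lift_v z0 w) = s_v P v w.
Proof.
move=> Uw; rewrite /lift_v insubdK //; apply: mem_set; apply: (s_v_Zset hT hP hv) => f fv.
by move: Uw; rewrite (UsetE hT hP hv) => /(_ f fv) /ltW.
Qed.

Lemma psi_v_point_v z0 w : Uset P v w -> psi_v P texp v w (point_v z0 w).
Proof. by move=> Uw; split=> //; exists (lift_v z0 w) => //; exact: val_lift_v. Qed.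

Lemma Zv_lift_v z0 w : Uset P v w -> Zv P v (lift_v z0 w).
Proof. by move=> /psi_v_point_v -/(_ z0) /psi_vP []. Qed.

Lemma phi_v_point_v z0 w : Uset P v w -> phi_v P texp v (point_v z0 w) = w.
Proof. by move=> /psi_v_point_v -/(_ z0) /phi_v_psi_v []. Qed.

Lemma Mv_point_v z0 w : Uset P v w -> Mv P texp v (point_v z0 w).
Proof. by move=> /psi_v_point_v -/(_ z0) /phi_v_psi_v []. Qed.

Lemma point_v_phi_v z0 m : Mv P texp v m -> point_v z0 (phi_v P texp v m) = m.
Proof.
move=> hm; apply: phi_v_inj; rewrite ?inE //; first exact/Mv_point_v/phi_v_Uset.
exact/phi_v_point_v/phi_v_Uset.
Qed.

Lemma open_Uset : open (Uset P v).
Proof. exact: open_interior. Qed.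

Lemma s_v_smooth : smooth (Uset P v) (s_v P v).
Proof.
have oU := open_Uset.
have key : smooth (Uset P v) (fun w : Cv => ofC (fun f =>
    if insub f is Some f' then zc w f' else Complex (r_f P f (mu_v P v w)) 0)).
  apply: (smooth_ofC oU (h := fun f w =>
    if insub f is Some f' then zc w f' else Complex (r_f P f (mu_v P v w)) 0)) => f.
  have sid : smooth (Uset P v) (fun w : Cv => w) by apply: smooth_sub (@smooth_id R _).
  case: insubP => [f' _ _|fv]; first exact: csmooth_zc.
  apply: csmooth_real => //; apply: smooth_sqrt_comp => //.
    by move=> w; rewrite (UsetE hT hP hv) => /(_ f fv) s0; rewrite mulr_gt0.
  apply: smooth_mul => //; first exact: smooth_cst.
  by apply: smooth_sub (slack_mu_v_smooth hT hP hv f).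
apply: smooth_ext key => // w _; apply: zc_inj => f; rewrite zc_ofC.
have [fv|fv] := boolP (f \in Fv v); last by rewrite insubF ?zc_s_v_out // (negbTE fv).
by rewrite -[f](val_facet_of fv) valK zc_s_v_in.
Qed.

Lemma lift_v_continuous z0 w : Uset P v w -> {for w, continuous (lift_v z0)}.
Proof.
move=> Uw; apply: continuous_to_set_type.
have cs := smooth_continuous s_v_smooth Uw.
rewrite /prop_for /continuous_at val_lift_v //; apply: cvg_trans cs.
apply: near_eq_cvg; have := open_nbhs_nbhs (conj open_Uset Uw).
by apply: filterS => w' Uw'; rewrite val_lift_v.
Qed.

Lemma point_v_continuous z0 w : Uset P v w -> {for w, continuous (point_v z0)}.
Proof.
move=> Uw; apply: (@continuous_comp _ _ _ (lift_v z0) p); first exact: lift_v_continuous.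
exact: projM_continuous.
Qed.

Lemma phi_v_continuous m : Mv P texp v m -> {for m, continuous (phi_v P texp v)}.
Proof.
have [z <-] := projM_surj m; move=> /MvP zv A.
rewrite phi_v_projM // => hA.
have cz : {for z, continuous (fun z : Z => phihat v (val z))}.
  apply: (@continuous_comp _ _ _ (val : Z -> Cspace R F) (phihat v)).
    exact: val_Z_continuous.
  by apply: (smooth_continuous phihat_smooth); apply/ZvDv.
have n1 : nbhs z [set z | Zv P v z /\ A (phihat v (val z))].
  by apply: filterI; [apply: open_nbhs_nbhs; split=> //; exact: open_Zv|exact: cz].
move: n1; rewrite nbhsE => -[B [oB Bz] BA].
apply: (@filterS _ _ _ (p @` B)); last first.
  by apply: open_nbhs_nbhs; split; [exact: projM_open|exists z].
by move=> _ [z' Bz' <-] /=; have [zv' ?] := BA _ Bz'; rewrite phi_v_projM.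
Qed.

(** The inverse of the chart, [point_v], is continuous. *)
Lemma phi_v_open (A : set M) : open A -> A `<=` Mv P texp v -> open (phi_v P texp v @` A).
Proof.
move=> oA AM; rewrite openE => _ [m Am <-]; rewrite /interior.
have hm := AM _ Am; have Uw := phi_v_Uset hm.
have cs := point_v_continuous (z0 := repr m) Uw.
have n1 : nbhs (phi_v P texp v m) (Uset P v `&` point_v (repr m) @^-1` A).
  apply: filterI; first by apply: open_nbhs_nbhs; split=> //; exact: open_Uset.
  by apply: cs; rewrite point_v_phi_v //; exact: open_nbhs_nbhs.
apply: filterS n1 => w [Uw' Aw]; exists (point_v (repr m) w) => //.
exact: phi_v_point_v.
Qed.

End Chart.

(** The vanishing coordinates of z are the facets through its moment image; a vertex lying on
    all of these facets exists by [vertex_of_face]. *)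
Lemma Zv_cover z : exists2 v, vertices (Delta P) v & Zv P v z.
Proof.
have [v hv sub] := vertex_of_face hP (muZ_Delta hT hP (ZsetZ z)).
exists v => //; apply/(ZvDv hv) => f fv; rewrite -mu_gt0 (muZP hT hP (ZsetZ z)).
rewrite -(slack_gt0 hP _ (muZ_Delta hT hP (ZsetZ z))).
by apply: contra fv => /(fintype.subsetP sub).
Qed.

Lemma Mv_cover m : exists2 v, vertices (Delta P) v & Mv P texp v m.
Proof.
have [z <-] := projM_surj m; have [v hv zv] := Zv_cover z.
by exists v => //; apply/(MvP hv).
Qed.

(** A point over the interior of Delta. It lies in every Z_v and its stabilizer is trivial,
    which is used for connectedness and for effectiveness. *)
Lemma generic_point : exists z, forall f, zc (val z) f != 0.
Proof.
have [x0 Dx0 s0] := interior_slack hP.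
pose w : Cspace R F := ofC (fun f => Complex (Num.sqrt (2 * slack f x0)) 0).
have hw : Zset P w.
  apply/(ZsetP hT hP); exists x0 => f; rewrite mu_zc zc_ofC normc_real.
  rewrite ger0_norm ?sqrtr_ge0 // sqr_sqrtr ?mulr_ge0 ?(ltW (s0 f)) //.
  by rewrite mulrC mulKf.
exists (exist _ w (mem_set hw)) => f /=.
by rewrite zc_ofC real_complex_eq0 gt_eqF // sqrtr_gt0 mulr_gt0.
Qed.

(** |z_f|^2 / 2 is the slack of a point of Delta, and Delta is bounded. *)
Lemma Zset_compact : compact (Zset P).
Proof.
have [[[[K [Kr bK]] _] _] _ _ _ _] := hP.
have [B B0 hB] : exists2 B, 0 <= B & forall f xi, Delta P xi -> slack f xi <= B.
  have bound f : exists B, forall xi, Delta P xi -> slack f xi <= B.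
    have l : linear (pairing (X f)) by move=> a x y; rewrite pairingDr pairingZr.
    pose L : {linear 'rV[R]_n -> R} := mklinear l.
    have [k k0 hk] := linear_lipschitz (f := L) (@pairing_continuous R n (X f)).
    exists (k * (K + 1) + offset P f) => xi Dxi; rewrite /slack lerD2r.
    apply: le_trans (ler_norm _) _; apply: le_trans (hk xi) _.
    by apply: ler_wpM2l; [exact: ltW|apply: bK => //; rewrite ltrDl].
  have [b hb] := boolp.choice bound.
  exists (\sum_f `|b f|); first exact: sumr_ge0.
  move=> f xi Dxi; apply: le_trans (hb f xi Dxi) _; apply: le_trans (ler_norm _) _.
  by rewrite (bigD1 f) //= lerDl sumr_ge0.
pose L := Num.sqrt (2 * B).
have sqL (x : R) : x ^+ 2 <= 2 * B -> `|x| <= L.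
  by move=> h; rewrite -sqrtr_sqr ler_wsqrtr.
pose S : set 'rV[R]_#|F| := [set x | `|x| <= L].
have cS : compact S.
  apply: bounded_closed_compact.
    exists L; split; first exact: num_real.
    by move=> t tL x; rewrite /S /= => /le_trans; apply; exact: ltW.
  by apply: (preimage_closed _ (@closed_le R L)) => y _; exact: norm_continuous.
apply: (subclosed_compact _ (compact_setX cS cS)).
  rewrite (_ : Zset P = \bigcap_(Y in [set Y : F -> R | piF P Y = 0])
      [set z : Cspace R F | \sum_f Y f * mu z f = \sum_f Y f * offset P f]); last first.
    by apply/seteqP; split=> z h Y; exact: h.
  apply: closed_bigI => Y _.
  apply: (preimage_closed (f := fun z : Cspace R F => \sum_f Y f * mu z f) _
    (@closed_eq R _)) => z _.
  have key : smooth setT (fun z : Cspace R F => \sum_f Y f * mu z f).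
    apply: smooth_sum => [|f]; first exact: openT.
    apply: smooth_mul; [exact: openT|exact: smooth_cst|].
    by apply: (@smooth_mu _ _ _ _ _ id); [exact: openT|exact: smooth_id].
  exact: (smooth_continuous key).
move=> z hz.
have muB f : mu z f <= B.
  by rewrite (muZP hT hP hz); apply: hB; exact: (muZ_Delta hT hP).
have reB f : `|rePart z f| <= L.
  apply: sqL; have := muB f; rewrite /mu ler_pdivrMr // mulrC; apply: le_trans.
  by rewrite lerDl sqr_ge0.
have imB f : `|imPart z f| <= L.
  apply: sqL; have := muB f; rewrite /mu ler_pdivrMr // mulrC; apply: le_trans.
  by rewrite lerDr sqr_ge0.
have L0 : 0 <= L by exact: sqrtr_ge0.
split; rewrite /S /= /Num.norm /= mx_normrE; apply/bigmax_leP; split=> // -[i j] _ /=.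
  by rewrite ord1 -(enum_valK j); exact: reB.
by rewrite ord1 -(enum_valK j); exact: imB.
Qed.

Lemma Z_compact : compact [set: Z].
Proof. exact: compact_set_type Zset_compact. Qed.

Lemma M_compact : compact [set: M].
Proof.
have -> : [set: M] = p @` [set: Z].
  by apply/seteqP; split=> // m _; have [z <-] := projM_surj m; exists z.
apply: continuous_compact Z_compact; apply: continuous_subspaceT; exact: projM_continuous.
Qed.

(** The U_v are star-shaped around 0, since mu_v moves towards v under scaling, and the M_v
    all contain the class of a generic point. *)
Lemma M_connected : connected [set: M].
Proof.
have [z0 z0P] := generic_point.
have -> : [set: M] = \bigcup_(v in vertices (Delta P)) Mv P texp v.
  by apply/seteqP; split=> // m _; have [v hv mv] := Mv_cover m; exists v.
apply: bigcup_connected.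
  by exists (p z0) => v hv; apply/(MvP hv)/(ZvDv hv) => f _; exact: z0P.
move=> v hv.
have -> : Mv P texp v = @point_v v z0 @` Uset P v.
  apply/seteqP; split=> [m hm|_ [w Uw <-]]; last exact: (Mv_point_v hv).
  by exists (phi_v P texp v m); [exact: (phi_v_Uset hv)|exact: (point_v_phi_v hv)].
apply: connected_continuous_connected.
  rewrite (UsetE hT hP hv); apply: star_connected => /=.
    move=> f fv; have := slack_mu_v_scale hT hP hv 0 0 f.
    by rewrite scale0r expr0n /= mul0r subr0 mul1r add0r => ->; exact: (slack_vertex hP hv).
  move=> w c h /andP[c0 c1] f fv; rewrite (slack_mu_v_scale hT hP hv).
  have h1 := h f fv; have h2 := slack_vertex hP hv fv.
  have [c11|c11] := eqVneq c 1; first by rewrite c11 expr1n subrr mul0r addr0 mul1r.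
  apply: ltr_wpDl; first by rewrite mulr_ge0 ?sqr_ge0 // ltW.
  by rewrite mulr_gt0 // subr_gt0 expr_lt1 // lt_neqAle c11.
rewrite continuous_open_subspace; last exact: open_Uset.
by move=> w; rewrite inE; exact: (point_v_continuous hv).
Qed.

(** Points with different images under muT are separated by muT; the others lie in a common
    chart domain, as chart domains are preimages under muT. *)
Lemma M_hausdorff : hausdorff_space M.
Proof.
move=> m m' cl.
have muE : muT m = muT m'.
  apply: (@norm_hausdorff _ 'rV[R]_n) => A B hA hB.
  have := cl _ _ (muT_continuous hA) (muT_continuous hB).
  by move=> [q [qA qB]]; exists (muT q).
have [v hv mv] := Mv_cover m.
have mv' : Mv P texp v m' by move: mv; rewrite (MvE hv) /= muE.
have nM q : Mv P texp v q -> nbhs q (Mv P texp v).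
  by move=> hq; apply: open_nbhs_nbhs; split=> //; exact: (open_Mv hv).
apply: (phi_v_inj hv); rewrite ?inE //.
apply: (@norm_hausdorff _ (Cspace R (facet_index P v))) => A B hA hB.
have [q [qA qB]] := cl _ _ (phi_v_continuous hv mv hA) (phi_v_continuous hv mv' hB).
by exists (phi_v P texp v q).
Qed.

Lemma M_second_countable : @second_countable M.
Proof.
have [z0 _] := generic_point.
have [B cB [oB hB]] := compact_second_countable_inhabited z0 Z_compact.
exists [set p @` b | b in B]; first exact: card_le_trans (card_image_le _ _) cB.
split=> [_ [b Bb <-]|m A mA]; first exact/projM_open/oB.
have [z zE] := projM_surj m.
have : nbhs z (p @^-1` A) by apply: projM_continuous; rewrite zE.
move=> /hB [b [Bb bz] bA].
exists (p @` b); first by split; [exists b|exists z].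
by move=> _ [z' bz' <-]; exact: bA.
Qed.

End ReducedSpace.

(** * The level set is a submanifold *)
Section RowIndexing.
Context {R : realType} (J : finType) (k : nat) (hk : #|J| = k).

(** Row vectors are indexed by ordinals; [rvof] and [rvat] let the entries be named by
    elements of any type of the right cardinality. *)
Definition rvof (h : J -> R) : 'rV[R]_k := \row_i h (enum_val (cast_ord (esym hk) i)).
Definition rvat (u : 'rV[R]_k) (j : J) : R := u ord0 (cast_ord hk (enum_rank j)).

Lemma rvofK h j : rvat (rvof h) j = h j.
Proof. by rewrite /rvat mxE cast_ordK enum_rankK. Qed.

Lemma rvatK u : rvof (rvat u) = u.
Proof. by apply/rowP => i; rewrite mxE /rvat enum_valK cast_ordKV. Qed.

Lemma rvof0 h : rvof h = 0 <-> forall j, h j = 0.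
Proof.
split=> [h0 j|h0]; first by rewrite -(rvofK h) h0 /rvat mxE.
by apply/rowP => i; rewrite !mxE h0.
Qed.
End RowIndexing.

Section Submanifold.
Context {R : realType} {n : nat} {F : finType} {T : topologicalZmodType}.
Variables (AT : atlas R T) (texp : {additive 'rV[R]_n -> T}).
Variables (P : polytope_data R n F).
Hypothesis hT : torus_with_exp AT texp.
Hypothesis hP : delzant P texp.

Local Notation slack := (slack P).
Local Notation Fv := (facets_at P).
Local Notation E := (Cspace R F).

Lemma from_mu_eq v (m m' : F -> R) : (forall f, f \in Fv v -> m f = m' f) ->
  from_mu P v m = from_mu P v m'.
Proof. by move=> h; apply: eq_bigr => f /h ->. Qed.

(** The values |z_f|^2 / 2 with f in F_v determine the moment image; membership in Z means
    that the remaining ones are the slacks of that point. *)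
Lemma Zset_transverse v (z : E) : vertices (Delta P) v ->
  Zset P z <-> forall f, f \notin Fv v -> mu z f - slack f (from_mu P v (mu z)) = 0.
Proof.
move=> hv; split=> [hz f _|h].
  by rewrite -(muZ_from_mu hT hP hv hz) (muZP hT hP hz) subrr.
apply/(ZsetP hT hP); exists (from_mu P v (mu z)) => f.
have [fv|fv] := boolP (f \in Fv v); first by rewrite (slack_from_mu hT hP).
by apply/eqP; rewrite -subr_eq0 h.
Qed.

Section SliceChart.
Variables (v : 'rV[R]_n) (x : E).
Hypothesis hv : vertices (Delta P) v.
Hypothesis hx : forall f, f \notin Fv v -> zc x f != 0.

Definition outside : finType := {f : F | f \notin Fv v}.
Definition slice_index : finType := ((facet_index P v + facet_index P v) + outside)%type.

Lemma card_outside : (#|Fv v| + #|{: outside}| = #|F|)%N.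
Proof. by rewrite card_sig -(cardC (mem (Fv v))); congr (_ + _)%N; apply: eq_card. Qed.

Lemma card_slice_index : #|{: slice_index}| = (n + #|F|)%N.
Proof.
rewrite !card_sum -card_outside (card_facets_at hT hP hv) card_sig.
by rewrite (card_facets_at hT hP hv) addnA.
Qed.

Let k := (n + #|F|)%N.
Let l := #|{: outside}|.
Let q_at (q : 'rV[R]_k) (j : slice_index) : R := rvat card_slice_index q j.
Let u_at (u : 'rV[R]_l) (f : outside) : R := rvat (erefl l) u f.

Let rad f : R := rePart x f ^+ 2 + imPart x f ^+ 2.
Let along (z : E) f : R := rePart x f * rePart z f + imPart x f * imPart z f.
Let across (z : E) f : R := rePart x f * imPart z f - imPart x f * rePart z f.

Let rad_gt0 f : f \notin Fv v -> 0 < rad f.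
Proof. by move=> /hx; rewrite -mu_gt0 /mu pmulr_lgt0 ?invr_gt0. Qed.

Let h (z : E) : 'rV[R]_k * 'rV[R]_l :=
  (rvof card_slice_index (fun j => match j with
     | inl (inl f) => rePart z (val f)
     | inl (inr f) => imPart z (val f)
     | inr f => across z (val f) end),
   rvof (erefl l) (fun f => mu z (val f) - slack (val f) (from_mu P v (mu z)))).

Let gre (q : 'rV[R]_k) f : R := if insub f is Some f' then q_at q (inl (inl f')) else 0.
Let gim (q : 'rV[R]_k) f : R := if insub f is Some f' then q_at q (inl (inr f')) else 0.
Let gt (q : 'rV[R]_k) f : R := if insub f is Some f' then q_at q (inr f') else 0.
Let gu (u : 'rV[R]_l) f : R := if insub f is Some f' then u_at u f' else 0.
Let gmu (q : 'rV[R]_k) f : R := (gre q f ^+ 2 + gim q f ^+ 2) / 2.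
Let disc (qu : 'rV[R]_k * 'rV[R]_l) f : R :=
  2 * rad f * (gu qu.2 f + slack f (from_mu P v (gmu qu.1))) - gt qu.1 f ^+ 2.
Let g (qu : 'rV[R]_k * 'rV[R]_l) : E :=
  mkC (fun f => if f \in Fv v then gre qu.1 f
                else (rePart x f * Num.sqrt (disc qu f) - imPart x f * gt qu.1 f) / rad f)
      (fun f => if f \in Fv v then gim qu.1 f
                else (imPart x f * Num.sqrt (disc qu f) + rePart x f * gt qu.1 f) / rad f).

Let D : set E := [set z | forall f, f \notin Fv v -> 0 < along z f].
Let W : set ('rV[R]_k * 'rV[R]_l) := [set qu | forall f, f \notin Fv v -> 0 < disc qu f].

Let insub_in f (fv : f \in Fv v) : insub f = Some (facet_of fv) :> option (facet_index P v).
Proof. exact: insubT. Qed.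

Let insub_out f (fv : f \notin Fv v) : insub f = Some (exist _ f fv) :> option outside.
Proof. exact: insubT. Qed.

Let gre_h z f : f \in Fv v -> gre (h z).1 f = rePart z f.
Proof. by move=> fv; rewrite /gre (insub_in fv) /q_at rvofK. Qed.
Let gim_h z f : f \in Fv v -> gim (h z).1 f = imPart z f.
Proof. by move=> fv; rewrite /gim (insub_in fv) /q_at rvofK. Qed.
Let gt_h z f : f \notin Fv v -> gt (h z).1 f = across z f.
Proof. by move=> fv; rewrite /gt (insub_out fv) /q_at rvofK. Qed.
Let gu_h z f : f \notin Fv v -> gu (h z).2 f = mu z f - slack f (from_mu P v (mu z)).
Proof. by move=> fv; rewrite /gu (insub_out fv) /u_at rvofK. Qed.

Let from_gmu_h z : from_mu P v (gmu (h z).1) = from_mu P v (mu z).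
Proof. by apply: from_mu_eq => f fv; rewrite /gmu gre_h // gim_h. Qed.

Let disc_h z f : f \notin Fv v -> disc (h z) f = along z f ^+ 2.
Proof.
move=> fv; rewrite /disc from_gmu_h gt_h // gu_h // subrK /rad /along /across /mu.
by field.
Qed.

Let hW z : D z -> W (h z).
Proof. by move=> Dz f fv; rewrite disc_h // exprn_gt0 //; exact: Dz. Qed.

Let gK z : D z -> g (h z) = z.
Proof.
move=> Dz; have sq f : f \notin Fv v -> Num.sqrt (disc (h z) f) = along z f.
  by move=> fv; rewrite disc_h // sqrtr_sqr gtr0_norm //; exact: Dz.
have rn f : f \notin Fv v -> rePart x f ^+ 2 + imPart x f ^+ 2 != 0.
  by move=> fv; rewrite -/(rad f) gt_eqF ?rad_gt0.
apply: Cspace_ext => f; rewrite (rePart_mkC, imPart_mkC).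
  have [fv|fv] := boolP (f \in Fv v); first by rewrite gre_h.
  by rewrite sq // gt_h // /along /across /rad; field; exact: rn.
have [fv|fv] := boolP (f \in Fv v); first by rewrite gim_h.
by rewrite sq // gt_h // /along /across /rad; field; exact: rn.
Qed.

Let g_re_in qu f : f \in Fv v -> rePart (g qu) f = gre qu.1 f.
Proof. by move=> fv; rewrite rePart_mkC fv. Qed.
Let g_im_in qu f : f \in Fv v -> imPart (g qu) f = gim qu.1 f.
Proof. by move=> fv; rewrite imPart_mkC fv. Qed.

Let g_along qu f : f \notin Fv v -> along (g qu) f = Num.sqrt (disc qu f).
Proof.
move=> fv; rewrite /along rePart_mkC imPart_mkC (negbTE fv) /rad; field.
by rewrite -/(rad f) gt_eqF ?rad_gt0.
Qed.

Let g_across qu f : f \notin Fv v -> across (g qu) f = gt qu.1 f.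
Proof.
move=> fv; rewrite /across rePart_mkC imPart_mkC (negbTE fv) /rad; field.
by rewrite -/(rad f) gt_eqF ?rad_gt0.
Qed.

Let from_mu_g qu : from_mu P v (mu (g qu)) = from_mu P v (gmu qu.1).
Proof. by apply: from_mu_eq => f fv; rewrite /mu /gmu g_re_in // g_im_in. Qed.

Let mu_g qu f : W qu -> f \notin Fv v ->
  mu (g qu) f = gu qu.2 f + slack f (from_mu P v (gmu qu.1)).
Proof.
move=> Wqu fv; have r0 := rad_gt0 fv.
have : 2 * rad f * mu (g qu) f = disc qu f + gt qu.1 f ^+ 2.
  rewrite -(g_across qu fv) -[disc qu f]sqr_sqrtr; last by rewrite ltW //; exact: Wqu.
  by rewrite -(g_along qu fv) /rad /mu /along /across; field.
by rewrite /disc subrK => /mulfI; apply; rewrite mulf_neq0 // gt_eqF.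
Qed.

Let gD qu : W qu -> D (g qu).
Proof. by move=> Wqu f fv; rewrite g_along // sqrtr_gt0; exact: Wqu. Qed.

Let hK qu : W qu -> h (g qu) = qu.
Proof.
move=> Wqu; case: (qu) (Wqu) => q u Wqu'; rewrite /h; congr (_, _).
  rewrite -[RHS](rvatK card_slice_index); congr (rvof _ _); apply/funext => -[[f|f]|f].
  - by rewrite g_re_in ?facet_indexP //= /gre valK.
  - by rewrite g_im_in ?facet_indexP //= /gim valK.
  - by rewrite g_across ?(valP f) //= /gt valK.
rewrite -[RHS](rvatK (erefl l)); congr (rvof _ _); apply/funext => f.
by rewrite from_mu_g mu_g ?(valP f) // addrK /gu /= valK.
Qed.

Let smooth_re (V : normedModType R) (B : set V) (f : V -> E) i :
  open B -> smooth B f -> smooth B (fun y => rePart (f y) i).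
Proof. by move=> oB sf; have [] := csmooth_zc oB i sf. Qed.
Let smooth_im (V : normedModType R) (B : set V) (f : V -> E) i :
  open B -> smooth B f -> smooth B (fun y => imPart (f y) i).
Proof. by move=> oB sf; have [] := csmooth_zc oB i sf. Qed.

Let smooth_sq (V : normedModType R) (B : set V) (f : V -> R) :
  open B -> smooth B f -> smooth B (fun y => f y ^+ 2).
Proof. by move=> oB sf; exact: smooth_mul. Qed.

Let smooth_slack_from_mu (V : normedModType R) (B : set V) (m : V -> F -> R) i : open B ->
  (forall f, smooth B (m^~ f)) -> smooth B (fun y => slack i (from_mu P v (m y))).
Proof.
move=> oB sm.
have key : smooth B (fun y => (\sum_f (if f \in Fv v then
    (m y f + - offset P f) * pairing (normal P i) (edge P v f) else 0)) + offset P i).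
  apply: smooth_add => //; last exact: smooth_cst.
  apply: smooth_sum => // f; case: (f \in Fv v); last exact: smooth_cst.
  apply: smooth_mul => //; last exact: smooth_cst.
  by apply: smooth_add => //; exact: smooth_cst.
apply: smooth_ext key => // y _.
rewrite /slack /from_mu pairing_sumr -big_mkcond /=; congr (_ + _).
by apply: eq_bigr => f _; rewrite pairingZr.
Qed.

Let smooth_mu_id f : smooth setT (fun z : E => mu z f).
Proof. by apply: (@smooth_mu _ _ _ _ _ id); [exact: openT|exact: smooth_id]. Qed.

Let smooth_across f : smooth setT (fun z : E => across z f).
Proof.
have sid := @smooth_id R E; have oT := @openT E.
apply: smooth_add => //; first by apply: smooth_mul => //; [exact: smooth_cst|exact: smooth_im].
by apply: smooth_opp => //; apply: smooth_mul => //; [exact: smooth_cst|exact: smooth_re].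
Qed.

Let smooth_along f : smooth setT (fun z : E => along z f).
Proof.
have sid := @smooth_id R E; have oT := @openT E.
apply: smooth_add => //; first by apply: smooth_mul => //; [exact: smooth_cst|exact: smooth_re].
by apply: smooth_mul => //; [exact: smooth_cst|exact: smooth_im].
Qed.

Let smooth_h : smooth setT h.
Proof.
have sid := @smooth_id R E; have oT := @openT E.
apply: smooth_pair => //.
  apply: (smooth_row (f := fun i z => match enum_val (cast_ord (esym card_slice_index) i) with
     | inl (inl f) => rePart z (val f)
     | inl (inr f) => imPart z (val f)
     | inr f => across z (val f) end)) => // i.
  case: (enum_val _) => [[f|f]|f]; [exact: smooth_re|exact: smooth_im|exact: smooth_across].
pose out i : F := val (enum_val (cast_ord (esym (erefl l)) i) : outside).
apply: (smooth_row (f := fun i z => mu z (out i) + - slack (out i) (from_mu P v (mu z)))) => // i.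
apply: smooth_add => //.
by apply: smooth_opp => //; apply: smooth_slack_from_mu => // f; exact: smooth_mu_id.
Qed.

Let smooth_q_at j : smooth setT (fun qu : 'rV[R]_k * 'rV[R]_l => q_at qu.1 j).
Proof.
have oT := @openT ('rV[R]_k * 'rV[R]_l)%type.
by apply: smooth_coord_comp => //; apply: smooth_fst_comp => //; exact: smooth_id.
Qed.

Let smooth_u_at j : smooth setT (fun qu : 'rV[R]_k * 'rV[R]_l => u_at qu.2 j).
Proof.
have oT := @openT ('rV[R]_k * 'rV[R]_l)%type.
by apply: smooth_coord_comp => //; apply: smooth_snd_comp => //; exact: smooth_id.
Qed.

Let smooth_gre f : smooth setT (fun qu : 'rV[R]_k * 'rV[R]_l => gre qu.1 f).
Proof. by rewrite /gre; case: (insub f) => [f'|]; [exact: smooth_q_at|exact: smooth_cst]. Qed.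
Let smooth_gim f : smooth setT (fun qu : 'rV[R]_k * 'rV[R]_l => gim qu.1 f).
Proof. by rewrite /gim; case: (insub f) => [f'|]; [exact: smooth_q_at|exact: smooth_cst]. Qed.
Let smooth_gt f : smooth setT (fun qu : 'rV[R]_k * 'rV[R]_l => gt qu.1 f).
Proof. by rewrite /gt; case: (insub f) => [f'|]; [exact: smooth_q_at|exact: smooth_cst]. Qed.
Let smooth_gu f : smooth setT (fun qu : 'rV[R]_k * 'rV[R]_l => gu qu.2 f).
Proof. by rewrite /gu; case: (insub f) => [f'|]; [exact: smooth_u_at|exact: smooth_cst]. Qed.

Let smooth_disc f : smooth setT (disc^~ f).
Proof.
have oT := @openT ('rV[R]_k * 'rV[R]_l)%type.
apply: smooth_add => //; last by apply: smooth_opp => //; exact: smooth_sq.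
apply: smooth_mul => //; first exact: smooth_cst.
apply: smooth_add => //; apply: smooth_slack_from_mu => // f'.
apply: smooth_mul => //; last exact: smooth_cst.
by apply: smooth_add => //; exact: smooth_sq.
Qed.

Let oW : open W.
Proof.
apply: (@open_forall_pos _ _ F (fun f => f \notin Fv v) (fun f qu => disc qu f)) => f qu.
exact: (smooth_continuous (smooth_disc f)).
Qed.

Let oD : open D.
Proof.
apply: (@open_forall_pos _ _ F (fun f => f \notin Fv v) (fun f z => along z f)) => f z.
exact: (smooth_continuous (smooth_along f)).
Qed.

Let smooth_g : smooth W g.
Proof.
have sw (f : 'rV[R]_k * 'rV[R]_l -> R) : smooth setT f -> smooth W f by apply: smooth_sub.
have sd f : f \notin Fv v -> smooth W (fun qu => Num.sqrt (disc qu f)).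
  by move=> fv; apply: smooth_sqrt_comp => //; [move=> qu; exact|exact: sw].
apply: smooth_pair => //.
  apply: (smooth_row (f := fun j qu => let f := enum_val j in
    if f \in Fv v then gre qu.1 f else (rePart x f * Num.sqrt (disc qu f) +
      - (imPart x f * gt qu.1 f)) * (rad f)^-1)) => // j /=.
  have [fv|fv] := boolP (enum_val j \in Fv v); first exact: sw.
  apply: smooth_mul => //; last exact: smooth_cst.
  apply: smooth_add => //; first by apply: smooth_mul => //; [exact: smooth_cst|exact: sd].
  by apply: smooth_opp => //; apply: smooth_mul => //; [exact: smooth_cst|exact: sw].
apply: (smooth_row (f := fun j qu => let f := enum_val j in
  if f \in Fv v then gim qu.1 f else (imPart x f * Num.sqrt (disc qu f) +
    rePart x f * gt qu.1 f) * (rad f)^-1)) => // j /=.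
have [fv|fv] := boolP (enum_val j \in Fv v); first exact: sw.
apply: smooth_mul => //; last exact: smooth_cst.
apply: smooth_add => //; first by apply: smooth_mul => //; [exact: smooth_cst|exact: sd].
by apply: smooth_mul => //; [exact: smooth_cst|exact: sw].
Qed.

(** The chart h records the coordinates in F_v and, for f outside F_v, the component of z_f
    orthogonal to x_f together with the defect of the equation |z_f|^2 / 2 = slack f; Z is
    where all defects vanish ([Zset_transverse]). Near x the component of z_f along x_f is
    positive, and it is recovered by taking a square root, as the defect and the orthogonal
    component determine its square [disc]. *)
Lemma slice_chart : exists (l : nat) (O : set E) (h : E -> 'rV[R]_(n + #|F|) * 'rV[R]_l),
    [/\ open O, O x, smooth O h, set_inj O h & open (h @` O)] /\
    smooth_via h O id /\
    O `&` Zset P = O `&` [set y | (h y).2 = 0].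
Proof.
exists l, D, h; split; [split|split]; first exact: oD.
- by move=> f fv; have := rad_gt0 fv; rewrite /rad /along -!expr2.
- exact: smooth_sub smooth_h.
- by move=> z z'; rewrite !inE => Dz Dz' E; rewrite -(gK Dz) E gK.
- rewrite (_ : h @` D = W) //; apply/seteqP; split=> [_ [z Dz <-]|qu Wqu]; first exact: hW.
  by exists (g qu); [exact: gD|exact: hK].
- apply: (smooth_via_of_smooth oW smooth_g) => z Dz; first exact: hW.
  by rewrite gK.
apply/seteqP; split=> z [Dz hz]; split=> //.
  by apply/rvof0 => f; move: hz => /(Zset_transverse _ hv); apply; exact: (valP f).
apply/(Zset_transverse _ hv) => f fv.
by move: hz => /rvof0 /(_ (exist _ f fv)).
Qed.

End SliceChart.

Lemma Zset_submanifold : smooth_submanifold (Zset P) (n + #|F|)%N.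
Proof.
move=> x hx; have [v hv xv] := Zv_cover hT hP (exist _ x (mem_set hx) : Ztype P).
exact: (slice_chart hv ((ZvE hT hP hv _).1 xv)).
Qed.

End Submanifold.

(** * Velocities of plane curves *)
Section Curves.
Context {R : realType}.
Implicit Types V W : normedModType R.

(** The velocity of an image curve is the image of the velocity. *)
Lemma derive1_comp_diff V W (c : R -> V) (g : V -> W) (s : R) :
  differentiable c s -> differentiable g (c s) ->
  derive1 (fun r => g (c r)) s = 'd g (c s) (derive1 c s).
Proof.
move=> dc dg; have dgc := differentiable_comp dc dg.
rewrite -[LHS]/(derive1 (g \o c) s) (derive1E' dgc) (derive1E' dc).
by rewrite (diff_comp dc dg).
Qed.

Lemma derive1_lin_comp V W (c : R -> V) (L : {linear V -> W}) (s : R) :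
  continuous L -> differentiable c s ->
  derive1 (fun r => L (c r)) s = L (derive1 c s).
Proof.
move=> cL dc; rewrite (derive1_comp_diff dc (linear_differentiable _ cL)).
by rewrite (diff_lin _ cL).
Qed.

Lemma near_eq_derive1 V (c c' : R -> V) (s : R) : (\forall r \near s, c r = c' r) ->
  derive1 c s = derive1 c' s.
Proof. by move=> h; rewrite !derive1E; exact: near_eq_derive. Qed.

Local Notation C := (complex R).

(** Componentwise, so that the calculus of real functions applies. *)
Definition is_cderive (h : R -> C) (a : C) : Prop :=
  is_derive (0 : R) (1 : R) (fun s => complex.Re (h s)) (complex.Re a) /\
  is_derive (0 : R) (1 : R) (fun s => complex.Im (h s)) (complex.Im a).

Lemma is_derive_val (f : R -> R) (a : R) : is_derive (0 : R) (1 : R) f a -> derive1 f 0 = a.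
Proof. by move=> h; rewrite derive1E derive_val. Qed.

Lemma is_derive_mulr (f g : R -> R) (a b : R) : is_derive (0 : R) (1 : R) f a ->
  is_derive (0 : R) (1 : R) g b ->
  is_derive (0 : R) (1 : R) (fun s => f s * g s) (f 0 * b + g 0 * a).
Proof. by move=> hf hg; exact: is_deriveM. Qed.

Lemma is_derive_addr (f g : R -> R) (a b : R) : is_derive (0 : R) (1 : R) f a ->
  is_derive (0 : R) (1 : R) g b ->
  is_derive (0 : R) (1 : R) (fun s => f s + g s) (a + b).
Proof. by move=> hf hg; exact: is_deriveD. Qed.

Lemma is_derive_subr (f g : R -> R) (a b : R) : is_derive (0 : R) (1 : R) f a ->
  is_derive (0 : R) (1 : R) g b ->
  is_derive (0 : R) (1 : R) (fun s => f s - g s) (a - b).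
Proof. by move=> hf hg; exact: is_deriveB. Qed.

Lemma is_derive_invr (f : R -> R) (a : R) : f 0 != 0 -> is_derive (0 : R) (1 : R) f a ->
  is_derive (0 : R) (1 : R) (fun s => (f s)^-1) (- (f 0) ^- 2 * a).
Proof. by move=> f0 hf; exact: is_deriveV. Qed.

Lemma is_derive_sum_fin (I : Type) (r : seq I) (p : pred I) (f : I -> R -> R) (a : I -> R) :
  (forall i, p i -> is_derive (0 : R) (1 : R) (f i) (a i)) ->
  is_derive (0 : R) (1 : R) (fun s => \sum_(i <- r | p i) f i s) (\sum_(i <- r | p i) a i).
Proof.
move=> h; elim: r => [|i r IH].
  by rewrite big_nil; under eq_fun do rewrite big_nil; exact: is_derive_cst.
rewrite big_cons; under eq_fun do rewrite big_cons.
by have [pi|//] := boolP (p i); apply: is_derive_addr => //; exact: h.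
Qed.

Lemma is_derive_sqrt_comp (f : R -> R) (a : R) : 0 < f 0 -> is_derive (0 : R) (1 : R) f a ->
  is_derive (0 : R) (1 : R) (fun s => Num.sqrt (f s)) (a / (2 * Num.sqrt (f 0))).
Proof.
move=> f0 hf; have hs := is_derive1_sqrt f0.
have := @is_derive1_comp R Num.sqrt f 0 _ _ hs hf.
by rewrite mulrC.
Qed.

Lemma cderive_mul (h g : R -> C) a b : is_cderive h a -> is_cderive g b ->
  is_cderive (fun s => h s * g s) (a * g 0 + h 0 * b).
Proof.
have hRe : (fun s => complex.Re (h s * g s)) =
    (fun s => complex.Re (h s) * complex.Re (g s) - complex.Im (h s) * complex.Im (g s)).
  by apply/funext => s; case: (h s) (g s) => [? ?] [].
have hIm : (fun s => complex.Im (h s * g s)) =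
    (fun s => complex.Re (h s) * complex.Im (g s) + complex.Im (h s) * complex.Re (g s)).
  by apply/funext => s; case: (h s) (g s) => [? ?] [].
move=> [h1 h2] [g1 g2]; split.
  rewrite hRe.
  apply: is_derive_eq (is_derive_subr (is_derive_mulr h1 g1) (is_derive_mulr h2 g2)) _.
  by case: a b (h 0) (g 0) {h1 h2 g1 g2} => [a1 a2] [b1 b2] [c1 c2] [d1 d2] /=; ring.
rewrite hIm; apply: is_derive_eq (is_derive_addr (is_derive_mulr h1 g2) (is_derive_mulr h2 g1)) _.
by case: a b (h 0) (g 0) {h1 h2 g1 g2} => [a1 a2] [b1 b2] [c1 c2] [d1 d2] /=; ring.
Qed.

Lemma cderive_cst (a : C) : is_cderive (fun=> a) 0.
Proof. by split; exact: is_derive_cst. Qed.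

(** Logarithmic derivatives turn the products of powers in [phihat] into sums. *)
Definition is_logderive (h : R -> C) (w : C) : Prop := h 0 != 0 /\ is_cderive h (w * h 0).

Lemma logderive_mul h g w w' : is_logderive h w -> is_logderive g w' ->
  is_logderive (fun s => h s * g s) (w + w').
Proof.
move=> [h0 hw] [g0 gw]; split; first by rewrite mulf_neq0.
have := cderive_mul hw gw.
by rewrite (_ : _ + _ = (w + w') * (h 0 * g 0)) //; ring.
Qed.

Lemma logderive_cst (a : C) : a != 0 -> is_logderive (fun=> a) 0.
Proof. by move=> a0; split=> //; rewrite mul0r; exact: cderive_cst. Qed.

Lemma logderive_inv h w : is_logderive h w -> is_logderive (fun s => (h s)^-1) (- w).
Proof.
move=> [h0 [h1 h2]]; split; first by rewrite invr_eq0.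
pose N s := complex.Re (h s) ^+ 2 + complex.Im (h s) ^+ 2.
have N0 : N 0 != 0.
  move: h0; rewrite /N; case: (h 0) => a b; rewrite eq_complex negb_and /= => ab.
  by rewrite paddr_eq0 ?sqr_ge0 // !sqrf_eq0 negb_and.
have dN := is_derive_addr (is_derive_mulr h1 h1) (is_derive_mulr h2 h2).
have dNi := is_derive_invr (f := N) N0 dN.
have hRe : (fun s => complex.Re (h s)^-1) = (fun s => complex.Re (h s) * (N s)^-1).
  by apply/funext => s; rewrite /N; case: (h s).
have hIm : (fun s => complex.Im (h s)^-1) = (fun s => 0 - complex.Im (h s) * (N s)^-1).
  by apply/funext => s; rewrite /N sub0r; case: (h s).
split.
  rewrite hRe; apply: is_derive_eq (is_derive_mulr h1 dNi) _.
  move: N0; rewrite /N; case: w (h 0) {h1 h2 h0 dN dNi} => [w1 w2] [c1 c2] /= N0.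
  by field; exact: N0.
rewrite hIm; apply: is_derive_eq (is_derive_subr (is_derive_cst _ _ _) (is_derive_mulr h2 dNi)) _.
move: N0; rewrite /N; case: w (h 0) {h1 h2 h0 dN dNi} => [w1 w2] [c1 c2] /= N0.
by field; exact: N0.
Qed.

Lemma logderive_expn h w k : is_logderive h w -> is_logderive (fun s => h s ^+ k) (k%:R * w).
Proof.
move=> hw; elim: k => [|k IH].
  rewrite mul0r; under eq_fun do rewrite expr0; apply: logderive_cst; exact: oner_neq0.
rewrite -natr1 mulrDl mul1r addrC; under eq_fun do rewrite exprS; exact: logderive_mul.
Qed.

Lemma logderive_expz h w (k : int) : is_logderive h w ->
  is_logderive (fun s => h s ^ k) (k%:~R * w).
Proof.
move=> hw; case: k => k; first exact: logderive_expn.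
have -> : (Negz k)%:~R * w = - (k.+1%:R * w) by rewrite NegzE mulrNz mulNr.
exact: logderive_inv (logderive_expn k.+1 hw).
Qed.

Lemma logderive_prod (I : Type) (r : seq I) (p : pred I) (h : I -> R -> C) (w : I -> C) :
  (forall i, p i -> is_logderive (h i) (w i)) ->
  is_logderive (fun s => \prod_(i <- r | p i) h i s) (\sum_(i <- r | p i) w i).
Proof.
move=> hw; elim: r => [|i r IH].
  rewrite big_nil; under eq_fun do rewrite big_nil; apply: logderive_cst; exact: oner_neq0.
rewrite big_cons; under eq_fun do rewrite big_cons.
by have [pi|//] := boolP (p i); apply: logderive_mul => //; exact: hw.
Qed.

(** Angular velocity of a plane curve at position c with velocity a. *)
Definition angular (c a : C) : R :=
  (complex.Re c * complex.Im a - complex.Im c * complex.Re a) /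
  (complex.Re c ^+ 2 + complex.Im c ^+ 2).

(** The phase moves on the unit circle, so its logarithmic derivative is purely imaginary. *)
Lemma logderive_phase h a : h 0 != 0 -> is_cderive h a ->
  is_logderive (fun s => phase (h s)) (Complex 0 (angular (h 0) a)).
Proof.
move=> h0 [h1 h2]; split; first by rewrite -normc_eq0 normc_phase ?oner_eq0.
pose N s := complex.Re (h s) ^+ 2 + complex.Im (h s) ^+ 2.
have N0 : 0 < N 0.
  move: h0; rewrite /N; case: (h 0) => u v; rewrite eq_complex negb_and /= => ab.
  by rewrite lt_def paddr_eq0 ?sqr_ge0 // !sqrf_eq0 negb_and ab addr_ge0 ?sqr_ge0.
have dN := is_derive_addr (is_derive_mulr h1 h1) (is_derive_mulr h2 h2).
have dq := is_derive_sqrt_comp (f := N) N0 dN.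
have q0 : Num.sqrt (N 0) != 0 by rewrite gt_eqF // sqrtr_gt0.
have dqi := is_derive_invr q0 dq.
have phE s : phase (h s) = Complex (complex.Re (h s) * (Num.sqrt (N s))^-1)
    (complex.Im (h s) * (Num.sqrt (N s))^-1).
  rewrite /phase /N; case: (h s) => u v; rewrite /normc /=; set q := Num.sqrt _.
  have [->|q1] := eqVneq q 0.
    by rewrite (_ : Complex 0 0 = 0 :> C) // (@invr0 C) (@invr0 R) !mulr0.
  by apply/eqP; rewrite eq_complex /=; apply/andP; split; apply/eqP; field.
have qq : Num.sqrt (N 0) ^+ 2 = N 0 by rewrite sqr_sqrtr // ltW.
split.
  under eq_fun do rewrite phE /=; apply: is_derive_eq (is_derive_mulr h1 dqi) _.
  rewrite phE /angular.
  move: qq q0; set q := Num.sqrt (N 0); rewrite /N; move: q.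
  case: a (h 0) {h1 h2 h0 dN dq dqi N0} => [a1 a2] [c1 c2] /= q qq q0.
  have e : q^-1 * a1 = (c1 ^+ 2 + c2 ^+ 2) * a1 / q ^+ 3 by rewrite -qq; field.
  by rewrite -qq e; field.
under eq_fun do rewrite phE /=; apply: is_derive_eq (is_derive_mulr h2 dqi) _.
rewrite phE /angular.
move: qq q0; set q := Num.sqrt (N 0); rewrite /N; move: q.
case: a (h 0) {h1 h2 h0 dN dq dqi N0} => [a1 a2] [c1 c2] /= q qq q0.
have e : q^-1 * a2 = (c1 ^+ 2 + c2 ^+ 2) * a2 / q ^+ 3 by rewrite -qq; field.
by rewrite -qq e; field.
Qed.

Lemma cderive_zc (I : finType) (c : R -> Cspace R I) i : differentiable c 0 ->
  is_cderive (fun s => zc (c s) i) (zc (derive1 c 0) i).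
Proof.
move=> dc.
have lre : linear (fun z : Cspace R I => rePart z i) by move=> a x y; exact: rePart_lin.
have lim : linear (fun z : Cspace R I => imPart z i) by move=> a x y; exact: imPart_lin.
pose Lre : {linear Cspace R I -> R} := mklinear lre.
pose Lim : {linear Cspace R I -> R} := mklinear lim.
have cre : continuous Lre.
  move=> z; apply: (@continuous_comp _ _ _ fst (fun x : 'rV[R]_#|I| => x ord0 (enum_rank i))).
    exact: cvg_fst.
  exact: coord_continuous.
have cim : continuous Lim.
  move=> z; apply: (@continuous_comp _ _ _ snd (fun x : 'rV[R]_#|I| => x ord0 (enum_rank i))).
    exact: cvg_snd.
  exact: coord_continuous.
have key (L : {linear Cspace R I -> R}) : continuous L ->
    is_derive (0 : R) (1 : R) (fun s => L (c s)) (L (derive1 c 0)).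
  move=> cL; apply: DeriveDef; last by rewrite -derive1E derive1_lin_comp.
  apply/derivable1_diffP/(differentiable_comp dc); exact: linear_differentiable.
by split; [exact: (key Lre)|exact: (key Lim)].
Qed.

Lemma cderive_unique (h : R -> C) a b : is_cderive h a -> is_cderive h b -> a = b.
Proof.
move=> [h1 h2] [h3 h4]; apply/eqP; rewrite eq_complex -(is_derive_val h1) -(is_derive_val h2).
by rewrite (is_derive_val h3) (is_derive_val h4) !eqxx.
Qed.

End Curves.

(** * The standard symplectic form *)
Section SymplecticAlgebra.
Context {R : realType}.
Local Notation C := (complex R).

Lemma complex_int_imag (k : int) (r : R) : (k%:~R : C) * Complex 0 r = Complex 0 (k%:~R * r).
Proof.
rewrite -(rmorph_int (real_complex R)); apply/eqP; rewrite eq_complex /=.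
by rewrite !mulr0 mul0r subrr addr0 !eqxx.
Qed.

(** The area form dx /\ dy. *)
Definition omega (a b : C) : R := complex.Re a * complex.Im b - complex.Im a * complex.Re b.

Lemma sigmaE (I : finType) (u w : Cspace R I) :
  sigma u w = (2 * pi)^-1 * \sum_i omega (zc u i) (zc w i).
Proof. by []. Qed.

Lemma omega_unit (k a b : C) : normc k = 1 -> omega (k * a) (k * b) = omega a b.
Proof.
case: k a b => [k1 k2] [a1 a2] [b1 b2]; rewrite /normc /omega /= => h.
have {}h : k1 ^+ 2 + k2 ^+ 2 = 1.
  by rewrite -[LHS]sqr_sqrtr ?h ?expr1n // addr_ge0 // sqr_ge0.
by rewrite -[RHS]mul1r -h; ring.
Qed.

Lemma sigma_rotate (I : finType) (t : I -> R) (u w : Cspace R I) :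
  sigma (rotate t u) (rotate t w) = sigma u w.
Proof.
rewrite !sigmaE; congr (_ * _); apply: eq_bigr => i _.
by rewrite (zc_rotate t u i) (zc_rotate t w i) omega_unit // normc_cis.
Qed.

(** The rate of change of |c|^2 / 2 under velocity a. *)
Definition radial (c a : C) : R := complex.Re c * complex.Re a + complex.Im c * complex.Im a.

(** Effect of an additional rotation of the plane, with speeds r and s for the two vectors. *)
Lemma omega_shift (c a b : C) (r s : R) :
  omega (a + Complex 0 r * c) (b + Complex 0 s * c) = omega a b + s * radial c a - r * radial c b.
Proof. by case: c a b => [c1 c2] [a1 a2] [b1 b2]; rewrite /omega /radial /=; ring. Qed.

(** In polar coordinates the area form is d(rho^2 / 2) /\ d theta. *)
Lemma omega_polar (c a b : C) : c != 0 ->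
  omega a b = angular c b * radial c a - angular c a * radial c b.
Proof.
case: c a b => [c1 c2] [a1 a2] [b1 b2]; rewrite eq_complex negb_and /= => c0.
rewrite /omega /radial /angular /=; field.
by rewrite paddr_eq0 ?sqr_ge0 // !sqrf_eq0 negb_and.
Qed.

Lemma sigma_linear (I : finType) (a : R) (u u' w : Cspace R I) :
  sigma (a *: u + u') w = a * sigma u w + sigma u' w.
Proof.
rewrite !sigmaE.
have -> : \sum_i omega (zc (a *: u + u') i) (zc w i) =
    a * (\sum_i omega (zc u i) (zc w i)) + \sum_i omega (zc u' i) (zc w i); last by ring.
rewrite mulr_sumr -big_split; apply: eq_bigr => i _ /=.
by rewrite /omega /zc /= /rePart /imPart !mxE; ring.
Qed.

Lemma sigma_diag (I : finType) (u : Cspace R I) : sigma u u = 0.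
Proof.
by rewrite /sigma big1 ?mulr0 // => i _; rewrite [imPart u i * _]mulrC subrr.
Qed.

Lemma sigma_nondegenerate (I : finType) (u : Cspace R I) : (forall w, sigma u w = 0) -> u = 0.
Proof.
move=> h; have := h (mkC (fun i => - imPart u i) (fun i => rePart u i)).
rewrite /sigma => /eqP; rewrite mulf_eq0 invr_eq0 mulf_eq0 pnatr_eq0 /= gt_eqF ?pi_gt0 //=.
rewrite psumr_eq0 => [/allP hi|i _]; last first.
  by rewrite rePart_mkC imPart_mkC mulrN opprK -!expr2 addr_ge0 // sqr_ge0.
have h0 i : rePart u i = 0 /\ imPart u i = 0.
  have := hi i; rewrite mem_index_enum rePart_mkC imPart_mkC mulrN opprK -!expr2 => /(_ isT).
  by rewrite paddr_eq0 ?sqr_ge0 // !sqrf_eq0 => /andP[/eqP -> /eqP ->].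
by apply: Cspace_ext => i; have [hr hm] := h0 i; rewrite ?hr ?hm /rePart /imPart !mxE.
Qed.

Lemma mu_derive (I : finType) (c : R -> Cspace R I) i : differentiable c 0 ->
  is_derive (0 : R) (1 : R) (fun s => mu (c s) i) (radial (zc (c 0) i) (zc (derive1 c 0) i)).
Proof.
move=> dc; have [h1 h2] := cderive_zc i dc.
have H := is_derive_mulr (is_derive_addr (is_derive_mulr h1 h1) (is_derive_mulr h2 h2))
  (is_derive_cst (2^-1 : R) (0 : R) (1 : R)).
by apply: is_derive_eq H _; rewrite /radial /=; field.
Qed.

End SymplecticAlgebra.

(** * The form on the level set in a chart *)
Section ReducedForm.
Context {R : realType} {n : nat} {F : finType} {T : topologicalZmodType}.
Variables (AT : atlas R T) (texp : {additive 'rV[R]_n -> T}).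
Variables (P : polytope_data R n F).
Hypothesis hT : torus_with_exp AT texp.
Hypothesis hP : delzant P texp.
Implicit Types (Y xi v : 'rV[R]_n) (t : F -> R) (z : Ztype P).

Local Notation slack := (slack P).
Local Notation Fv := (facets_at P).
Local Notation Z := (Ztype P).
Local Notation M := (Mspace P texp).
Local Notation p := (projM P texp).
Local Notation phihat := (phihat P).
Local Notation coef := (coef P).
Local Notation A := (M_atlas P texp).
Local Notation E := (Cspace R F).
Local Notation C := (complex R).

Lemma curve_differentiable (c : R -> Z) : smooth_curve c ->
  differentiable (fun s => val (c s)) 0.
Proof. by move=> sc; exact: (smooth_differentiable sc (I : setT 0)). Qed.

Section AtVertex.
Variable v : 'rV[R]_n.
Hypothesis hv : vertices (Delta P) v.
Local Notation Cv := (Cspace R (facet_index P v)).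

Lemma curve_near_Zv (c : R -> Z) : smooth_curve c -> Zv P v (c 0) ->
  \forall s \near (0 : R), Zv P v (c s).
Proof.
move=> sc zv; have cc := smooth_continuous sc (I : setT (0 : R)).
have : \forall s \near (0 : R), Dv P v (val (c s)).
  apply: (cc (Dv P v)); apply: open_nbhs_nbhs; split; first exact: open_Dv.
  by apply/(ZvDv hT hP hv).
by apply: filterS => s h; apply/(ZvDv hT hP hv).
Qed.

Lemma curve_phi_v (c : R -> Z) : smooth_curve c -> Zv P v (c 0) ->
  derive1 (fun s => phi_v P texp v (p (c s))) 0 = derive1 (fun s => phihat v (val (c s))) 0.
Proof.
move=> sc zv; apply: near_eq_derive1; apply: filterS (curve_near_Zv sc zv) => s hs.
by rewrite (phi_v_projM hT hP hv).
Qed.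

Let unit_part z f : C := \prod_(f' | f' \notin Fv v) phase (zc (val z) f') ^ coef v f' f.

Let twist (z : Z) (d : E) f : R :=
  \sum_(f' | f' \notin Fv v) (coef v f' f)%:~R * angular (zc (val z) f') (zc d f').

(** The chart acts on a velocity by a unit factor and an additional rotation with speed
    [twist], the combination of the angular velocities outside F_v with coefficients c_f'f. *)
Lemma phihat_velocity (c : R -> Z) (f : facet_index P v) :
  smooth_curve c -> Zv P v (c 0) ->
  zc (derive1 (fun s => phihat v (val (c s))) 0) f =
  unit_part (c 0) (val f) * (zc (derive1 (fun s => val (c s)) 0) (val f) +
    Complex 0 (twist (c 0) (derive1 (fun s => val (c s)) 0) (val f)) * zc (val (c 0)) (val f)).
Proof.
move=> sc zv; have dv0 := (ZvDv hT hP hv _).1 zv.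
have dc := curve_differentiable sc.
have dph : differentiable (phihat v \o (fun s => val (c s))) 0.
  apply: differentiable_comp => //; exact: (smooth_differentiable (phihat_smooth P v) dv0).
set d := derive1 (fun s => val (c s)) 0.
have lphase f' : f' \notin Fv v -> is_logderive (fun s => phase (zc (val (c s)) f'))
    (Complex 0 (angular (zc (val (c 0)) f') (zc d f'))).
  move=> f'v; apply: (logderive_phase (h := fun s => zc (val (c s)) f')); first exact: dv0.
  exact: (cderive_zc f' dc).
have [_ lprod] := logderive_prod (index_enum F) (p := fun f' => f' \notin Fv v)
   (fun f' f'v => logderive_expz (coef v f' (val f)) (lphase f' f'v)).
have := cderive_mul (cderive_zc (val f) dc) lprod.
have E1 : (fun s => zc (val (c s)) (val f) *
    \prod_(f' | f' \notin Fv v) phase (zc (val (c s)) f') ^ coef v f' (val f)) =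
    fun s => zc (phihat v (val (c s))) f.
  by apply/funext => s; rewrite zc_phihat.
rewrite E1 => H; apply: (etrans (cderive_unique (cderive_zc f dph) H)).
rewrite -/(unit_part (c 0) (val f)) -/d.
have -> : \sum_(f' | f' \notin Fv v) (coef v f' (val f))%:~R *
    Complex 0 (angular (zc (val (c 0)) f') (zc d f')) =
    Complex 0 (twist (c 0) d (val f)).
  rewrite /twist (big_morph (fun r : R => Complex 0 r : C) (id1 := 0) (op1 := +%R)) //;
    last first.
    by move=> a b; apply/eqP; rewrite eq_complex /= addr0 !eqxx.
  by apply: eq_bigr => f' _; exact: complex_int_imag.
by ring.
Qed.

Lemma mu_velocity (c : R -> Z) f : smooth_curve c ->
  is_derive (0 : R) (1 : R) (fun s => mu (val (c s)) f)
    (radial (zc (val (c 0)) f) (zc (derive1 (fun s => val (c s)) 0) f)).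
Proof.
by move=> sc; apply: (mu_derive f (c := fun s => val (c s))); exact: curve_differentiable.
Qed.

(** Differentiates the affine relations between the |z_f|^2 / 2 along a curve in Z. *)
Lemma radial_outside (c : R -> Z) f' : smooth_curve c ->
  let rad f := radial (zc (val (c 0)) f) (zc (derive1 (fun s => val (c s)) 0) f) in
  rad f' = \sum_(f in Fv v) (coef v f' f)%:~R * rad f.
Proof.
move=> sc rad; apply: (etrans (esym (is_derive_val (mu_velocity f' sc)))).
have -> : (fun s => mu (val (c s)) f') = fun s => \sum_(f in Fv v) (coef v f' f)%:~R *
    (mu (val (c s)) f - offset P f) + offset P f'.
  apply/funext => s; have hz := ZsetZ (c s).
  have := slack_normal_coef hT hP f' (muZ P (val (c s))) hv.
  rewrite -(muZP hT hP hz) => /eqP; rewrite subr_eq => /eqP ->; congr (_ + _).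
  by apply: eq_bigr => f _; rewrite (muZP hT hP hz).
apply: is_derive_val.
have H : is_derive (0 : R) (1 : R) (fun s => \sum_(f in Fv v) (coef v f' f)%:~R *
    (mu (val (c s)) f - offset P f)) (\sum_(f in Fv v) (coef v f' f)%:~R * rad f).
  apply: is_derive_sum_fin => f _.
  have Hm := is_derive_subr (mu_velocity f sc) (is_derive_cst (offset P f) (0 : R) (1 : R)).
  have H := is_derive_mulr (is_derive_cst ((coef v f' f)%:~R : R) (0 : R) (1 : R)) Hm.
  by apply: is_derive_eq H _; rewrite /rad; ring.
apply: is_derive_eq (is_derive_addr H (is_derive_cst (offset P f') (0 : R) (1 : R))) _.
by rewrite addr0.
Qed.

(** The chart takes the restriction of sigma to Z to the standard form. The unit factors do
    not matter; the rotations in the coordinates of F_v contribute the sum over f in F_v of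
    [twist] against the radial rates, and by [radial_outside] this equals the sum over f'
    outside F_v of the angular velocity against the radial rate, which is the part of sigma
    outside F_v ([omega_polar]). *)
Lemma sigma_phihat (c1 c2 : R -> Z) : smooth_curve c1 -> smooth_curve c2 ->
  c1 0 = c2 0 -> Zv P v (c1 0) ->
  sigma (derive1 (fun s => phihat v (val (c1 s))) 0)
        (derive1 (fun s => phihat v (val (c2 s))) 0) =
  sigma (derive1 (fun s => val (c1 s)) 0) (derive1 (fun s => val (c2 s)) 0).
Proof.
move=> s1 s2 c12 zv; have dv0 := (ZvDv hT hP hv _).1 zv.
have zv2 : Zv P v (c2 0) by rewrite -c12.
have r1 := fun f' => radial_outside f' s1; have r2 := fun f' => radial_outside f' s2.
have v1 := fun f => phihat_velocity f s1 zv; have v2 := fun f => phihat_velocity f s2 zv2.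
rewrite -c12 in v2 r2.
move: r1 r2 v1 v2.
set d1 := derive1 (fun s => val (c1 s)) 0; set d2 := derive1 (fun s => val (c2 s)) 0.
move: (c1 0) dv0 {zv c12 zv2} => z dv0 /= r1 r2 v1 v2.
pose rad1 f := radial (zc (val z) f) (zc d1 f); pose rad2 f := radial (zc (val z) f) (zc d2 f).
pose ang1 f := angular (zc (val z) f) (zc d1 f); pose ang2 f := angular (zc (val z) f) (zc d2 f).
rewrite !sigmaE; congr (_ * _).
transitivity (\sum_(f in Fv v) (omega (zc d1 f) (zc d2 f) +
  (twist z d2 f * rad1 f - twist z d1 f * rad2 f))).
  rewrite -big_facet_index; apply: eq_bigr => f _.
  apply: (etrans (congr2 omega (v1 f) (v2 f))).
  have nu : normc (unit_part z (val f)) = 1.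
    rewrite /unit_part normc_prod big1 // => f' f'v.
    by rewrite normc_expz // normc_phase //; exact: dv0.
  apply: (etrans (omega_unit _ _ nu)); apply: (etrans (omega_shift _ _ _ _ _)).
  by rewrite -addrA.
rewrite big_split /= [RHS](bigID (fun f => f \in Fv v)) /=; congr (_ + _).
have -> : \sum_(f | f \notin Fv v) omega (zc d1 f) (zc d2 f) =
    \sum_(f | f \notin Fv v) (ang2 f * rad1 f - ang1 f * rad2 f).
  by apply: eq_bigr => f fv; apply: omega_polar; exact: dv0.
have tw (d : E) (r : F -> R) :
    (forall f', r f' = \sum_(f in Fv v) (coef v f' f)%:~R * r f) ->
    \sum_(f in Fv v) twist z d f * r f =
    \sum_(f' | f' \notin Fv v) angular (zc (val z) f') (zc d f') * r f'.
  move=> hr; rewrite /twist.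
  under eq_bigr do rewrite mulr_suml.
  rewrite exchange_big /=; apply: eq_bigr => f' _; rewrite (hr f') mulr_sumr.
  by apply: eq_bigr => f _; ring.
rewrite !sumrB; congr (_ - _); [exact: (tw d2 rad1 r1)|exact: (tw d1 rad2 r2)].
Qed.

(** Tangent vectors are represented by curves defined for all times: a small multiple of
    the sine has speed 1 at 0 and remains in a given ball. *)
Lemma curve_in_ball (Vm : normedModType R) (D : set Vm) (w0 u : Vm) : open D -> D w0 ->
  exists theta : R -> R, [/\ smooth setT theta, theta 0 = 0, derive1 theta 0 = 1 &
    forall s, D (w0 + theta s *: u)].
Proof.
move=> oD Dw.
have /nbhs_normP [e /= e0 he] : nbhs w0 D by exact: open_nbhs_nbhs.
pose q := e / (2 * (`|u| + 1)).
have u1 : 0 < `|u| + 1 by rewrite ltr_wpDl.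
have q0 : 0 < q by rewrite divr_gt0 // mulr_gt0.
exists (fun s => q * sin (q^-1 * s)); split.
- have oT := @openT R.
  apply: smooth_mul => //; first exact: smooth_cst.
  have sl : smooth setT (fun s : R => q^-1 * s).
    by apply: smooth_mul => //; [exact: smooth_cst|exact: smooth_id].
  exact: (smooth_comp has_dim_real has_dim_real oT oT (fun _ _ => I) sl smooth_sin).
- by rewrite mulr0 sin0 mulr0.
- apply: is_derive_val.
  have hl : is_derive (0 : R) (1 : R) (fun s : R => q^-1 * s) q^-1.
    have H := is_derive_mulr (is_derive_cst (q^-1 : R) (0 : R) (1 : R))
      (is_derive_id (0 : R) (1 : R)).
    by apply: is_derive_eq H _; rewrite mulr1 mul0r addr0.
  have hs : is_derive (0 : R) (1 : R) (fun s : R => sin (q^-1 * s)) q^-1.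
    have H := @is_derive1_comp R sin (fun s => q^-1 * s) 0 _ _ (is_derive_sin _) hl.
    by apply: is_derive_eq H _; rewrite mulr0 cos0 mul1r.
  have H := is_derive_mulr (is_derive_cst (q : R) (0 : R) (1 : R)) hs.
  by apply: is_derive_eq H _; rewrite mulr0 addr0 divff // gt_eqF.
- move=> s; apply: he => /=.
  rewrite opprD addrA subrr add0r normrN normrZ normrM gtr0_norm //.
  apply: (@le_lt_trans _ _ (q * (`|u| + 1))).
    rewrite -mulrA; apply: ler_wpM2l; first exact: ltW.
    apply: (@le_trans _ _ (1 * `|u|)); last by rewrite mul1r lerDl.
    by apply: ler_wpM2r => //; rewrite ler_norml sin_geN1 sin_le1.
  have -> : q * (`|u| + 1) = e / 2 by rewrite /q; field; rewrite gt_eqF.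
  lra.
Qed.

(** Lift a line segment in U_v by s_v and undo the rotation that moved z into the image
    of s_v. *)
Lemma curve_exists z (u : Cv) : Zv P v z ->
  exists theta : R -> R, exists c : R -> Z,
  [/\ smooth setT theta, theta 0 = 0, derive1 theta 0 = 1, smooth_curve c & c 0 = z] /\
  forall s, Zv P v (c s) /\ phihat v (val (c s)) = phihat v (val z) + theta s *: u.
Proof.
move=> zv; have Uw := phihat_Uset hT hP hv zv.
have oU : open (Uset P v) by exact: open_interior.
have [theta [st t0 t1 tU]] := curve_in_ball u oU Uw.
have [t tN tE] := N_normal_form hT hP hv zv.
pose t' f := - t f.
have tN' : in_N P texp t' by exact: in_NN.
pose w s := phihat v (val z) + theta s *: u.
pose c s : Z := rotateZ t' (lift_v z (w s)).
exists theta, c; split; first split => //.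
- have sw : smooth setT w.
    apply: smooth_add; [exact: openT|exact: smooth_cst|].
    by apply: smooth_scale => //; exact: openT.
  have sl : smooth setT (fun s => s_v P v (w s)).
    exact: (smooth_comp (has_dim_Cspace _) (has_dim_Cspace _) openT oU
      (fun s _ => tU s) sw (s_v_smooth hT hP hv)).
  have sr : smooth setT (fun s => rotate t' (s_v P v (w s))).
    exact: (smooth_comp (has_dim_Cspace _) (has_dim_Cspace _) openT openT
      (fun _ _ => I) sl (rotate_smooth t')).
  apply: smooth_ext sr => [|s _]; first exact: openT.
  by rewrite /c /= (val_lift_v hT hP hv _ (tU s)).
- apply: val_inj; rewrite /c /= (val_lift_v hT hP hv); last exact: tU.
  rewrite /w t0 scale0r addr0 -tE -rotateD (_ : (fun f => t' f + t f) = fun=> 0) ?rotate0 //.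
  by apply/funext => f; rewrite addNr.
- move=> s; split; first by apply/(Zv_rotateZ hT hP hv)/(Zv_lift_v hT hP hv)/tU.
  rewrite /c /= (phihat_N hT hP hv _ tN') (val_lift_v hT hP hv _ (tU s)).
  exact: (phihat_s_v hT hP hv (tU s)).
Qed.

End AtVertex.
End ReducedForm.

(** * The symplectic manifold M *)
Section SymplecticAtlas.
Context {R : realType} {n : nat} {F : finType} {T : topologicalZmodType}.
Variables (AT : atlas R T) (texp : {additive 'rV[R]_n -> T}).
Variables (P : polytope_data R n F).
Hypothesis hT : torus_with_exp AT texp.
Hypothesis hP : delzant P texp.
Implicit Types (Y xi v : 'rV[R]_n) (t : F -> R) (z : Ztype P).

Local Notation Fv := (facets_at P).
Local Notation Z := (Ztype P).
Local Notation M := (Mspace P texp).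
Local Notation p := (projM P texp).
Local Notation phihat := (phihat P).
Local Notation A := (M_atlas P texp).
Local Notation E := (Cspace R F).
Local Notation phi := (phi_v P texp).

(** The coordinate expression, from the chart at v to the chart at v', of the map of M
    induced by the rotation by t. For t = 0 it is the change of charts. *)
Definition transition v v' t (w : Cspace R (facet_index P v)) : Cspace R (facet_index P v') :=
  phihat v' (rotate t (s_v P v w)).
Definition transition_dom v v' : set (Cspace R (facet_index P v)) :=
  Uset P v `&` s_v P v @^-1` Dv P v'.

Arguments transition : clear implicits.
Arguments transition_dom : clear implicits.

Lemma open_transition_dom v v' : vertices (Delta P) v -> open (transition_dom v v').
Proof.
move=> hv; apply: smooth_preimage_open (@open_Dv _ _ _ P v'); first exact: open_interior.
exact: (s_v_smooth hT hP hv).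
Qed.

Lemma transition_smooth v v' t : vertices (Delta P) v ->
  smooth (transition_dom v v') (transition v v' t).
Proof.
move=> hv; have oD := open_transition_dom (v' := v') hv.
have ss : smooth (transition_dom v v') (s_v P v).
  by apply: smooth_sub (s_v_smooth hT hP hv) => w [].
have sr : smooth (transition_dom v v') (fun w => rotate t (s_v P v w)).
  by apply: (smooth_rotate (f := fun _ => t)) => // i; exact: smooth_cst.
apply: (smooth_comp (has_dim_Cspace _) (has_dim_Cspace _) oD (@open_Dv _ _ _ P v') _ sr
  (phihat_smooth P v')).
by move=> w [_ h] f fv; rewrite (zc_rotate t (s_v P v w) f) mulf_neq0 ?cis_neq0 //; exact: h.
Qed.

(** The rotation that moves z to s_v(phi_v(p z)) belongs to N, so that phihat v' does not
    notice it. *)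
Lemma transitionP v v' t z : vertices (Delta P) v -> vertices (Delta P) v' ->
  Zv P v z -> Zv P v' z ->
  transition_dom v v' (phi v (p z)) /\ phi v' (p (rotateZ t z)) = transition v v' t (phi v (p z)).
Proof.
move=> hv hv' zv zv'.
rewrite (phi_v_projM hT hP hv) // (phi_v_projM hT hP hv'); last by apply/(Zv_rotateZ hT hP hv').
have [s sN sE] := N_normal_form hT hP hv zv.
split.
  split; first exact: (phihat_Uset hT hP hv).
  move=> f fv; rewrite -sE (zc_rotate s (val z) f) mulf_neq0 ?cis_neq0 //.
  by have /(ZvDv hT hP hv') := zv'; apply.
rewrite /transition -sE -rotateD /=.
have -> : (fun i => t i + s i) = (fun i => s i + t i) by apply/funext => i; rewrite addrC.
by rewrite rotateD (phihat_N hT hP hv' _ sN).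
Qed.

Lemma rotateZ0 z : rotateZ (fun=> 0) z = z.
Proof. by apply: val_inj; rewrite /= rotate0. Qed.

Lemma M_smooth_manifold : smooth_manifold (2 * n)%N A.
Proof.
split; [exact: (M_hausdorff hT hP)|exact: (M_second_countable hT hP)|split].
- move=> [v hv] /=.
  have -> : (2 * n)%N = (#|{: facet_index P v}| + #|{: facet_index P v}|)%N.
    by rewrite card_sig (card_facets_at hT hP hv) mul2n addnn.
  exact: has_dim_Cspace.
- by move=> [v hv] /=; exact: (open_Mv hT hP hv).
- apply/seteqP; split=> // m _; have [v hv mv] := Mv_cover hT hP m.
  by exists (exist _ v hv).
- move=> [v hv] /=; split.
  + have cv : {within Mv P texp v, continuous (phi v : M -> Cspace R (facet_index P v))}.
      by apply: continuous_in_subspaceT => m; rewrite inE; exact: (phi_v_continuous hT hP hv).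
    exact: cv.
  + exact: (phi_v_inj hT hP hv).
  + by move=> U oU; exact: (phi_v_open hT hP hv oU).
- move=> [v hv] [v' hv'] /=.
  have key m : (Mv P texp v `&` Mv P texp v') m ->
      transition_dom v v' (phi v m) /\ phi v' m = transition v v' (fun=> 0) (phi v m).
    have [z <-] := projM_surj m => -[/(MvP hT hP hv) zv /(MvP hT hP hv') zv'].
    by have := transitionP (fun=> 0) hv hv' zv zv'; rewrite rotateZ0.
  apply: (smooth_via_of_smooth (open_transition_dom (v' := v') hv)
    (transition_smooth v' (fun=> 0) hv)).
    by move=> m /key [].
  by move=> m /key [].
Qed.

Lemma M_smooth_submersion : smooth_submersion_projM P texp.
Proof.
move=> [v hv] /=; split.
  apply: (smooth_via_of_smooth (@open_Dv _ _ _ P v) (phihat_smooth P v)).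
    by move=> z /(MvP hT hP hv) /(ZvDv hT hP hv).
  by move=> z /(MvP hT hP hv) zv; rewrite (phi_v_projM hT hP hv).
move=> z /(MvP hT hP hv) zv u.
have [theta [c [[st t0 t1 sc c0] hc]]] := curve_exists hT hP hv u zv.
exists c => //; split=> //.
have -> : (fun s => phi v (p (c s))) = (fun s => phihat v (val z) + theta s *: u).
  by apply/funext => s; have [zs <-] := hc s; rewrite (phi_v_projM hT hP hv).
have dth : differentiable theta 0 by exact: (smooth_differentiable st (I : setT 0)).
have lu : linear (fun r : R => r *: u) by move=> a x y; rewrite scalerDl scalerA.
pose L : {linear R -> Cspace R (facet_index P v)} := mklinear lu.
have cL : continuous L by move=> x; exact: scalel_continuous.
have dLth : differentiable (L \o theta) 0.
  by apply: differentiable_comp => //; exact: linear_differentiable.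
rewrite derive1E (deriveD (f := cst (phihat v (val z))) (g := L \o theta)).
- by rewrite derive_cst add0r -derive1E (derive1_lin_comp cL dth) t1 /= scale1r.
- exact: derivable_cst.
- exact: diff_derivable.
Qed.

Definition std_form : two_form A := fun i a u w => sigma u w.

Lemma std_form_reduced : reduced_form std_form.
Proof.
move=> c1 c2 s1 s2 c12 [v hv] c /(MvP hT hP hv) zv.
have zv2 : Zv P v (c2 0) by rewrite -c12.
apply: etrans (sigma_phihat hT hP hv s1 s2 c12 zv).
exact: (congr2 sigma (curve_phi_v hT hP hv s1 zv) (curve_phi_v hT hP hv s2 zv2)).
Qed.

(** All tangent vectors in a chart are images of velocities of curves in Z. *)
Lemma reduced_form_unique (w' : two_form A) : reduced_form w' -> forall i m, dom A i m ->
  w' i (chart A i m) = std_form (i := i) (chart A i m).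
Proof.
move=> hw' i m hm; apply/funext => u1; apply/funext => u2.
have [z zE] := projM_surj m; rewrite -zE in hm *.
have [_ sub] := M_smooth_submersion i.
have [c1 sc1 [c10 c1u]] := sub z hm u1.
have [c2 sc2 [c20 c2u]] := sub z hm u2.
have c12 : c1 0 = c2 0 by rewrite c10.
have hm1 : dom A i (p (c1 0)) by rewrite c10.
have := etrans (hw' c1 c2 sc1 sc2 c12 i hm1) (esym (std_form_reduced sc1 sc2 c12 hm1)).
by cbv zeta; rewrite c10 c1u c2u.
Qed.

Lemma rotate_velocity t (c : R -> Z) : smooth_curve c ->
  derive1 (fun s => val (rotateZ t (c s))) 0 = rotate t (derive1 (fun s => val (c s)) 0).
Proof.
move=> sc; have dc := curve_differentiable sc.
have lr : linear (rotate t : E -> E).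
  move=> a x y; apply: Cspace_ext => i.
    by rewrite rePart_lin !rePart_mkC rePart_lin imPart_lin; ring.
  by rewrite imPart_lin !imPart_mkC rePart_lin imPart_lin; ring.
pose L : {linear E -> E} := mklinear lr.
have cL : continuous L.
  by move=> z; exact: (smooth_continuous (rotate_smooth t)).
exact: (derive1_lin_comp cL dc).
Qed.

Lemma rotate_curve t (c : R -> Z) : smooth_curve c -> smooth_curve (fun s => rotateZ t (c s)).
Proof.
move=> sc; exact: (smooth_comp (has_dim_Cspace _) (has_dim_Cspace _) openT openT
  (fun _ _ => I) sc (rotate_smooth t)).
Qed.

(** Tangent vectors are represented by curves in Z, the form is sigma on their velocities, and
    rotations preserve sigma. The trivial rotation gives the compatibility of the charts,
    the others give the invariance under T. *)
Lemma std_form_invariant t (h : M -> M) : (forall z, h (p z) = p (rotateZ t z)) ->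
  pullback_eq h std_form std_form.
Proof.
move=> hE [v hv] [v' hv'] g /= gE m mv mv' u1 u2.
have [z zE] := projM_surj m; rewrite -zE {m zE} in mv mv' *.
have zv : Zv P v z by apply/(MvP hT hP hv).
have hzv' z0 : Mv P texp v' (h (p z0)) <-> Zv P v' z0.
  rewrite hE; split=> [/(MvP hT hP hv') /(Zv_rotateZ hT hP hv')|?] //.
  exact/(MvP hT hP hv')/(Zv_rotateZ hT hP hv').
have zv' : Zv P v' z by apply/hzv'.
set a := phi v (p z).
have [Da _] := transitionP t hv hv' zv zv'.
have oD := open_transition_dom (v' := v') hv.
(* g represents h in coordinates, hence agrees near a with the transition and is differentiable *)
have near_g : \forall b \near a, transition v v' t b = g b.
  apply: filterS (open_nbhs_nbhs (conj oD Da)) => b [Ub Db].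
  have zb : Zv P v (lift_v z b) by exact: (Zv_lift_v hT hP hv).
  have zb' : Zv P v' (lift_v z b) by apply/(ZvDv hT hP hv'); rewrite (val_lift_v hT hP hv).
  have pb : phi v (p (lift_v z b)) = b by exact: (phi_v_point_v hT hP hv z Ub).
  have [_ tb] := transitionP t hv hv' zb zb'.
  rewrite pb in tb; rewrite -tb -hE -[in RHS]pb; apply/esym/gE; first exact/(MvP hT hP hv).
  exact/hzv'.
have dg : differentiable g a.
  apply: near_eq_differentiable near_g _.
  exact: (smooth_differentiable (transition_smooth v' t hv) Da).
have vel u : exists c : R -> Z, [/\ smooth_curve c, c 0 = z,
    derive1 (fun s => phi v (p (c s))) 0 = u &
    derive1 (fun s => phi v' (p (rotateZ t (c s)))) 0 = 'd g a u].
  have [_ sub] := M_smooth_submersion (exist _ v hv : idx A).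
  have [c sc [c0 cu]] := sub z mv u; exists c; split=> //.
  have zc0 : Zv P v (c 0) by rewrite c0.
  have zc0' : Zv P v' (c 0) by rewrite c0.
  transitivity (derive1 (fun s => g (phihat v (val (c s)))) 0).
    apply: near_eq_derive1; near=> s.
    have zs : Zv P v (c s) by near: s; exact: (curve_near_Zv hT hP hv).
    have zs' : Zv P v' (c s) by near: s; exact: (curve_near_Zv hT hP hv').
    rewrite -hE -(phi_v_projM hT hP hv zs); apply/esym/gE; first exact/(MvP hT hP hv).
    exact/hzv'.
  have dc := curve_differentiable sc.
  have dph : differentiable (phihat v \o (fun s => val (c s))) 0.
    apply: differentiable_comp => //.
    by apply: (smooth_differentiable (phihat_smooth P v)); apply/(ZvDv hT hP hv).
  have aE : phihat v (val (c 0)) = a by rewrite /a c0 (phi_v_projM hT hP hv).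
  rewrite (derive1_comp_diff (c := phihat v \o (fun s => val (c s))) dph) /= aE //.
  by rewrite -(curve_phi_v hT hP hv sc zc0) cu.
have [c1 [sc1 c10 c1u c1g]] := vel u1; have [c2 [sc2 c20 c2u c2g]] := vel u2.
rewrite -c1g -c2g -c1u -c2u.
have c12 : c1 0 = c2 0 by rewrite c10.
have m1 : dom A (exist _ v hv : idx A) (p (c1 0)) by rewrite c10.
have m2 : dom A (exist _ v' hv' : idx A) (p (rotateZ t (c1 0))) by rewrite c10 -hE.
apply: (etrans (std_form_reduced (rotate_curve t sc1) (rotate_curve t sc2)
  (congr1 (rotateZ t) c12) m2)).
apply: esym; apply: (etrans (std_form_reduced sc1 sc2 c12 m1)).
by rewrite (rotate_velocity t sc1) (rotate_velocity t sc2) sigma_rotate.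
Unshelve. all: by end_near. Qed.

(** In every chart the form is constant, hence closed. *)
Lemma std_form_symplectic : symplectic_form std_form.
Proof.
split.
  by apply: (@std_form_invariant (fun=> 0)) => z; rewrite rotateZ0.
move=> i c; split=> [x ix a u u' w|x ix u|u w|x ix u1 u2 u3|x ix u h].
- exact: sigma_linear.
- exact: sigma_diag.
- apply: (smooth_via_of_smooth (g := fun _ => sigma u w) (O := setT)) => //.
    exact: openT.
  exact: smooth_cst.
- by rewrite /std_form !derive_cst !addr0.
- exact: sigma_nondegenerate.
Qed.

End SymplecticAtlas.

(** * The Hamiltonian torus action *)
Section TorusAction.
Context {R : realType} {n : nat} {F : finType} {T : topologicalZmodType}.
Variables (AT : atlas R T) (texp : {additive 'rV[R]_n -> T}).
Variables (P : polytope_data R n F).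
Hypothesis hT : torus_with_exp AT texp.
Hypothesis hP : delzant P texp.
Implicit Types (Y xi v : 'rV[R]_n) (t : F -> R) (z : Ztype P).

Local Notation Fv := (facets_at P).
Local Notation Z := (Ztype P).
Local Notation M := (Mspace P texp).
Local Notation p := (projM P texp).
Local Notation phihat := (phihat P).
Local Notation A := (M_atlas P texp).
Local Notation E := (Cspace R F).
Local Notation phi := (phi_v P texp).
Local Notation edge := (edge P).

Definition coords v Y : F -> R := fun f => if f \in Fv v then pairing Y (edge v f) else 0.

Lemma piF_coords v Y : vertices (Delta P) v -> piF P (coords v Y) = Y.
Proof.
move=> hv; have [_ h] := edge_dual hT hP hv; rewrite [RHS]h /piF [RHS]big_mkcond.
by apply: eq_bigr => f _; rewrite /coords; case: ifP => // _; rewrite scale0r.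
Qed.

Lemma ex_piF (tau : T) : exists t, texp (piF P t) = tau.
Proof.
have [Y <-] := texp_surjective hT tau; have [v hv] := ex_vertex hP.
by exists (coords v Y); rewrite piF_coords.
Qed.

(** T is the quotient of R^F / Z^F by N, so a rotation representing tau exists and its effect
    on M is independent of the choice ([act_projM]). *)
Definition act (tau : T) (m : M) : M := p (rotateZ (sval (cid (ex_piF tau))) (repr m)).

Lemma in_N_sub t t' : texp (piF P t) = texp (piF P t') -> in_N P texp (fun f => t f - t' f).
Proof.
move=> h; rewrite /in_N /piF; under eq_bigr do rewrite scalerBl.
by rewrite sumrB raddfB /= -/(piF P t) -/(piF P t') h subrr.
Qed.

Lemma act_projM t z : act (texp (piF P t)) (p z) = p (rotateZ t z).
Proof.
rewrite /act; case: (cid _) => t' /= t'E.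
have /(projM_eqP texp) [s sN sE] : p z = p (repr (p z)) by rewrite projM_repr.
apply/(projM_eqP texp); exists (fun f => (t f - t' f) + - s f).
  by apply: in_ND; [exact: in_N_sub|exact: in_NN].
apply: val_inj; rewrite /= sE /= -!rotateD; congr (rotate _ _); apply/funext => f; ring.
Qed.

Lemma act_rotation tau : exists t, forall z, act tau (p z) = p (rotateZ t z).
Proof. by have [t <-] := ex_piF tau; exists t => z; exact: act_projM. Qed.

Lemma act0 m : act 0 m = m.
Proof.
have [z <-] := projM_surj m.
have <- : texp (piF P (fun=> 0)) = 0 by exact: in_N0.
by rewrite act_projM rotateZ0.
Qed.

Lemma actD (s1 s2 : T) m : act (s1 + s2) m = act s1 (act s2 m).
Proof.
have [z <-] := projM_surj m; have [a <-] := ex_piF s1; have [b <-] := ex_piF s2.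
have <- : texp (piF P (fun f => a f + b f)) = texp (piF P a) + texp (piF P b).
  rewrite -raddfD /piF -big_split; congr (texp _); apply: eq_bigr => f _; exact: scalerDl.
rewrite !act_projM; congr (p _); apply: val_inj; exact: rotateD.
Qed.

Lemma muT_act tau m : muT (act tau m) = muT m.
Proof.
have [z <-] := projM_surj m; have [t ->] := act_rotation tau.
by rewrite !(muT_projM hT hP) /= (muZ_rotate hT hP).
Qed.

Lemma Mv_act v tau m : vertices (Delta P) v -> Mv P texp v (act tau m) <-> Mv P texp v m.
Proof. by move=> hv; rewrite !(MvE hT hP hv) /= muT_act. Qed.

(** In the chart at v the torus acts by rotation of the coordinates, by [phihat_rotate]. *)
Lemma phi_v_act v Y m : vertices (Delta P) v -> Mv P texp v m ->
  phi v (act (texp Y) m) = rotate (fun f => pairing Y (edge v (val f))) (phi v m).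
Proof.
move=> hv mv; have [z zE] := projM_surj m; rewrite -zE {m zE} in mv *.
have zv : Zv P v z by apply/(MvP hT hP hv).
rewrite -{1}(piF_coords Y hv) act_projM (phi_v_projM hT hP hv zv).
rewrite (phi_v_projM hT hP hv); last by apply/(Zv_rotateZ hT hP hv).
by rewrite /= (phihat_rotate hT hP hv) /tcoord piF_coords.
Qed.

(** An element acting trivially fixes a generic point, all of whose coordinates in the chart
    are nonzero, hence its logarithm has integral coordinates in the basis at v. *)
Lemma act_effective : effective act.
Proof.
move=> tau h; have [Y YE] := texp_surjective hT tau; rewrite -YE in h *.
have [v hv] := ex_vertex hP; have [z0 z0P] := generic_point hT hP.
have zv : Zv P v z0 by apply/(ZvDv hT hP hv) => f _; exact: z0P.
have mv : Mv P texp v (p z0) by apply/(MvP hT hP hv).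
have := phi_v_act Y hv mv; rewrite h (phi_v_projM hT hP hv zv) => rE.
apply: (lattice_of_coord hT hP hv) => f fv.
have := congr1 (fun w => zc w (facet_of fv)) rE.
have w0 : zc (phihat v (val z0)) (facet_of fv) != 0.
  by rewrite -mu_gt0 (mu_phihat _ (fun f' _ => z0P f')) mu_gt0 z0P.
rewrite /= zc_rotate -[LHS]mul1r => /(mulIf w0) /esym; exact: cis_eq1.
Qed.

(** Locally tau = texp (l tau) with l smooth, and texp Y acts by rotations that depend
    linearly on Y; the change of charts is the transition for t = 0. *)
Lemma act_smooth_via a (i j : idx A) :
  smooth_via (chart (prod_atlas AT A) (a, i))
    (dom (prod_atlas AT A) (a, i) `&` (fun sm => act sm.1 sm.2) @^-1` dom A j)
    (fun sm => chart A j (act sm.1 sm.2)).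
Proof.
case: i j => [v hv] [v' hv'] [t0 m0] /= [[/= at0 mv0] mv0'].
have hA := torus_atlas hT.
have [dimA _ _ homeoA _] := hA.
have [D [l [oD Dt0 Da lE sl]]] := local_log hT at0.
have [W1 [g1 [oW1 W1t0 sg1 g1E]]] := sl t0 Dt0.
have [_ injA openA] := homeoA a.
pose W2 := W1 `&` chart AT a @` D.
have oW2 : open W2 by apply: openI => //; exact: openA.
have W2D (t : T) : dom AT a t -> W2 (chart AT a t) -> l t = g1 (chart AT a t) /\ D t.
  move=> at_ [W1t [t' Dt' t'E]].
  have tt' : t' = t by apply: injA; rewrite ?inE //; exact: Da.
  by rewrite -tt'; split=> //; apply: g1E => //; rewrite tt'.
pose Ev := Cspace R (facet_index P v).
pose fst' := (fun xw : (model AT a * Ev)%type => xw.1).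
pose snd' := (fun xw : (model AT a * Ev)%type => xw.2).
have sfst : smooth setT fst' by apply: smooth_fst_comp; [exact: openT|exact: smooth_id].
have ssnd : smooth setT snd' by apply: smooth_snd_comp; [exact: openT|exact: smooth_id].
have oTD := open_transition_dom hT hP (v' := v') hv.
pose B := (setT `&` fst' @^-1` W2) `&` (setT `&` snd' @^-1` (@transition_dom R n F P v v')).
have oB : open B by apply: openI; apply: smooth_preimage_open => //; exact: openT.
pose g (xw : (model AT a * Ev)%type) : Cspace R (facet_index P v') :=
  rotate (fun f => pairing (g1 xw.1) (edge v' (val f))) (@transition R n F P v v' (fun=> 0) xw.2).
have sg : smooth B g.
  have sB1 : smooth B fst' by apply: smooth_sub sfst.
  have sB2 : smooth B snd' by apply: smooth_sub ssnd.
  apply: (smooth_rotate (f := fun xw f => pairing (g1 xw.1) (edge v' (val f)))) => // [f|].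
    have sg1B : smooth B (fun xw => g1 (fst' xw)).
      apply: (smooth_comp (dimA a) (has_dim_rV n) oB oW1) sB1 sg1.
      by move=> xw [[_ []]].
    have le : linear (pairing (edge v' (val f))) by move=> b x y; rewrite pairingDr pairingZr.
    pose L : {linear 'rV[R]_n -> R} := mklinear le.
    have sL := smooth_lin_comp (L := L) oB (@pairing_continuous R n _) sg1B.
    by apply: smooth_ext sL => // xw _; exact: pairingC.
  apply: (smooth_comp (has_dim_Cspace _) (has_dim_Cspace _) oB oTD) sB2
    (transition_smooth hT hP v' (fun=> 0) hv).
  by move=> xw [_ []].
have key (t : T) m : dom AT a t -> Mv P texp v m -> Mv P texp v' (act t m) ->
    (@transition_dom R n F P v v') (phi v m) /\ (W2 (chart AT a t) ->
      phi v' (act t m) = g (chart AT a t, phi v m)).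
  move=> at_ mv /(Mv_act _ _ hv') mv'.
  have [z zE] := projM_surj m.
  have zv : Zv P v z by apply/(MvP hT hP hv); rewrite zE.
  have zv' : Zv P v' z by apply/(MvP hT hP hv'); rewrite zE.
  have := transitionP hT hP (fun=> 0) hv hv' zv zv'; rewrite rotateZ0 zE => -[td tE].
  split=> // /(W2D _ at_) [lt Dt].
  rewrite /g /= -lt -tE -{1}(lE t Dt); exact: phi_v_act.
exists B, g; split=> //.
  have [td _] := key t0 m0 at0 mv0 mv0'.
  by split; split=> //; split=> //; exists t0.
move=> [t m] /= [[at_ mv] mv'] [[_ W2t] _].
by have [_] := key t m at_ mv mv'; apply.
Qed.

(** Near a given point the action stays in the domain of one chart, since chart domains are
    invariant, and there it is smooth in coordinates. *)
Lemma act_continuous : continuous (fun sm : (T * M)%type => act sm.1 sm.2).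
Proof.
move=> [t0 m0].
have [v hv mv0] := Mv_cover hT hP m0.
have hA := torus_atlas hT.
have [a at0] := atlas_cover hA t0.
pose i : idx A := exist _ v hv.
pose f (sm : (T * M)%type) := phi v (act sm.1 sm.2).
have near_dom : nbhs (t0, m0) (dom AT a `*` Mv P texp v).
  exists (dom AT a, Mv P texp v) => //; split; first exact: (atlas_dom_nbhs hA at0).
  by apply: open_nbhs_nbhs; split => //; exact: (open_Mv hT hP hv).
have cf : {for (t0, m0), continuous f}.
  apply: (smooth_via_continuous_at _ _ (@act_smooth_via a i i)).
    apply: filterS near_dom => -[t m] [at_ mv]; split=> //=.
    by apply/(Mv_act _ _ hv).
  have c1 : {for (t0, m0), continuous (chart AT a \o fst : T * M -> model AT a)}.
    apply: continuous_comp; first exact: cvg_fst.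
    exact: (atlas_chart_continuous hA at0).
  have c2 : {for (t0, m0), continuous (phi v \o snd : T * M -> Cspace R (facet_index P v))}.
    apply: continuous_comp; first exact: cvg_snd.
    exact: (phi_v_continuous hT hP hv mv0).
  exact: (cvg_pair c1 c2).
have [z0 _] := generic_point hT hP.
have mva : Mv P texp v (act t0 m0) by apply/(Mv_act _ _ hv).
have Uf : Uset P v (f (t0, m0)) by exact: (phi_v_Uset hT hP hv).
have cpf := @continuous_comp _ _ _ f (point_v texp z0) (t0, m0) cf
  (point_v_continuous hT hP hv Uf).
have E0 : point_v texp z0 (f (t0, m0)) = act t0 m0 by exact: (point_v_phi_v hT hP hv).
rewrite /prop_for /continuous_at /= -E0; apply: cvg_trans cpf; apply: near_eq_cvg.
apply: filterS near_dom => -[t m] [/= at_ mv].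
by rewrite /f /= (point_v_phi_v hT hP hv) //; apply/(Mv_act _ _ hv).
Qed.

Lemma act_smooth : smooth_action AT A act.
Proof.
split; [exact: act0|exact: actD|split; first exact: act_continuous].
by move=> [a i] j; exact: act_smooth_via.
Qed.

Lemma muT_phi_v v m : vertices (Delta P) v -> Mv P texp v m -> muT m = mu_v P v (phi v m).
Proof.
move=> hv mv; have [z zE] := projM_surj m; rewrite -zE {m zE} in mv *.
have zv : Zv P v z by apply/(MvP hT hP hv).
by rewrite (muT_projM hT hP) (phi_v_projM hT hP hv zv) (mu_v_phihat hT hP hv zv).
Qed.

Lemma muT_smooth : smooth_map A (flat_atlas 'rV[R]_n) (@muT R n F T texp P).
Proof.
split; first exact: (muT_continuous hT hP).
move=> [v hv] [] /=.
apply: (smooth_via_of_smooth (g := mu_v P v) openT (mu_v_smooth hT hP hv)) => // m [mv _].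
exact: muT_phi_v.
Qed.

Lemma rotate_derive (J : finType) (c : J -> R) (w : Cspace R J) i :
  zc (derive1 (fun s : R => rotate (fun i => s * c i) w) 0) i = Complex 0 (2 * pi * c i) * zc w i.
Proof.
have sr : smooth setT (fun s : R => rotate (fun i => s * c i) w).
  apply: (@smooth_rotate R R setT J (fun s i => s * c i) (fun _ => w)) => [|j|];
    [exact: openT| |exact: smooth_cst].
  by apply: smooth_mul; [exact: openT|exact: smooth_id|exact: smooth_cst].
have dr := smooth_differentiable sr (I : setT 0).
have hl (k : R) : is_derive (0 : R) (1 : R) (fun s : R => 2 * pi * (s * k)) (2 * pi * k).
  have H := is_derive_mulr (is_derive_cst (2 * pi : R) (0 : R) (1 : R))
    (is_derive_mulr (is_derive_id (0 : R) (1 : R)) (is_derive_cst (k : R) (0 : R) (1 : R))).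
  by apply: is_derive_eq H _; rewrite /cst /=; ring.
have hcis : is_cderive (fun s => cis (s * c i)) (Complex 0 (2 * pi * c i)).
  split => /=.
    have H := @is_derive1_comp R cos (fun s => 2 * pi * (s * c i)) 0 _ _
      (is_derive_cos _) (hl (c i)).
    by apply: is_derive_eq H _; rewrite mul0r mulr0 sin0 oppr0 mul0r.
  have H := @is_derive1_comp R sin (fun s => 2 * pi * (s * c i)) 0 _ _
    (is_derive_sin _) (hl (c i)).
  by apply: is_derive_eq H _; rewrite mul0r mulr0 cos0 mul1r.
have hw : is_cderive (fun=> zc w i) 0 by exact: cderive_cst.
have H := cderive_mul hcis hw.
have E1 : (fun s => cis (s * c i) * zc w i) = (fun s => zc (rotate (fun i => s * c i) w) i).
  by apply/funext => s; rewrite (zc_rotate (fun i => s * c i) w i).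
rewrite E1 in H; apply: (etrans (cderive_unique (cderive_zc i dr) H)).
by rewrite mulr0 addr0.
Qed.

Lemma omega_rotation (k : R) (a b : complex R) :
  omega (Complex 0 k * a) b = - (k * radial a b).
Proof. by case: a b => [a1 a2] [b1 b2]; rewrite /omega /radial /=; ring. Qed.

Lemma derive_pairing_mu_v v Y (w u : Cspace R (facet_index P v)) : vertices (Delta P) v ->
  'D_u (fun b => pairing Y (mu_v P v b)) w =
  \sum_(f : facet_index P v) pairing Y (edge v (val f)) * radial (zc w f) (zc u f).
Proof.
move=> hv.
have lY : linear (pairing Y) by move=> b x y; rewrite pairingDr pairingZr.
pose L : {linear 'rV[R]_n -> R} := mklinear lY.
have sH : smooth setT (fun b => pairing Y (mu_v P v b)).
  exact: (smooth_lin_comp (L := L) openT (@pairing_continuous R n Y) (mu_v_smooth hT hP hv)).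
have dH := smooth_differentiable sH (I : setT w).
pose c (s : R) : Cspace R (facet_index P v) := w + s *: u.
have sc : smooth setT c.
  apply: smooth_add; [exact: openT|exact: smooth_cst|].
  by apply: smooth_scale; [exact: openT|exact: smooth_id].
have dc := smooth_differentiable sc (I : setT 0).
have c0 : c 0 = w by rewrite /c scale0r addr0.
have lu : linear (fun r : R => r *: u) by move=> a x y; rewrite scalerDl scalerA.
pose Lu : {linear R -> Cspace R (facet_index P v)} := mklinear lu.
have cLu : continuous Lu by move=> x; exact: scalel_continuous.
have c'0 : derive1 c 0 = u.
  rewrite derive1E (deriveD (f := cst w) (g := Lu)); [|exact: derivable_cst|].
    rewrite derive_cst add0r deriveE; last exact: linear_differentiable.
    by rewrite (diff_lin _ cLu) /= scale1r.
  by apply: diff_derivable; exact: linear_differentiable.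
have -> : 'D_u (fun b => pairing Y (mu_v P v b)) w =
    derive1 (fun s => pairing Y (mu_v P v (c s))) 0.
  rewrite (derive1_comp_diff (c := c) (g := fun b => pairing Y (mu_v P v b)) dc) c0 // c'0.
  by rewrite deriveE.
have -> : (fun s => pairing Y (mu_v P v (c s))) = (fun s => \sum_(f : facet_index P v)
    pairing Y (edge v (val f)) * (mu (c s) f - offset P (val f))).
  apply/funext => s; rewrite (mu_vE hT hP hv) pairing_sumr; apply: eq_bigr => f _.
  by rewrite pairingZr mulrC.
apply: is_derive_val; apply: is_derive_sum_fin => f _.
have Hm := is_derive_subr (mu_derive f dc) (is_derive_cst (offset P (val f)) (0 : R) (1 : R)).
have H := is_derive_mulr (is_derive_cst (pairing Y (edge v (val f)) : R) (0 : R) (1 : R)) Hm.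
by apply: is_derive_eq H _; rewrite c0 c'0 /cst mulr0 addr0 subr0.
Qed.

(** In the chart at v, the vector field of Y rotates the coordinate f with speed
    2 pi <Y, edge v f>, and <Y, mu_v> is the combination of the |z_f|^2 / 2 with coefficients
    <Y, edge v f>; the factor 2 pi cancels that of sigma. *)
Lemma act_hamiltonian :
  hamiltonian_action texp (@std_form R n F T texp P) act (@muT R n F T texp P).
Proof.
split.
- move=> tau; have [t tE] := act_rotation tau; exact: (std_form_invariant hT hP tE).
- exact: muT_smooth.
- by move=> tau m; exact: muT_act.
move=> Y [v hv] h hE m mv u.
have Uw := phi_v_Uset hT hP hv mv.
set w := phi v m in Uw *.
have -> : 'D_u h (chart A (exist _ v hv) m) = 'D_u (fun b => pairing Y (mu_v P v b)) w.
  apply: near_eq_derive; apply: filterS (open_nbhs_nbhs (conj (open_interior _) Uw)) => b Ub.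
  have [z0 _] := generic_point hT hP.
  have mb := Mv_point_v hT hP hv z0 Ub.
  have bE : phi v (point_v texp z0 b) = b by exact: (phi_v_point_v hT hP hv).
  by have := hE _ mb; rewrite /= bE (muT_phi_v hv mb) bE.
rewrite (derive_pairing_mu_v Y w u hv).
have -> : (fun s : R => chart A (exist _ v hv) (act (texp (s *: Y)) m)) =
    (fun s : R => rotate (fun f => s * pairing Y (edge v (val f))) w).
  apply/funext => s; apply: (etrans (phi_v_act (s *: Y) hv mv)).
  by congr (rotate _ _); apply/funext => f; rewrite pairingZl.
rewrite /std_form sigmaE -sumrN mulr_sumr; apply: eq_bigr => f _.
apply: (etrans (congr1 (fun a => _ * omega a _) (rotate_derive _ w f))).
rewrite omega_rotation mulrN mulrA mulrA mulVf ?mul1r //.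
by rewrite mulf_neq0 // gt_eqF // pi_gt0.
Qed.

(** A rotation fixing z has integral angles where z_f is nonzero, in particular outside F_v;
    an element of N with integral components outside F_v is integral. *)
Lemma rotateZ_free t z : in_N P texp t -> rotateZ t z = z -> forall f, t f \is a Num.int.
Proof.
move=> tN zE; have [v hv zv] := Zv_cover hT hP z.
have out f : f \notin Fv v -> t f \is a Num.int.
  move=> fv; have z0 := (ZvDv hT hP hv z).1 zv f fv.
  have := congr1 (fun z : Z => zc (val z) f) zE; rewrite /= (zc_rotate t (val z) f) -[RHS]mul1r.
  by move=> /(mulIf z0); exact: cis_eq1.
move=> f; have [fv|] := boolP (f \in Fv v); last exact: out.
have := (in_N_tcoord hT hP hv t).1 tN (facet_of fv).
rewrite (tcoordE hT hP hv) /= => h.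
rewrite -[t f](addrK (\sum_(f' | f' \notin Fv v) (coef P v f' f)%:~R * t f')) rpredB //.
by apply: rpred_sum => f' f'v; rewrite rpredM ?intr_int // out.
Qed.

Lemma phi_v_act_iota v (t : facet_index P v -> R) m : vertices (Delta P) v -> Mv P texp v m ->
  phi v (act (texp (piF P (iota_v P v t))) m) = rotate t (phi v m).
Proof.
move=> hv mv; rewrite phi_v_act //; congr (rotate _ _); apply/funext => f.
rewrite -/(tcoord (iota_v P v t) f) (tcoordE hT hP hv) /iota_v valK big1 ?addr0 // => f' f'v.
by rewrite insubF ?mulr0 // (negbTE f'v).
Qed.

End TorusAction.

(** * The reduced space of a Delzant polytope *)
Theorem corollary3p6 (R : realType) (n : nat)
    (T : topologicalZmodType) (AT : atlas R T)
    (texp : {additive 'rV[R]_n -> T}) (hT : torus_with_exp AT texp)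
    (F : finType) (P : polytope_data R n F) (hP : delzant P texp) :
  let V := vertices (Delta P) in
  let Z := Ztype P in
  let M := Mspace P texp in
  let p : Z -> M := projM P texp in
  let A := M_atlas P texp in
  let M_ := Mv P texp in
  let phi := phi_v P texp in
  [/\ \bigcup_(v in V) Zv P v = [set: Z],
      smooth_submanifold (Zset P) (n + #|F|)%N &
      forall t : F -> R, in_N P texp t -> forall z : Z,
        rotateZ t z = z -> forall f, t f \is a Num.int] /\
  [/\ [set: M] !=set0, compact [set: M], connected [set: M],
      smooth_manifold (2 * n)%N A & smooth_submersion_projM P texp] /\
  [/\ forall v, V v -> open (M_ v),
      \bigcup_(v in V) M_ v = [set: M],
      forall v, V v -> forall m, M_ v m -> psi_v P texp v (phi v m) m &
      forall v, V v -> forall z, Uset P v z ->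
        exists2 m, M_ v m & psi_v P texp v z m /\ phi v m = z] /\
  exists (w : two_form A) (act : T -> M -> M) (muT : M -> 'rV[R]_n),
    [/\ symplectic_form w, reduced_form w &
        forall w' : two_form A, reduced_form w' -> forall i m, dom A i m ->
          w' i (chart A i m) = w i (chart A i m)] /\
    [/\ smooth_action AT A act,
        forall (t : F -> R) (z : Z), act (texp (piF P t)) (p z) = p (rotateZ t z),
        effective act &
        hamiltonian_action texp w act muT] /\
    [/\ forall (z : Z) f,
          piF_dual P (muT (p z)) f = mu (val z) f - offset P f &
        forall mu' : M -> 'rV[R]_n,
          (forall (z : Z) f,
             piF_dual P (mu' (p z)) f = mu (val z) f - offset P f) ->
          mu' = muT] /\
    forall v (hv : V v),
      [/\ forall m, M_ v m ->
            w (exist _ v hv) (phi v m) = @sigma R (facet_index P v),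
          forall (t : facet_index P v -> R) m, M_ v m ->
            let tau := texp (piF P (iota_v P v t)) in
            M_ v (act tau m) /\ phi v (act tau m) = rotate t (phi v m),
          M_ v = muT @^-1` Delta_v P v &
          forall m, M_ v m -> muT m = mu_v P v (phi v m)].
Proof.
move=> V Z M p A M_ phi.
have psiP v : V v -> forall w, Uset P v w ->
    exists2 m, M_ v m & psi_v P texp v w m /\ phi v m = w.
  move=> hv w Uw; have [z0 _] := generic_point hT hP.
  have psi := psi_v_point_v hT hP hv z0 Uw.
  exists (point_v texp z0 w); first exact: (Mv_point_v hT hP hv z0 Uw).
  by split=> //; exact: (phi_v_point_v hT hP hv z0 Uw).
split; [split|split; [split|split; [split|]]].
- apply/seteqP; split=> // z _; have [v hv zv] := Zv_cover hT hP z.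
  by exists v.
- exact: (Zset_submanifold hT hP).
- by move=> t tN z; exact: (rotateZ_free hT hP tN).
- by have [z0 _] := generic_point hT hP; exists (p z0).
- exact: (M_compact hT hP).
- exact: (M_connected hT hP).
- exact: (M_smooth_manifold hT hP).
- exact: (M_smooth_submersion hT hP).
- by move=> v hv; exact: (open_Mv hT hP hv).
- apply/seteqP; split=> // m _; have [v hv mv] := Mv_cover hT hP m.
  by exists v.
- by move=> v hv m; exact: (psi_v_phi_v hT hP hv).
- exact: psiP.
exists (@std_form R n F T texp P), (act hT hP), (@muT R n F T texp P).
split; [split|split; [split|split; [split|]]].
- exact: (std_form_symplectic hT hP).
- exact: (std_form_reduced hT hP).
- by move=> w' hw' i m hm; exact: (reduced_form_unique hT hP hw' hm).
- exact: (act_smooth hT hP).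
- by move=> t z; exact: act_projM.
- exact: act_effective.
- exact: act_hamiltonian.
- by move=> z f; rewrite (mu_muT hT hP z f) /slack addrK.
- move=> mu' hmu'; apply/funext => m; have [z <-] := projM_surj m.
  apply: (normal_span hP) => f.
  have := hmu' z f; rewrite (mu_muT hT hP z f) /slack addrK; exact.
move=> v hv; split.
- by [].
- move=> t m mv tau; split; first by apply/(Mv_act hT hP _ _ hv).
  exact: phi_v_act_iota.
- exact: (MvE hT hP hv).
- by move=> m mv; exact: (muT_phi_v hT hP hv mv).
Qed.
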